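(* Let $(G,\Gamma)$ be a Hecke pair and let $\alpha$ be the action induced by right multiplication of $G$ on itself (so $\overline{\alpha}$ is right translation on functions on $G$). The full crossed product $C_0(G/\Gamma)\times_{\alpha}G/\Gamma$ exists and moreover $$C_0(G/\Gamma)\times_{\alpha}G/\Gamma\;\cong\;C_0(G/\Gamma)\times_{\alpha,r}G/\Gamma\;\cong\;\mathcal{K}(\ell^2(G/\Gamma)).$$ Denoting by $M:C_0(G/\Gamma)\to B(\ell^2(G/\Gamma))$ the $*$-representation by pointwise multiplication and by $\rho$ the right regular representation of $\mathcal{H}(G,\Gamma)$, $(M,\rho)$ is a covariant $*$-representation and $M\times\rho$ is a faithful $*$-representation of $C_0(G/\Gamma)\times_{\alpha}G/\Gamma$ with range $\mathcal{K}(\ell^2(G/\Gamma))$.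
   Context: **Hecke pairs.** $(G,\Gamma)$ is a Hecke pair if $\Gamma\subseteq G$ is a subgroup such that every double coset $\Gamma g\Gamma$ is a finite union of left (and of right) cosets. $\Gamma^g:=\Gamma\cap g\Gamma g^{-1}$, $L(g)=|\Gamma g\Gamma/\Gamma|$, $R(g)=|\Gamma\backslash\Gamma g\Gamma|$, $\Delta(g)=L(g)/R(g)$. $\mathcal{H}(G,\Gamma)$ is the $*$-algebra of finitely supported functions on $\Gamma\backslash G/\Gamma$ with $(f_1*f_2)(\Gamma g\Gamma)=\sum_{h\Gamma\in G/\Gamma}f_1(\Gamma h\Gamma)f_2(\Gamma h^{-1}g\Gamma)$, $f^*(\Gamma g\Gamma)=\Delta(g^{-1})\overline{f(\Gamma g^{-1}\Gamma)}$; $\Gamma g\Gamma$ also denotes the characteristic function of that double coset. The right regular representation $\rho$ on $\ell^2(G/\Gamma)$ is $(\rho(f)\xi)(g\Gamma)=\sum_{[h]\in G/\Gamma}\Delta(h)^{1/2}f(\Gamma h\Gamma)\xi(gh\Gamma)$. **Crossed product.** Put $(\overline{\alpha}_gf)(x)=f(xg)$ for functions $f$ on $G$. For a subgroup $H\subseteq G$, $C_c(G/H)$ is the algebra of finitely supported functions on $G/H$, viewed as right $H$-invariant functions on $G$. Let $\mathfrak{B}$ be the $*$-algebra of finitely supported functions $f$ from $G/\Gamma$ to functions on $G$ with $f(\gamma g\Gamma)=\overline{\alpha}_\gamma(f(g\Gamma))$ for $\gamma\in\Gamma$, with $(f_1*f_2)(g\Gamma)=\sum_{[h]\in G/\Gamma}f_1(h\Gamma)\overline{\alpha}_h(f_2(h^{-1}g\Gamma))$,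 $f^*(g\Gamma)=\Delta(g^{-1})\overline{\overline{\alpha}_g(f(g^{-1}\Gamma))}$. $C_c(G/\Gamma)\times^{alg}_\alpha G/\Gamma$ is the $*$-subalgebra of those $f$ with $f(g\Gamma)\in C_c(G/\Gamma^g)$ for all $g$. $C_c(G/\Gamma)$ is identified with functions supported on the coset $\Gamma$, and $\mathcal{H}(G,\Gamma)\subseteq\mathfrak{B}$ via $f\mapsto(g\Gamma\mapsto f(\Gamma g\Gamma)1)$. The crossed product is spanned by the elements $1_{x\Gamma}*\Gamma g\Gamma*1_{xg\Gamma}$, and contains all $\Gamma g\Gamma*1_{x\Gamma}*\Gamma s\Gamma$. **Full and reduced completions.** $C_0(G/\Gamma)\times_\alpha G/\Gamma$ is the completion in $\|f\|_u=\sup_\Phi\|\Phi(f)\|$, over all $*$-representations $\Phi$ of $C_c(G/\Gamma)\times^{alg}_\alpha G/\Gamma$ on Hilbert spaces whose restriction to $C_c(G/\Gamma)$ is continuous in the supremum norm; it exists if $\|\cdot\|_u$ is finite everywhere (then it is a $C^*$-norm). Let $\mathcal{D}_r\subseteq\ell^\infty(G)$ be the $C^*$-algebra generated by all $C_c(G/H)$, $H$ a finite intersection of conjugates of $\Gamma$. $C_0(G/\Gamma)\times_{\alpha,r}G/\Gamma$ is the completion in the norm $\sup_\pi\|[\pi_\alpha\times(1\otimes\rho)](f)\|$ over nondegenerate $*$-representations $\pi:\mathcal{D}_r\to B(\mathscr{H})$, where $[\pi_\alpha\times(1\otimes\rho)](f)(\xi\otimes\delta_{h\Gamma})=\sum_{[g]\in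 G/\Gamma}\Delta(g^{-1}h)^{1/2}\pi(\overline{\alpha}_g(f(g^{-1}h\Gamma)))\xi\otimes\delta_{g\Gamma}$. **Covariant representations.** A covariant pre-$*$-representation on $\mathscr{H}$ is a pair $(\pi,\mu)$ where $\pi$ is a nondegenerate $*$-representation of $C_c(G/\Gamma)$ (equivalently $C_0(G/\Gamma)$) on $\mathscr{H}$ and $\mu$ is a unital $*$-homomorphism of $\mathcal{H}(G,\Gamma)$ into the adjointable operators on the inner product space $\pi(C_c(G/\Gamma))\mathscr{H}$ (linear span), preserving product decompositions: whenever $\Gamma g\Gamma*1_{x\Gamma}*\Gamma s\Gamma=\sum_i c_i\,1_{x_i\Gamma}*\Gamma g_i\Gamma*1_{x_ig_i\Gamma}$ in the crossed product, then $\mu(\Gamma g\Gamma)\pi(1_{x\Gamma})\mu(\Gamma s\Gamma)=\sum_i c_i\,\pi(1_{x_i\Gamma})\mu(\Gamma g_i\Gamma)\pi(1_{x_ig_i\Gamma})$. It is a covariant $*$-representation if $\mu$ takes values in bounded operators. Its integrated form is the $*$-representation determined by $(\pi\times\mu)(1_{x\Gamma}*\Gamma g\Gamma*1_{xg\Gamma})=\pi(1_{x\Gamma})\mu(\Gamma g\Gamma)\pi(1_{xg\Gamma})$, extended by continuity to completions when possible. *)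

(* Defs.v *)
From HB Require Import structures.
From mathcomp Require Import all_boot all_order all_algebra finmap.
From mathcomp Require Import all_classical all_reals all_analysis.
From mathcomp.real_closed Require Import complex.
From mathcomp.analysis Require showcase.summability.
From mathcomp Require Import ring.
Set Implicit Arguments. Unset Strict Implicit. Unset Printing Implicit Defensive.
Import Order.TTheory GRing.Theory Num.Theory.
Import numFieldNormedType.Exports.
Local Open Scope classical_set_scope.
Local Open Scope ring_scope.

(* [R[i]] as a normed module over itself: the library has instances for its
   abstract number fields and for [R[i]^o], but not for the concrete type. *)
#[non_forgetful_inheritance]
HB.instance Definition _ (R : realType) := PseudoPointedMetric.copy R[i] R[i]^o.
#[non_forgetful_inheritance]
HB.instance Definition _ (R : realType) := GRing.ComAlgebra.copy R[i] R[i]^o.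
#[non_forgetful_inheritance]
HB.instance Definition _ (R : realType) := NormedModule.copy R[i] R[i]^o.

(* The inner product is linear in the first variable. *)
HB.mixin Record isHilbert (R : realType) H & CompleteNormedModule R[i] H := {
  ip : H -> H -> R[i];
  ip_linear : forall y, linear (ip^~ y : H -> R[i]);
  ip_conj : forall x y, ip y x = (ip x y)^*;
  ip_norm : forall x, ip x x = `|x| ^+ 2 }.
#[short(type="hilbertType")]
HB.structure Definition Hilbert (R : realType) :=
  {H of CompleteNormedModule R[i] H & isHilbert R H}.

(* Norms of normed modules over [R[i]] take their values in [R[i]]; this is the
   same norm, as an element of [R]. *)
Definition rnorm (R : realType) (V : normedModType R[i]) (x : V) : R :=
  complex.Re `|x|.

Section rnorm.
Variables (R : realType) (V : normedModType R[i]).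
Implicit Types x y : V.

Lemma rnormE x : `|x| = (rnorm x)%:C%C.
Proof.
rewrite /rnorm; have := normr_ge0 x.
by case: (`|x|) => a b; rewrite lecE /= => /andP[/eqP -> _].
Qed.

Lemma rnorm_ge0 x : 0 <= rnorm x.
Proof. by rewrite -lecR -rnormE normr_ge0. Qed.

Lemma rnorm0 : rnorm (0 : V) = 0. Proof. by rewrite /rnorm normr0. Qed.

Lemma rnormD x y : rnorm (x + y) <= rnorm x + rnorm y.
Proof. by rewrite -lecR rmorphD /= -!rnormE ler_normD. Qed.

Lemma rnorm_eq0 x : rnorm x = 0 -> x = 0.
Proof. by move=> h; apply/eqP; rewrite -normr_eq0 rnormE h. Qed.

Lemma rnormN x : rnorm (- x) = rnorm x.
Proof. by rewrite /rnorm normrN. Qed.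

Lemma rnormZ (k : R[i]) x : rnorm (k *: x) = rnorm (k : R[i]) * rnorm x.
Proof.
by apply: complexI; rewrite rmorphM /= -!rnormE normrZ.
Qed.
End rnorm.

Section Ccomplete.
Variable R : realType.
Local Notation C := R[i].

Lemma rnorm_normc (z : C) : rnorm (z : C) = ComplexField.Normc.normc z.
Proof. by case: z. Qed.

Lemma normr_Re (z : C) : `|complex.Re z| <= rnorm (z : C).
Proof.
rewrite rnorm_normc; case: z => a b /=.
by rewrite -sqrtr_sqr ler_sqrt ?addr_ge0 ?sqr_ge0// lerDl sqr_ge0.
Qed.

Lemma normr_Im (z : C) : `|complex.Im z| <= rnorm (z : C).
Proof.
rewrite rnorm_normc; case: z => a b /=.
by rewrite -sqrtr_sqr ler_sqrt ?addr_ge0 ?sqr_ge0// lerDr sqr_ge0.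
Qed.

Lemma rnormC (x : R) : rnorm (x%:C%C : C) = `|x|.
Proof. by rewrite rnorm_normc /= expr0n /= addr0 sqrtr_sqr. Qed.

Lemma rnorm_ReIm (z : C) : rnorm (z : C) <= `|complex.Re z| + `|complex.Im z|.
Proof.
case: z => a b /=; rewrite rnorm_normc /= -[leRHS]ger0_norm ?addr_ge0//.
rewrite -sqrtr_sqr ler_sqrt ?sqr_ge0// sqrrD !real_normK ?num_real//.
by rewrite -addrA [X in _ <= _ + X]addrC addrA lerDl mulrn_wge0 ?mulr_ge0.
Qed.

Lemma C_complete (F : set_system C) : ProperFilter F -> cauchy F -> cvg F.
Proof.
move=> FF /cauchy_ballP Fc.
have Rec (p : C -> R) (hp : forall x y : C, `|p x - p y| <= rnorm (x - y : C)) :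
    cvg (p @ F).
  apply: R_complete; apply/cauchy_ballP => e e0.
  have [|[A B] /= [FA FB] AB] := Fc e%:C%C; first by rewrite ltcR.
  exists (p @` A, p @` B) => /=.
    split; first by apply: filterS FA => x Ax; exists x.
    by apply: filterS FB => x Ax; exists x.
  move=> [_ _] [[x Ax <-] [y By <-]] /=.
  rewrite /ball /=; apply: le_lt_trans (hp _ _) _.
  by rewrite -ltcR -rnormE; exact: (AB (x, y)).
have /cvg_ex[a Fa] := Rec (@complex.Re R) (fun x y => ltac:(
   rewrite (_ : _ - _ = complex.Re (x - y)) ?normr_Re//; by case: x y => [? ?] [? ?])).
have /cvg_ex[b Fb] := Rec (@complex.Im R) (fun x y => ltac:(
   rewrite (_ : _ - _ = complex.Im (x - y)) ?normr_Im//; by case: x y => [? ?] [? ?])).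
apply/cvg_ex; exists (a +i* b)%C; apply/cvgrPdist_lt => /= e e0.
have /eqP eE : e == (complex.Re e)%:C%C by case: e e0 => e1 e2; rewrite ltcE /= eq_complex /= eqxx => /andP[].
move: e0; rewrite eE ltcR; set e' := complex.Re e => e0.
near=> z; rewrite -[X in X < _]/(`|(a +i* b)%C - z : C|) rnormE ltcR.
apply: le_lt_trans (rnorm_ReIm _) _.
rewrite [ltRHS]splitr ltrD//.
  rewrite (_ : complex.Re _ = a - complex.Re z); last by case: (z).
  by near: z; move/cvgrPdist_lt : Fa => /(_ (e' / 2)); apply; rewrite divr_gt0.
rewrite (_ : complex.Im _ = b - complex.Im z); last by case: (z).
by near: z; move/cvgrPdist_lt : Fb => /(_ (e' / 2)); apply; rewrite divr_gt0.
Unshelve. all: by end_near. Qed.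

HB.instance Definition _ := Uniform_isComplete.Build C C_complete.

Lemma ipC_linear (y : C) : linear ((fun x => x * y^*) : C -> C).
Proof. by move=> k x z; rewrite mulrDl scalerAl. Qed.
Lemma ipC_conj (x y : C) : y * x^* = (x * y^*)^*.
Proof. by rewrite rmorphM /= conjCK mulrC. Qed.
Lemma ipC_norm (x : C) : x * x^* = `|x| ^+ 2.
Proof. by rewrite normCK. Qed.
HB.instance Definition _ := isHilbert.Build R C ipC_linear ipC_conj ipC_norm.
End Ccomplete.

(* The Hilbert space direct sum of copies of [H] indexed by [I]. It is used both
   as l^2(I), for [H = R[i]], and as the tensor product of [H] with l^2(I): see
   [tens] below. *)
Section ell2.
Variables (R : realType) (I : choiceType) (H : hilbertType R).
Implicit Types (x y : I -> H) (A : {fset I}).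

Definition sqsum x : \bar R := (\esum_(i in [set: I]) (rnorm (x i) ^+ 2)%:E)%E.

Definition ell2_pred : {pred I -> H} := mem [set x | (sqsum x < +oo)%E].

Let part x A : R := \sum_(i <- A) rnorm (x i) ^+ 2.

Lemma sqsum_leP x (M : R) :
  (forall A, part x A <= M) <-> (sqsum x <= M%:E)%E.
Proof.
split=> h.
  apply: ub_ereal_sup => _ [A [fA _] <-].
  by rewrite fsbig_finite//= sumEFin lee_fin h.
move=> A; rewrite -lee_fin; apply: le_trans h; apply: ereal_sup_ubound.
exists [set` A]; first by split.
by rewrite fsbig_finite//= set_fsetK sumEFin.
Qed.

Lemma sqsum_ge0 x : (0 <= sqsum x)%E.
Proof. by apply: esum_ge0 => i _; rewrite lee_fin sqr_ge0. Qed.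

Lemma ell2_boundP x :
  x \in ell2_pred <-> exists M : R, forall A, part x A <= M.
Proof.
rewrite inE /=; split.
  move=> xoo; exists (fine (sqsum x)); apply/sqsum_leP.
  by rewrite fineK// ge0_fin_numE// sqsum_ge0.
by move=> [M /sqsum_leP h]; apply: le_lt_trans h (ltry _).
Qed.

Fact ell2_submod_closed : submod_closed ell2_pred.
Proof.
split.
  by apply/ell2_boundP; exists 0 => A; rewrite /part big1// => i _; rewrite rnorm0 expr0n.
move=> k x y /ell2_boundP[M hM] /ell2_boundP[N hN]; apply/ell2_boundP.
exists (2 * (rnorm k ^+ 2 * M + N)) => A.
apply: (@le_trans _ _ (2 * (rnorm k ^+ 2 * part x A + part y A))); last first.
  by rewrite ler_pM2l// lerD// ler_wpM2l// sqr_ge0.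
rewrite /part mulr_sumr -big_split mulr_sumr /=; apply: ler_sum => i _.
have := rnormD (k *: x i) (y i); rewrite rnormZ -exprMn.
have := rnorm_ge0 (k *: x i + y i); rewrite !fctE.
move: (rnorm _) (_ * _) (rnorm _) => c b a a0 h.
apply: (@le_trans _ _ ((b + c) ^+ 2)); first by rewrite ler_sqr ?nnegrE// (le_trans a0).
by rewrite -subr_ge0 (_ : _ - _ = (b - c) ^+ 2) ?sqr_ge0//; ring.
Qed.

HB.instance Definition _ :=
  GRing.isSubmodClosed.Build _ _ ell2_pred ell2_submod_closed.

Record ell2 := Ell2 { ell2_val :> I -> H; ell2_valP : ell2_val \in ell2_pred }.
HB.instance Definition _ := [isSub of ell2 for ell2_val].
HB.instance Definition _ := [Choice of ell2 by <:].
HB.instance Definition _ := [SubChoice_isSubLmodule of ell2 by <:].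

Definition ell2_norm (x : ell2) : R := Num.sqrt (fine (sqsum x)).

Lemma ell2_norm_ge0 (x : ell2) : 0 <= ell2_norm x. Proof. exact: sqrtr_ge0. Qed.

Lemma ell2_norm_leP (x : ell2) (M : R) : 0 <= M ->
  (forall A, part x A <= M ^+ 2) <-> ell2_norm x <= M.
Proof.
move=> M0; have xoo : sqsum x \is a fin_num.
  by rewrite ge0_fin_numE ?sqsum_ge0//; have := ell2_valP x; rewrite inE.
rewrite -[ell2_norm x <= M]ler_sqr ?nnegrE ?ell2_norm_ge0//.
rewrite sqr_sqrtr ?fine_ge0 ?sqsum_ge0//.
split=> [/sqsum_leP h|h]; first by rewrite -lee_fin fineK.
by apply/sqsum_leP; rewrite -(fineK xoo) lee_fin.
Qed.

Lemma part_norm (x : ell2) A : part x A <= ell2_norm x ^+ 2.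
Proof. by move: A; apply/ell2_norm_leP; rewrite ?ell2_norm_ge0. Qed.

Lemma rnorm_ell2 (x : ell2) i : rnorm (x i) <= ell2_norm x.
Proof.
rewrite -ler_sqr ?nnegrE ?rnorm_ge0 ?ell2_norm_ge0//.
by have := part_norm x [fset i]%fset; rewrite /part big_seq_fset1.
Qed.

Lemma ell2_norm0 (x : ell2) : ell2_norm x = 0 -> x = 0.
Proof.
move=> x0; apply/val_inj/funext => i /=; apply: rnorm_eq0; apply/eqP.
by rewrite eq_le rnorm_ge0 -x0 rnorm_ell2.
Qed.

Lemma ell2_normD (x y : ell2) : ell2_norm (x + y) <= ell2_norm x + ell2_norm y.
Proof.
have := ell2_norm_ge0 x; rewrite le_eqVlt => /predU1P[/esym/ell2_norm0 ->|x0].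
  by rewrite add0r lerDr ell2_norm_ge0.
have := ell2_norm_ge0 y; rewrite le_eqVlt => /predU1P[/esym/ell2_norm0 ->|y0].
  by rewrite addr0 lerDl ell2_norm_ge0.
apply/ell2_norm_leP => [|A]; first by rewrite addr_ge0// ltW.
set X := ell2_norm x in x0 *; set Y := ell2_norm y in y0 *.
have -> : (X + Y) ^+ 2 = (1 + Y / X) * X ^+ 2 + (1 + X / Y) * Y ^+ 2.
  by field; rewrite !gt_eqF.
apply: (@le_trans _ _ ((1 + Y / X) * part x A + (1 + X / Y) * part y A)); last first.
  by rewrite lerD// ler_wpM2l ?part_norm// addr_ge0// divr_ge0// ltW.
rewrite /part !mulr_sumr -big_split /=; apply: ler_sum => i _.
have := rnormD (x i) (y i); have := rnorm_ge0 (x i + y i).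
move: (rnorm _) (rnorm _) (rnorm _) => c b a a0 h.
apply: (@le_trans _ _ ((b + c) ^+ 2)).
  by rewrite ler_sqr ?nnegrE// (le_trans a0).
rewrite -subr_ge0 (_ : _ - _ = (Y * b - X * c) ^+ 2 / (X * Y)).
  by rewrite divr_ge0 ?sqr_ge0// mulr_ge0// ltW.
by field; rewrite !gt_eqF.
Qed.

Lemma ell2_normZ (k : R[i]) (x : ell2) : ell2_norm (k *: x) = rnorm k * ell2_norm x.
Proof.
have le (l : R[i]) (y : ell2) : ell2_norm (l *: y) <= rnorm l * ell2_norm y.
  apply/ell2_norm_leP => [|A]; first by rewrite mulr_ge0 ?rnorm_ge0 ?ell2_norm_ge0.
  rewrite exprMn; apply: le_trans (ler_wpM2l (sqr_ge0 _) (part_norm _ A)).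
  by rewrite /part mulr_sumr ler_sum// => i _ /=; rewrite fctE rnormZ exprMn.
apply/eqP; rewrite eq_le le/=.
have [->|k0] := eqVneq k 0; first by rewrite rnorm0 mul0r ell2_norm_ge0.
have := le k^-1 (k *: x); rewrite scalerA mulVf// scale1r.
have kE : rnorm k^-1 = (rnorm k)^-1.
  apply: complexI; rewrite -rnormE normfV rnormE.
  by rewrite fmorphV.
have k0' : 0 < rnorm k.
  by rewrite lt_neqAle rnorm_ge0 andbT eq_sym; apply: contra_neq k0; exact: rnorm_eq0.
by rewrite kE mulrC ler_pdivlMr// mulrC.
Qed.

Let nrm (x : ell2) : R[i] := (ell2_norm x)%:C%C.
Let nrmD (x y : ell2) : nrm (x + y) <= nrm x + nrm y.
Proof. by rewrite -rmorphD lecR ell2_normD. Qed.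
Let nrmZ (l : R[i]) (x : ell2) : nrm (l *: x) = `|l| * nrm x.
Proof. by rewrite /nrm ell2_normZ rmorphM /= rnormE. Qed.
Let nrm0 (x : ell2) : nrm x = 0 -> x = 0.
Proof. by move=> h; apply: ell2_norm0; apply: complexI. Qed.
HB.instance Definition _ := Lmodule_isNormed.Build R[i] ell2 nrmD nrmZ nrm0.

Lemma ell2_rnorm (x : ell2) : rnorm x = ell2_norm x.
Proof. by []. Qed.
End ell2.
Lemma rnorm_dist (R : realType) (V : normedModType R[i]) (x y : V) :
  `|rnorm x - rnorm y| <= rnorm (x - y).
Proof.
have h (a b : V) : rnorm a - rnorm b <= rnorm (a - b).
  by rewrite lerBlDr; have := rnormD (a - b) b; rewrite subrK.
by rewrite ler_norml h andbT lerNl opprB -(rnormN (x - y)) opprB h.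
Qed.

Section ip_theory.
Variables (R : realType) (H : hilbertType R).
Implicit Types (x y z : H).

Lemma ipDl x y z : ip (x + y) z = ip x z + ip y z.
Proof. by have := ip_linear z 1 x y; rewrite !scale1r. Qed.
Lemma ip0l z : ip 0 z = 0 :> R[i].
Proof. by have := ipDl 0 0 z; rewrite addr0 => /eqP; rewrite addrC -subr_eq subrr => /eqP. Qed.
Lemma ipZl (k : R[i]) x z : ip (k *: x) z = k * ip x z.
Proof. by have := ip_linear z k x 0; rewrite !addr0 ip0l addr0. Qed.
Lemma ipDr x y z : ip x (y + z) = ip x y + ip x z.
Proof. by rewrite ip_conj ipDl rmorphD /= -!ip_conj. Qed.
Lemma ipZr (k : R[i]) x z : ip x (k *: z) = k^* * ip x z.
Proof. by rewrite ip_conj ipZl rmorphM /= -!ip_conj. Qed.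

Lemma sqnormD x y : `|x + y| ^+ 2 = `|x| ^+ 2 + `|y| ^+ 2 + ip x y + ip y x :> R[i].
Proof. by rewrite -!ip_norm ipDl !ipDr; ring. Qed.

Lemma ip_polar x y : ip x y =
  4^-1 * (`|x + y| ^+ 2 - `|x - y| ^+ 2
    + 'i * `|x + 'i *: y| ^+ 2 - 'i * `|x - 'i *: y| ^+ 2) :> R[i].
Proof.
rewrite -[- y]scaleN1r -[- ('i *: y)]scaleN1r !sqnormD !normrZ !ipZl !ipZr !rmorphN !rmorph1.
rewrite /= conjCi !normrN normr1 !normCi !mul1r.
have i2 : 'i * 'i = - 1 :> R[i] by rewrite -expr2 sqrCi.
move: (ip x y) (ip y x) (`|x| ^+ 2) (`|y| ^+ 2) => a b c d.
transitivity (4^-1 * (2 * a + 2 * b - ('i * 'i) * 2 * a + ('i * 'i) * 2 * b) : R[i]); last by ring.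
by rewrite i2; field.
Qed.
End ip_theory.

Section ell2_hilbert.
Variables (R : realType) (I : choiceType) (H : hilbertType R).
Implicit Types (x y z : ell2 I H) (A : {fset I}).

Lemma ell2_complete (F : set_system (ell2 I H)) : ProperFilter F -> cauchy F -> cvg F.
Proof.
move=> FF /cauchy_ballP Fc.
have Fi i : cvg ((fun x : ell2 I H => x i) @ F).
  apply: cauchy_cvg; apply/cauchy_ballP => e e0.
  have [[A B] /= [FA FB] AB] := Fc e e0.
  exists ((fun x : ell2 I H => x i) @` A, (fun x : ell2 I H => x i) @` B) => /=.
    split; first by apply: filterS FA => x Ax; exists x.
    by apply: filterS FB => x Ax; exists x.
  move=> [_ _] [[x Ax <-] [y By <-]] /=.
  have := AB (x, y) (conj Ax By); rewrite -!ball_normE /=; apply: le_lt_trans.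
  by rewrite -[X in X <= _]/(`|(x - y) i|) !rnormE lecR rnorm_ell2.
pose g i := lim ((fun x : ell2 I H => x i) @ F).
have close (e : R) : 0 < e -> \forall x \near F,
    forall A, \sum_(i <- A) rnorm ((x : ell2 I H) i - g i) ^+ 2 <= e ^+ 2.
  move=> e0; have [|[A B] /= [FA FB] AB] := Fc e%:C%C; first by rewrite ltcR.
  near=> x => D.
  have cvgD : (fun y : ell2 I H => \sum_(i <- D) rnorm (x i - y i) ^+ 2) @ F
      --> \sum_(i <- D) rnorm (x i - g i) ^+ 2.
    elim: (enum_fset D) => [|i s IHs].
      rewrite big_nil (_ : (fun _ => _) = cst 0); first exact: cvg_cst.
      by apply/funext => y; rewrite big_nil.
    rewrite big_cons; under eq_fun do rewrite big_cons.
    apply: cvgD => //; apply: (@cvg_comp _ _ _ _ (fun r : R => r ^+ 2)); last exact: exprn_continuous.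
    apply/cvgrPdist_lt => d d0; have /cvgrPdist_lt/(_ d%:C%C) := Fi i.
    rewrite ltcR => /(_ d0); apply: filterS => y; rewrite rnormE ltcR; apply: le_lt_trans.
    apply: le_trans (rnorm_dist _ _) _.
    by rewrite -[leRHS]rnormN -/(g i) !opprB addrC subrKA.
  rewrite -(cvg_lim (@Rhausdorff R) cvgD).
  apply: limr_le; first by apply/cvg_ex; exists (\sum_(i <- D) rnorm (x i - g i) ^+ 2).
  near=> y.
  have : ell2_norm (x - y) <= e.
    have := AB (x, y) _; rewrite -ball_normE /= rnormE ltcR => h.
    by apply/ltW/h; split=> //=; [near: x|near: y].
  by move/(ell2_norm_leP _ (ltW e0)); exact.
have gP : g \in ell2_pred (H := H) (I := I).
  have /filter_ex[x hx] := close 1 ltr01.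
  have xg : (x : I -> H) - g \in ell2_pred (H := H) (I := I).
    by apply/ell2_boundP; exists (1 ^+ 2).
  by rewrite -[g](subKr (x : I -> H)) rpredB// ell2_valP.
apply/cvg_ex; exists (Ell2 gP); apply/cvgrPdist_le => /= e e0.
have eE : e = (rnorm e)%:C%C by rewrite -rnormE gtr0_norm.
move: e0; rewrite eE ltcR => e0; near=> x.
rewrite distrC rnormE lecR ell2_rnorm; apply/ell2_norm_leP; first exact: ltW.
by near: x; exact: close.
Unshelve. all: by end_near. Qed.
HB.instance Definition _ := Uniform_isComplete.Build (ell2 I H) ell2_complete.

#[local] Existing Instance summability.totally_filter.

Definition ell2_ip x y : R[i] :=
  lim ((fun A : {fset I} => \sum_(i <- A) ip (x i) (y i) : R[i])
         @ summability.totally).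

Lemma cvg_sqnorm x :
  (fun A : {fset I} => \sum_(i <- A) `|x i| ^+ 2 : R[i]) @ summability.totally
  --> `|x| ^+ 2.
Proof.
have sE A : \sum_(i <- A) `|x i| ^+ 2 = (\sum_(i <- A) rnorm (x i) ^+ 2)%:C%C.
  by rewrite rmorph_sum /=; apply: eq_bigr => i _; rewrite rnormE rmorphXn.
have xE : `|x| ^+ 2 = (rnorm x ^+ 2)%:C%C by rewrite rnormE rmorphXn.
apply/cvgrPdist_le => /= e e0.
have eE : e = (rnorm e)%:C%C by rewrite -rnormE gtr0_norm.
move: e0; rewrite eE ltcR => e0.
have [A0 hA0] : exists A0 : {fset I},
    rnorm x ^+ 2 - rnorm e <= \sum_(i <- A0) rnorm (x i) ^+ 2.
  apply: contrapT => /forallNP h.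
  have /sqsum_leP : forall A, \sum_(i <- A) rnorm (x i) ^+ 2 <= rnorm x ^+ 2 - rnorm e.
    by move=> A; apply/ltW; rewrite ltNge; apply/negP/h.
  have xoo : sqsum x \is a fin_num.
    by rewrite ge0_fin_numE ?sqsum_ge0//; have := ell2_valP x; rewrite inE.
  rewrite ell2_rnorm /ell2_norm sqr_sqrtr ?fine_ge0 ?sqsum_ge0//.
  by rewrite -{1}(fineK xoo) lee_fin leNgt ltrBlDr ltrDl e0.
exists A0 => // A /= A0A.
rewrite xE sE -rmorphB rnormE rnormC lecR ger0_norm; last first.
  by rewrite subr_ge0 ell2_rnorm; exact: part_norm.
rewrite lerBlDr -lerBlDl; apply: le_trans hA0 _.
rewrite (big_fsetID _ (mem A0) A) /= -[leLHS]addr0 lerD ?sumr_ge0// => [|i _]; last exact: sqr_ge0.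
rewrite le_eqVlt; apply/orP; left; apply/eqP; congr bigop.
by congr enum_fset; apply/fsetP => i; rewrite !inE andb_idl// => /(fsubsetP A0A).
Qed.

Lemma cvg_ip x y :
  (fun A : {fset I} => \sum_(i <- A) ip (x i) (y i) : R[i]) @ summability.totally
  --> ell2_ip x y.
Proof.
apply/cvg_ex; exists (4^-1 * (`|x + y| ^+ 2 - `|x - y| ^+ 2
    + 'i * `|x + 'i *: y| ^+ 2 - 'i * `|x - 'i *: y| ^+ 2)).
have -> : (fun A : {fset I} => \sum_(i <- A) ip (x i) (y i) : R[i]) =
    (fun A => 4^-1 * (\sum_(i <- A) `|(x + y) i| ^+ 2 - \sum_(i <- A) `|(x - y) i| ^+ 2
    + 'i * \sum_(i <- A) `|(x + 'i *: y) i| ^+ 2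
    - 'i * \sum_(i <- A) `|(x - 'i *: y) i| ^+ 2)).
  apply/funext => A; rewrite !mulr_sumr -!sumrN -!big_split mulr_sumr /=.
  by apply: eq_bigr => i _; rewrite ip_polar.
apply: cvgM; first exact: cvg_cst.
by apply: cvgB; [apply: cvgD; [apply: cvgB|apply: cvgM]|apply: cvgM];
  (exact: cvg_cst || exact: cvg_sqnorm).
Qed.

Lemma ell2_ip_linear y : linear (fun x => ell2_ip x y).
Proof.
move=> k x z; apply: (cvg_lim (@norm_hausdorff _ _)).
have -> : (fun A : {fset I} => \sum_(i <- A) ip ((k *: x + z) i) (y i) : R[i]) =
    (fun A => k * \sum_(i <- A) ip (x i) (y i) + \sum_(i <- A) ip (z i) (y i)).
  apply/funext => A; rewrite mulr_sumr -big_split /=.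
  by apply: eq_bigr => i _; rewrite ipDl ipZl.
by apply: cvgD; [apply: cvgM; [exact: cvg_cst|]|]; exact: cvg_ip.
Qed.

Lemma ell2_ip_conj x y : ell2_ip y x = (ell2_ip x y)^*.
Proof.
apply: (cvg_lim (@norm_hausdorff _ _)).
apply/cvgrPdist_lt => e e0; have /cvgrPdist_lt/(_ e e0) := cvg_ip (x := x) (y := y).
apply: filterS => A; rewrite -norm_conjC rmorphB rmorph_sum /=.
by under eq_bigr do rewrite -ip_conj.
Qed.

Lemma ell2_ip_norm x : ell2_ip x x = `|x| ^+ 2.
Proof.
apply: (cvg_lim (@norm_hausdorff _ _)).
under eq_fun do under eq_bigr do rewrite ip_norm.
exact: cvg_sqnorm.
Qed.

HB.instance Definition _ :=
  isHilbert.Build R (ell2 I H) ell2_ip_linear ell2_ip_conj ell2_ip_norm.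

End ell2_hilbert.

(* C*-algebras need not be unital. *)
HB.mixin Record isCStarAlgebra (R : realType) A & CompleteNormedModule R[i] A := {
  cmul : A -> A -> A;
  cstar : A -> A;
  cmulA : associative cmul;
  cmul_linearl : forall y, linear (cmul^~ y);
  cmul_linearr : forall x, linear (cmul x);
  cstar_antilinear : forall (k : R[i]) x y,
    cstar (k *: x + y) = k^* *: cstar x + cstar y;
  cstarK : involutive cstar;
  cstarM : forall x y, cstar (cmul x y) = cmul (cstar y) (cstar x);
  cnormM : forall x y, `|cmul x y| <= `|x| * `|y|;
  cnorm_cstar : forall x, `|cmul (cstar x) x| = `|x| ^+ 2 }.
#[short(type="cstarAlgType")]
HB.structure Definition CStarAlgebra (R : realType) :=
  {A of CompleteNormedModule R[i] A & isCStarAlgebra R A}.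

Section operators.
Variable R : realType.

Definition bounded_op (H K : hilbertType R) (T : H -> K) : Prop :=
  linear T /\ exists M : R[i], forall x, `|T x| <= M * `|x|.

Definition compact_op (H : hilbertType R) (T : H -> H) : Prop :=
  linear T /\ compact (closure (T @` [set x | `|x| <= 1])).

Definition opnorm (H K : hilbertType R) (T : H -> K) : \bar R :=
  ereal_sup [set (rnorm (T x))%:E | x in [set x : H | `|x| <= 1]].

Definition lspan (V : lmodType R[i]) (X : set V) : set V :=
  [set v | exists (n : nat) (k : 'I_n -> R[i]) (x : 'I_n -> V),
     (forall i, X (x i)) /\ v = \sum_(i < n) k i *: x i].

(* The *-algebras of functions below are given by a subset [S] of a space of
   functions and operations [mul] and [star] defined on the whole space; maps out
   of such an algebra are only constrained on [S]. *)
Definition star_rep (V : lmodType R[i]) (S : set V) (mul : V -> V -> V)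
    (star : V -> V) (H : hilbertType R) (Phi : V -> H -> H) : Prop :=
  [/\ forall a, S a -> bounded_op (Phi a),
      forall k a b x, S a -> S b -> Phi (k *: a + b) x = k *: Phi a x + Phi b x,
      forall a b x, S a -> S b -> Phi (mul a b) x = Phi a (Phi b x) &
      forall a x y, S a -> ip (Phi a x) y = ip x (Phi (star a) y)].

Definition nondegenerate (V : lmodType R[i]) (S : set V) (H : hilbertType R)
    (Phi : V -> H -> H) : Prop :=
  closure (lspan [set Phi a x | a in S & x in [set: H]]) = [set: H].

(* [B] is the C*-completion of the *-algebra [S] in the norm [N], with canonical
   map [j]. *)
Definition is_completion (V : lmodType R[i]) (S : set V) (mul : V -> V -> V)
    (star : V -> V) (N : V -> \bar R) (B : cstarAlgType R) (j : V -> B) : Prop :=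
  [/\ forall k a b, S a -> S b -> j (k *: a + b) = k *: j a + j b,
      forall a b, S a -> S b -> j (mul a b) = cmul (j a) (j b),
      forall a, S a -> j (star a) = cstar (j a),
      forall a, S a -> (rnorm (j a))%:E = N a &
      closure (j @` S) = [set: B]].

Definition cstar_iso (A B : cstarAlgType R) : Prop :=
  exists f : A -> B, [/\ linear f, {morph f : x y / cmul x y},
                         {morph f : x / cstar x} & bijective f].

Definition cstar_rep (A : cstarAlgType R) (H : hilbertType R) (Psi : A -> H -> H) :=
  star_rep [set: A] cmul cstar Psi.

(* [A] is isomorphic to the C*-algebra of compact operators on [H]: an injective
   *-homomorphism into the bounded operators whose range is that algebra. *)
Definition iso_compact (A : cstarAlgType R) (H : hilbertType R) : Prop :=
  exists Psi : A -> H -> H,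
    [/\ cstar_rep Psi, injective Psi & range Psi = @compact_op H].
End operators.

Section function_star_algebra.
Variables (R : realType) (T : Type).
Definition fmul (f g : T -> R[i]) : T -> R[i] := fun x => f x * g x.
Definition fstar (f : T -> R[i]) : T -> R[i] := fun x => (f x)^*.
End function_star_algebra.

Section cosets.
Variable G : groupType.
Local Open Scope group_scope.
Implicit Types (A : set G) (g h x : G).

Definition is_subgroup A : Prop :=
  [/\ A 1, forall x y, A x -> A y -> A (x * y) & forall x, A x -> A x^-1].

Definition lcoset A g : set G := [set g * a | a in A].
Definition rcoset A g : set G := [set a * g | a in A].
Definition dcoset A g : set G := [set a * g * b | a in A & b in A].
Definition conjset A g : set G := [set g * a * g^-1 | a in A].

(* For [k := lcoset A] (resp. [dcoset A]), [classes k] is the type of the left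
   (resp. double) cosets of [A], [cls k g] is the coset of [g] and [rep c] is a
   chosen element of the coset [c]. The formulas below that mention [rep] do not
   depend on that choice on the *-algebras where they are used. *)
Definition classes (k : G -> set G) : choiceType := range k.
Definition cls (k : G -> set G) g : classes k :=
  exist _ (k g) (mem_set (imageT k g)).
Definition rep (k : G -> set G) (c : classes k) : G := s2val (cid2 (set_mem (svalP c))).

Lemma repK (k : G -> set G) : cancel (@rep k) (cls k).
Proof. by move=> c; apply: val_inj; rewrite /rep/=; case: cid2. Qed.

Definition hecke_pair A : Prop :=
  is_subgroup A /\
  forall g, finite_set (lcoset A @` dcoset A g) /\
            finite_set (rcoset A @` dcoset A g).

Definition Lindex A g : nat := #|` fset_set (lcoset A @` dcoset A g)|.
Definition Rindex A g : nat := #|` fset_set (rcoset A @` dcoset A g)|.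
End cosets.
Notation lquot A := (classes (lcoset A)).
Notation dquot A := (classes (dcoset A)).

Section tensor.
Variables (R : realType) (I : choiceType) (H : hilbertType R).

Fact delta_subproof (i : I) : (fun j => (j == i)%:R : R[i]) \in @ell2_pred R I R[i].
Proof.
apply/ell2_boundP; exists 1 => A.
have rn (b : bool) : rnorm (b%:R : R[i]) ^+ 2 = b%:R.
  by case: b; rewrite /rnorm ?normr1 ?normr0 /= ?expr1n ?expr0n.
under eq_bigr do rewrite rn.
have [iA|iA] := boolP (i \in A).
  by rewrite (big_fsetD1 i)//= eqxx big_seq big1 ?addr0// => j; rewrite !inE => /andP[/negPf->].
by rewrite big_seq big1 ?ler01// => j jA; case: eqP => // ji; rewrite -ji jA in iA.
Qed.
Definition delta (i : I) : ell2 I R[i] := Ell2 (delta_subproof i).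

Fact tens_subproof (v : H) (x : ell2 I R[i]) :
  (fun i => x i *: v) \in @ell2_pred R I H.
Proof.
apply/ell2_boundP; exists (ell2_norm x ^+ 2 * rnorm v ^+ 2) => A.
under eq_bigr do rewrite rnormZ exprMn.
by rewrite -mulr_suml ler_wpM2r ?sqr_ge0// part_norm.
Qed.
(* Simple tensors, with the tensor product of [H] and l^2(I) realized as
   [ell2 I H]. *)
Definition tens (v : H) (x : ell2 I R[i]) : ell2 I H := Ell2 (tens_subproof v x).
End tensor.

Section crossed_product.
Variables (R : realType) (G : groupType) (Gam : set G).
Local Notation C := R[i].
Local Notation GH := (lquot Gam).
Local Notation cl := (cls (lcoset Gam)).
Local Notation dcl := (cls (dcoset Gam)).
Local Notation dbl := (dquot Gam).

Definition modular (g : G) : R := (Lindex Gam g)%:R / (Rindex Gam g)%:R.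

Definition hecke : set (dbl -> C) := [set f | finite_set [set D | f D != 0]].
Definition hmul (f1 f2 : dbl -> C) : dbl -> C := fun D =>
  \sum_(c \in [set: GH])
     f1 (dcl (rep c)) * f2 (dcl ((rep c)^-1 * rep D)%g).
Definition hstar (f : dbl -> C) : dbl -> C := fun D =>
  (modular (rep D)^-1%g)%:C%C * (f (dcl (rep D)^-1%g))^*.
Definition dchar (g : G) : dbl -> C := \1_[set dcl g].

Definition rtrans (g : G) (phi : G -> C) : G -> C := fun x => phi (x * g)%g.

(* C_c(G/K), as right K-invariant functions on G, and similarly for C_0. *)
Definition Cc (K : set G) : set (G -> C) :=
  [set phi | (forall x k, K k -> phi (x * k)%g = phi x) /\
             finite_set (lcoset K @` [set x | phi x != 0])].

Definition C0 : set (G -> C) :=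
  [set phi | (forall x k, Gam k -> phi (x * k)%g = phi x) /\
     forall e : R, 0 < e ->
       finite_set (lcoset Gam @` [set x | e <= rnorm (phi x)])].

(* The ambient *-algebra of covariant functions on G/Gam. *)
Definition Bset : set (GH -> G -> C) :=
  [set f | finite_set [set c | f c != 0] /\
     forall a g, Gam a -> f (cl (a * g)%g) = rtrans a (f (cl g))].
Definition bmul (f1 f2 : GH -> G -> C) : GH -> G -> C := fun c x =>
  \sum_(d \in [set: GH])
     f1 d x * rtrans (rep d) (f2 (cl ((rep d)^-1 * rep c)%g)) x.
Definition bstar (f : GH -> G -> C) : GH -> G -> C := fun c x =>
  (modular (rep c)^-1%g)%:C%C * (rtrans (rep c) (f (cl (rep c)^-1%g)) x)^*.

Definition crossed : set (GH -> G -> C) :=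
  [set f | Bset f /\ forall g, Cc (Gam `&` conjset Gam g) (f (cl g))].

(* The embeddings of C_c(G/Gam) and of the Hecke algebra. *)
Definition ofC (phi : G -> C) : GH -> G -> C :=
  fun c => if c == cl 1%g then phi else 0.
Definition ofH (f : dbl -> C) : GH -> G -> C :=
  fun c _ => f (dcl (rep c)).
Definition ind (x : G) : G -> C := \1_(lcoset Gam x).

(* 1_{x Gam} * Gam g Gam * 1_{x g Gam} *)
Definition elem (x g : G) : GH -> G -> C :=
  bmul (bmul (ofC (ind x)) (ofH (dchar g))) (ofC (ind (x * g)%g)).

(* The *-representations whose restriction to C_c(G/Gam) is continuous in the
   supremum norm. *)
Definition full_rep (H : hilbertType R) (Phi : (GH -> G -> C) -> H -> H) : Prop :=
  star_rep crossed bmul bstar Phi /\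
  forall phi, Cc Gam phi -> forall e : R, 0 < e -> exists2 d : R, 0 < d &
    forall psi, Cc Gam psi -> (forall x, rnorm (psi x - phi x) <= d) ->
      (opnorm (fun v => (Phi (ofC psi) v - Phi (ofC phi) v)%R) <= e%:E)%E.

Definition full_norm (f : GH -> G -> C) : \bar R :=
  ereal_sup [set r | exists (H : hilbertType R) (Phi : (GH -> G -> C) -> H -> H),
    full_rep Phi /\ r = opnorm (Phi f)].

(* Intersections of finitely many (at least one) conjugates of [Gam]. *)
Definition conj_inter : set (set G) :=
  [set K | exists2 s : seq G, s != [::] & K = \bigcap_(g in [set` s]) conjset Gam g].

(* The closed *-subalgebra of l^oo(G) generated by the C_c(G/K). *)
Definition Dr : set (G -> C) := [set phi | forall D : set (G -> C),
  (forall K psi, conj_inter K -> Cc K psi -> D psi) ->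
  (forall (k : C) psi1 psi2, D psi1 -> D psi2 -> D (k *: psi1 + psi2)) ->
  (forall psi1 psi2, D psi1 -> D psi2 -> D (fmul psi1 psi2)) ->
  (forall psi, D psi -> D (fstar psi)) ->
  (forall psi, (forall e : R, 0 < e ->
     exists2 psi', D psi' & forall x, rnorm (psi x - psi' x) <= e) -> D psi) ->
  D phi].

(* [T] is the operator [pi_alpha x (1 (x) rho)](f). It is determined by its values
   on the total set of vectors v (x) delta. *)
Definition reg_op (H : hilbertType R) (pi : (G -> C) -> H -> H)
    (f : GH -> G -> C) (T : ell2 GH H -> ell2 GH H) : Prop :=
  bounded_op T /\
  forall v h, T (tens v (delta R (cl h))) =
    \sum_(d \in [set: GH])
      tens ((Num.sqrt (modular ((rep d)^-1 * h)%g))%:C%C *: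
              pi (rtrans (rep d) (f (cl ((rep d)^-1 * h)%g))) v) (delta R d).

Definition red_norm (f : GH -> G -> C) : \bar R :=
  ereal_sup [set r | exists (H : hilbertType R) (pi : (G -> C) -> H -> H) T,
    [/\ star_rep Dr (@fmul R G) (@fstar R G) pi, nondegenerate Dr pi,
        reg_op pi f T & r = opnorm T]].

Definition full_crossed_product_exists : Prop :=
  forall f, crossed f -> (full_norm f < +oo)%E.

Definition is_full_crossed_product (A : cstarAlgType R)
    (j : (GH -> G -> C) -> A) : Prop :=
  is_completion crossed bmul bstar full_norm j.

Definition is_reduced_crossed_product (A : cstarAlgType R)
    (j : (GH -> G -> C) -> A) : Prop :=
  is_completion crossed bmul bstar red_norm j.

(* The inner product space pi(C_c(G/Gam))H, on which [mu] acts. *)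
Definition cov_space (H : hilbertType R) (pi : (G -> C) -> H -> H) : set H :=
  lspan [set pi phi v | phi in Cc Gam & v in [set: H]].

Record covariant_pre_rep (H : hilbertType R) (pi : (G -> C) -> H -> H)
    (mu : (dbl -> C) -> H -> H) : Prop := CovariantPreRep {
  cov_rep : star_rep (Cc Gam) (@fmul R G) (@fstar R G) pi;
  cov_nondegenerate : nondegenerate (Cc Gam) pi;
  cov_stable : forall f v, hecke f -> cov_space pi v -> cov_space pi (mu f v);
  cov_op_linear : forall f k v w, hecke f -> cov_space pi v -> cov_space pi w ->
    mu f (k *: v + w) = k *: mu f v + mu f w;
  cov_linear : forall k f1 f2 v, hecke f1 -> hecke f2 -> cov_space pi v ->
    mu (k *: f1 + f2) v = k *: mu f1 v + mu f2 v;
  cov_mul : forall f1 f2 v, hecke f1 -> hecke f2 -> cov_space pi v ->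
    mu (hmul f1 f2) v = mu f1 (mu f2 v);
  cov_star : forall f v w, hecke f -> cov_space pi v -> cov_space pi w ->
    ip (mu f v) w = ip v (mu (hstar f) w);
  cov_unit : forall v, cov_space pi v -> mu (dchar 1%g) v = v;
  cov_decomposition : forall (g x s : G) n (k : 'I_n -> C) (y h : 'I_n -> G),
    bmul (bmul (ofH (dchar g)) (ofC (ind x))) (ofH (dchar s)) =
      \sum_(i < n) k i *: elem (y i) (h i) ->
    forall v, cov_space pi v ->
      mu (dchar g) (pi (ind x) (mu (dchar s) v)) =
      \sum_(i < n) k i *:
        pi (ind (y i)) (mu (dchar (h i)) (pi (ind (y i * h i)%g) v)) }.

Definition covariant_rep (H : hilbertType R) (pi : (G -> C) -> H -> H)
    (mu : (dbl -> C) -> H -> H) : Prop :=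
  covariant_pre_rep pi mu /\
  forall f, hecke f ->
    exists M : C, forall v, cov_space pi v -> `|mu f v| <= M * `|v|.

(* The elements [elem x g] span the crossed product, so these values determine
   the *-representation [Psi] of its completion [A]. *)
Definition integrated_form (H : hilbertType R) (pi : (G -> C) -> H -> H)
    (mu : (dbl -> C) -> H -> H) (A : cstarAlgType R) (j : (GH -> G -> C) -> A)
    (Psi : A -> H -> H) : Prop :=
  cstar_rep Psi /\
  forall x g v, Psi (j (elem x g)) v =
    pi (ind x) (mu (dchar g) (pi (ind (x * g)%g) v)).

(* [insubd 0] only serves to make [Mrep] and [rho] total: by [MrepE] and [rhoE] the
   function it is applied to is square-summable when [phi] is in [C0], resp. when
   [f] is in the Hecke algebra of a Hecke pair. *)
Definition Mrep (phi : G -> C) (v : ell2 GH C) : ell2 GH C :=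
  insubd 0 (fun c => phi (rep c) * v c).

Definition rho (f : dbl -> C) (v : ell2 GH C) : ell2 GH C :=
  insubd 0 (fun c => \sum_(d \in [set: GH])
    (Num.sqrt (modular (rep d)))%:C%C * f (dcl (rep d)) * v (cl (rep c * rep d)%g)).

Lemma lcoset_eqP (hG : is_subgroup Gam) x y :
  lcoset Gam x = lcoset Gam y -> exists2 a, Gam a & y = (x * a)%g.
Proof.
have [G1 _ _] := hG; move=> xy.
have : lcoset Gam y y by exists 1%g => //; rewrite mulg1.
by rewrite -xy => -[a Ga <-]; exists a.
Qed.

Lemma lcoset_trans k x : lcoset Gam (k * x)%g = [set (k * y)%g | y in lcoset Gam x].
Proof.
apply/seteqP; split=> [_ [a Ga <-]|_ [_ [a Ga <-] <-]].
  by exists (x * a)%g; [exists a|rewrite mulgA].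
by exists a => //; rewrite mulgA.
Qed.

Lemma lcoset_rep (c : GH) : lcoset Gam (rep c) = val c.
Proof. by rewrite -[in RHS](repK c). Qed.

Lemma lcoset_trans_inj k : injective (fun c : GH => lcoset Gam (k * rep c)%g).
Proof.
move=> c d /= cd; apply: val_inj; rewrite -!lcoset_rep.
have e x : lcoset Gam x = [set (k^-1 * y)%g | y in lcoset Gam (k * x)%g].
  by rewrite -lcoset_trans mulKg.
by rewrite e cd -e.
Qed.

Lemma hecke_support f : hecke_pair Gam -> hecke f ->
  finite_set [set c : GH | f (dcl (rep c)) != 0].
Proof.
move=> [[G1 _ _] hG] hf.
apply: (@sub_finite_set _ _ (\bigcup_(D in [set D | f D != 0]) [set c : GH | dcl (rep c) = D])).
  by move=> c /= fc; exists (dcl (rep c)).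
apply: bigcup_finite => // D _.
have [+ _] := hG (rep D).
move=> /(finite_preimage (f := fun c : GH => lcoset Gam (rep c)) _) fin.
apply: sub_finite_set (fin _) => [c /= <-|c d _ _ cd].
  exists (rep c) => //; have := congr1 val (repK (dcl (rep c))) => /= E.
  rewrite (_ : dcoset _ _ = dcoset Gam (rep c)) ?E//.
  by exists 1%g => //; exists 1%g => //; rewrite mul1g mulg1.
by apply: (@lcoset_trans_inj 1%g); rewrite /= !mul1g.
Qed.

Lemma shift_ell2 (v : ell2 GH C) h : hecke_pair Gam ->
  (fun c : GH => v (cl (rep c * h)%g)) \in @ell2_pred R GH C.
Proof.
move=> [hG fG]; have [G1 GM GV] := hG.
pose m (c : GH) := cl (rep c * h)%g; pose N := Lindex Gam h^-1%g.
have fibre (A : {fset GH}) e : (size [seq c <- A | m c == e] <= N)%N.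
  pose F := [fset c in A | m c == e]%fset.
  have -> : size [seq c <- A | m c == e] = #|` F|.
    apply: perm_size; apply: uniq_perm; rewrite ?filter_uniq ?fset_uniq// => c.
    by rewrite mem_filter !inE andbC.
  have <- : #|` [fset lcoset Gam ((rep e)^-1 * rep c)%g | c in F]%fset| = #|` F|.
    by rewrite card_imfset//; exact: lcoset_trans_inj.
  apply: fsubset_leq_card; apply/fsubsetP => _ /imfsetP[c /= cF ->].
  rewrite in_fset_set; last by have [] := fG h^-1%g.
  rewrite inE /=; exists ((rep e)^-1 * rep c)%g => //.
  move: cF; rewrite !inE => /andP[_ /eqP me].
  have [|a Ga E] := @lcoset_eqP hG (rep c * h)%g (rep e).
    by rewrite lcoset_rep -me.
  exists a^-1%g; first exact: GV.
  by exists 1%g => //; rewrite mulg1 E !invgM !mulgA mulgVK.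
apply/ell2_boundP; exists (N%:R * ell2_norm v ^+ 2) => A.
rewrite (partition_big_imfset _ m)/=.
apply: le_trans (ler_wpM2l (ler0n _ N) (part_norm v [fset m c | c in A]%fset)).
rewrite mulr_sumr; apply: ler_sum => e _.
rewrite (eq_bigr (fun=> rnorm (v e) ^+ 2)); last by move=> c /eqP <-.
rewrite big_const_seq iter_addr_0 -[leLHS]mulr_natl ler_wpM2r ?sqr_ge0// ler_nat.
by rewrite -size_filter fibre.
Qed.

Lemma rhoE f v c : hecke_pair Gam -> hecke f ->
  rho f v c = \sum_(d \in [set: GH])
    (Num.sqrt (modular (rep d)))%:C%C * f (dcl (rep d)) * v (cl (rep c * rep d)%g).
Proof.
move=> hG hf; rewrite /rho; set F := fun c : GH => \sum_(d \in _) _.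
suff FP : F \in @ell2_pred R GH C by rewrite -[LHS]/(val (insubd 0 F) c) insubdK.
pose S := fset_set [set c : GH | f (dcl (rep c)) != 0].
have -> : F = \sum_(d <- S) ((Num.sqrt (modular (rep d)))%:C%C * f (dcl (rep d))) *:
    (fun c : GH => v (cl (rep c * rep d)%g)).
  apply/funext => c0; rewrite fct_sumE /F.
  rewrite -(fsbig_widen [set c : GH | f (dcl (rep c)) != 0])//.
    by rewrite fsbig_finite//; exact: hecke_support.
  by move=> d /= [_ /negP/negPn/eqP ->]; rewrite mulr0 mul0r.
by apply: rpred_sum => d _; apply: rpredZ; exact: shift_ell2.
Qed.

Lemma C0_bounded phi : is_subgroup Gam -> C0 phi -> exists M : R, forall x, rnorm (phi x) <= M.
Proof.
move=> [G1 _ _] [phiG /(_ 1 ltr01) fin].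
have lc x y : lcoset Gam x y -> phi y = phi x by move=> [a Ga <-]; exact: phiG.
pose S := fset_set (lcoset Gam @` [set x | 1 <= rnorm (phi x)]).
pose u (K : set G) : R := rnorm (phi (xget 1%g K)).
exists (1 + \sum_(K <- S) u K) => x.
have u0 K : 0 <= u K by exact: rnorm_ge0.
have [x1|/ltW x1] := leP 1 (rnorm (phi x)); last first.
  by rewrite (le_trans x1)// lerDl sumr_ge0.
have xS : lcoset Gam x \in S by rewrite in_fset_set// inE; exists x.
rewrite (big_fsetD1 _ xS)/= addrCA ler_wpDr ?addr_ge0 ?sumr_ge0//.
rewrite /u; case: xgetP => [y _ /lc ->//|h].
by exfalso; apply: (h x); exists 1%g => //; rewrite mulg1.
Qed.

Lemma MrepE phi v c : is_subgroup Gam -> C0 phi -> Mrep phi v c = phi (rep c) * v c.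
Proof.
move=> hG /(C0_bounded hG)[M phiM]; rewrite /Mrep.
set F := fun c : GH => phi (rep c) * v c.
suff FP : F \in @ell2_pred R GH C by rewrite -[LHS]/(val (insubd 0 F) c) insubdK.
apply/ell2_boundP; exists (M ^+ 2 * ell2_norm v ^+ 2) => A.
apply: le_trans (ler_wpM2l (sqr_ge0 _) (part_norm v A)).
rewrite mulr_sumr; apply: ler_sum => d _.
rewrite /F -[phi _ * _]/(phi (rep d) *: v d) rnormZ exprMn ler_wpM2r ?sqr_ge0//.
by rewrite ler_sqr ?nnegrE ?rnorm_ge0// (le_trans (rnorm_ge0 _) (phiM (rep d))).
Qed.

End crossed_product.

(* Main.v *)
Require Import Defs.
From HB Require Import structures.
From mathcomp Require Import all_boot all_order all_algebra finmap.
From mathcomp Require Import all_classical all_reals all_analysis.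
From mathcomp.real_closed Require Import complex.
From mathcomp.analysis Require showcase.summability.
From mathcomp Require Import ring lra.
Set Implicit Arguments. Unset Strict Implicit. Unset Printing Implicit Defensive.
Import Order.TTheory GRing.Theory Num.Theory.
Import numFieldNormedType.Exports.
Local Open Scope classical_set_scope.
Local Open Scope ring_scope.

(** Put I = G / Gam and attach to an element f of the crossed product the matrix over I
    with entries k(c, d) = Delta(c^-1 d)^(1/2) f(c^-1 d)(c). Because Delta is a
    homomorphism ([modularM]), convolution becomes the product of matrices and the
    involution becomes the adjoint. Moreover f can be recovered from k, and a
    covariant f lies in the crossed product exactly when k has finitely many nonzero
    entries ([mat_ofK], [of_matK], [of_mat_crossed], [crossed_finmat]); the latter uses
    that orbits of Gam on I are finite. So, whatever the pair (G, Gam) is, the crossed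
    product is the *-algebra of finite matrices over I, and M x rho is its natural action
    on l^2(I).

    A *-algebra of finite matrices has only one C*-norm, the operator norm on l^2(I).
    [matrix_rep_bound] proves the inequality that matters without spectral theory.
    Matrix units are sent to contractions, so a *-representation Phi of the matrices
    supported on a finite set A satisfies |Phi(k)| <= C |k| with C depending on A only;
    inserting this into |Phi(k)|^2 <= |Phi(k^* k)| repeatedly gives
    |Phi(k)| <= C^(1/2^m) |k| for all m. The argument takes place inside an inner product
    space, so it also applies to operators that are not known to be bounded.

    Both norms of the theorem are therefore the operator norm. For the full norm
    ([full_normE]) the supremum is attained at the action on l^2(I). For the reduced norm
    ([red_normE]) it is attained at the character phi |-> phi(1) of D_r, whose regular
    representation is that same action; the upper bound is [matrix_rep_bound] applied to
    finitely supported vectors of H (x) l^2(I).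

    The norm closure of the finite matrices in B(l^2(I)) is the algebra of compact
    operators ([range_cpt]). It is thus a completion of the crossed product in either
    norm, and completions are unique ([completion_unique]). Finally M(phi) and rho(f) are
    given by matrices with finite rows, attached by the same formula to the images of phi
    and f in the ambient algebra of covariant functions; the covariance relations are
    then identities between products of matrices ([Mrep_rho_covariant]), and the
    boundedness of rho is the Schur test. *)

(** * Hilbert spaces and bounded operators *)

Section normed.
Variables (R : realType) (V : normedModType R[i]).
Implicit Types x y : V.

Lemma rnorm_sum (J : Type) (s : seq J) (F : J -> V) :
  rnorm (\sum_(j <- s) F j) <= \sum_(j <- s) rnorm (F j).
Proof.
elim: s => [|j s IHs]; first by rewrite !big_nil rnorm0.
by rewrite !big_cons (le_trans (rnormD _ _))// lerD2l.
Qed.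

Lemma rnorm_distC x y : rnorm (x - y) = rnorm (y - x).
Proof. by rewrite -rnormN opprB. Qed.

Lemma rnorm_triangle y x z : rnorm (x - z) <= rnorm (x - y) + rnorm (y - z).
Proof. by apply: le_trans (rnormD _ _); rewrite addrA subrK. Qed.

Lemma rnorm_le_eps x y (a : R) :
  (forall e : R, 0 < e -> rnorm (x - y) <= e * a) -> x = y.
Proof.
move=> h; apply/eqP; rewrite -subr_eq0; apply/eqP/rnorm_eq0/eqP.
rewrite eq_le rnorm_ge0 andbT leNgt; apply/negP => xy.
have a0 : 0 < a by have := lt_le_trans xy (h 1 ltr01); rewrite mul1r.
have := h (rnorm (x - y) / (2 * a)) (divr_gt0 xy (mulr_gt0 (ltr0Sn _ 1) a0)).
rewrite (_ : _ * a = rnorm (x - y) / 2); last by field; rewrite gt_eqF.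
by lra.
Qed.

(** As soon as [V] is nonzero, comparing M times a norm with a norm forces [M] to be
    real and nonnegative. *)
Lemma rnorm_bound (W : normedModType R[i]) (T : V -> W) :
  (exists M : R[i], forall x, `|T x| <= M * `|x|) <->
  (exists2 M : R, 0 <= M & forall x, rnorm (T x) <= M * rnorm x).
Proof.
split=> [[M hM]|[M M0 hM]]; last first.
  by exists M%:C%C => x; rewrite !rnormE -rmorphM /= lecR.
have [[x x0]|] := pselect (exists x : V, x != 0).
  exists (complex.Re M).
    have : 0 <= M * `|x| by apply: le_trans (hM x).
    rewrite pmulr_lge0 ?normr_gt0//.
    by case: M {hM} => a b; rewrite lecE /= => /andP[].
  move=> y; have := hM y; rewrite !rnormE; case: M {hM} => a b; rewrite lecE /=.
  by rewrite !mulr0 subr0 => /andP[].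
move=> /forallNP V0; exists 0 => // x; rewrite mul0r.
have := V0 x => /negP; rewrite negbK => /eqP ->.
by have := hM 0; rewrite normr0 mulr0 rnormE -(rmorph0 (real_complex R)) lecR.
Qed.

Lemma closure_rnormP (S : set V) x :
  closure S x <-> forall e : R, 0 < e -> exists2 y, S y & rnorm (x - y) <= e.
Proof.
split=> [cx e e0|h B].
  have [|y [Sy]] := cx (ball x (e%:C)%C); first by apply: nbhsx_ballx; rewrite ltcR.
  by rewrite -ball_normE /= rnormE ltcR => /ltW xy; exists y.
move=> /nbhs_ballP[e /= e0 eB].
have eE : e = (rnorm e)%:C%C by rewrite -rnormE gtr0_norm.
move: e0 eB; rewrite eE ltcR => e0 eB.
have [|y Sy xy] := h (rnorm e / 2); first by rewrite divr_gt0.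
exists y; split=> //; apply: eB; rewrite -ball_normE /= rnormE ltcR.
by apply: le_lt_trans xy _; rewrite ltr_pdivrMr// ltr_pMr// ltrDl.
Qed.

End normed.

Section hilbert.
Variables (R : realType) (H : hilbertType R).
Implicit Types x y z : H.

Lemma ip0r x : ip x 0 = 0 :> R[i].
Proof. by rewrite ip_conj ip0l rmorph0. Qed.

Lemma ipNl x y : ip (- x) y = - ip x y :> R[i].
Proof. by rewrite -scaleN1r ipZl mulN1r. Qed.

Lemma ipNr x y : ip x (- y) = - ip x y :> R[i].
Proof. by rewrite ip_conj ipNl rmorphN /= -ip_conj. Qed.

Lemma ipBl x y z : ip (x - y) z = ip x z - ip y z :> R[i].
Proof. by rewrite ipDl ipNl. Qed.

Lemma ipBr x y z : ip x (y - z) = ip x y - ip x z :> R[i].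
Proof. by rewrite ipDr ipNr. Qed.

Lemma ip_suml (J : Type) (s : seq J) (F : J -> H) z :
  ip (\sum_(j <- s) F j) z = \sum_(j <- s) ip (F j) z :> R[i].
Proof.
by elim: s => [|j s IHs]; rewrite ?big_nil ?ip0l// !big_cons ipDl IHs.
Qed.

Lemma ip_rnorm x : ip x x = (rnorm x ^+ 2)%:C%C :> R[i].
Proof. by rewrite ip_norm rnormE rmorphXn. Qed.

Lemma rnorm_sqr x : rnorm x ^+ 2 = rnorm (ip x x : R[i]).
Proof. by rewrite ip_rnorm rnormC ger0_norm// sqr_ge0. Qed.

Lemma Cauchy_Schwarz x y : rnorm (ip x y : R[i]) <= rnorm x * rnorm y.
Proof.
have [->|y0] := eqVneq y 0; first by rewrite ip0r !rnorm0 mulr0.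
have ny : 0 < rnorm y.
  by rewrite lt_neqAle rnorm_ge0 andbT eq_sym; apply: contra_neq y0; exact: rnorm_eq0.
set a : R[i] := ip x y.
(* the square of the norm of |y|^2 x - <x, y> y *)
have h : 0 <= (rnorm y ^+ 2) ^+ 2 * rnorm x ^+ 2 - rnorm y ^+ 2 * rnorm a ^+ 2.
  rewrite (_ : _ - _ = rnorm ((rnorm y ^+ 2)%:C%C *: x - a *: y) ^+ 2) ?sqr_ge0//.
  apply: complexI; rewrite -(ip_rnorm (_ - _)) ipBl !ipBr !ipZl !ipZr !ip_rnorm.
  have cr (r : R) : (r%:C%C)^* = r%:C%C :> R[i] by exact: conjc_real.
  have aE : ((rnorm a ^+ 2)%:C)%C = a * a^* by rewrite rmorphXn /= -rnormE normCK.
  have key (Y X A : R) :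
      (Y ^+ 2 * X - Y * A)%:C%C = Y%:C%C ^+ 2 * X%:C%C - Y%:C%C * A%:C%C :> R[i].
    by rewrite rmorphB !rmorphM.
  by rewrite (ip_conj x y) -/a cr key aE; ring.
rewrite -ler_sqr ?nnegrE ?rnorm_ge0 ?mulr_ge0 ?rnorm_ge0//.
rewrite exprMn -(ler_pM2l (exprn_gt0 2 ny)).
move: h; rewrite subr_ge0 => /le_trans; apply.
by rewrite le_eqVlt; apply/orP; left; apply/eqP; ring.
Qed.

Lemma ip_inj x y : (forall z, ip x z = ip y z :> R[i]) -> x = y.
Proof.
move=> h; apply/eqP; rewrite -subr_eq0; apply/eqP/rnorm_eq0/eqP.
by rewrite -sqrf_eq0; apply/eqP/complexI; rewrite -ip_rnorm ipBl h subrr.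
Qed.

Lemma ip_injr x y : (forall z, ip z x = ip z y :> R[i]) -> x = y.
Proof. by move=> h; apply: ip_inj => z; rewrite ip_conj h -ip_conj. Qed.

End hilbert.

Section opnorm.
Variables (R : realType) (H K : hilbertType R).
Implicit Types T : H -> K.

Lemma linop0 T : linear T -> T 0 = 0.
Proof.
by move=> Tl; apply/eqP; have /eqP := Tl 1 0 0; rewrite !scale1r addr0 -subr_eq subrr eq_sym.
Qed.

Lemma linopD T x y : linear T -> T (x + y) = T x + T y.
Proof. by move=> Tl; have := Tl 1 x y; rewrite !scale1r. Qed.

Lemma linopZ T k x : linear T -> T (k *: x) = k *: T x.
Proof. by move=> Tl; have := Tl k x 0; rewrite !addr0 linop0// addr0. Qed.

Lemma linopB T x y : linear T -> T (x - y) = T x - T y.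
Proof. by move=> Tl; rewrite linopD// -scaleN1r linopZ// scaleN1r. Qed.

Lemma linop_sum T (J : Type) (s : seq J) (F : J -> H) : linear T ->
  T (\sum_(j <- s) F j) = \sum_(j <- s) T (F j).
Proof.
by move=> Tl; elim: s => [|j s IHs]; rewrite ?big_nil ?linop0// !big_cons linopD// IHs.
Qed.

Lemma opnorm_leP T (M : R) : linear T -> 0 <= M ->
  (opnorm T <= M%:E)%E <-> forall x, rnorm (T x) <= M * rnorm x.
Proof.
move=> Tl M0; split=> [h x|h].
  have [->|x0] := eqVneq x 0; first by rewrite linop0// !rnorm0 mulr0.
  have nx : 0 < rnorm x.
    by rewrite lt_neqAle rnorm_ge0 andbT eq_sym; apply: contra_neq x0; exact: rnorm_eq0.
  have rn : rnorm ((rnorm x)^-1%:C%C : R[i]) = (rnorm x)^-1.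
    by rewrite rnormC ger0_norm// invr_ge0 ltW.
  have : ((rnorm (T ((rnorm x)^-1%:C%C *: x)))%:E <= M%:E)%E.
    apply: le_trans h; apply: ereal_sup_ubound; exists ((rnorm x)^-1%:C%C *: x) => //=.
    rewrite rnormE rnormZ rn mulVf ?gt_eqF//.
  by rewrite lee_fin linopZ// rnormZ rn ler_pdivrMl// mulrC.
apply: ge_ereal_sup => _ [x /= x1 <-]; rewrite lee_fin.
apply: le_trans (h x) _; rewrite ler_piMr//.
by move: x1; rewrite rnormE -[1]/(1%:C)%C lecR.
Qed.

Lemma opnorm_ge0 T : (0 <= opnorm T)%E.
Proof.
apply: (@le_trans _ _ (rnorm (T 0))%:E); first by rewrite lee_fin rnorm_ge0.
by apply: ereal_sup_ubound; exists 0 => //=; rewrite normr0.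
Qed.

Definition onorm T : R := fine (opnorm T).

Lemma onorm_ge0 T : 0 <= onorm T.
Proof. by rewrite fine_ge0// opnorm_ge0. Qed.

Lemma bounded_opP T : bounded_op T <->
  linear T /\ exists2 M : R, 0 <= M & forall x, rnorm (T x) <= M * rnorm x.
Proof. by split=> -[Tl] /rnorm_bound. Qed.

Lemma opnormE T : bounded_op T -> opnorm T = (onorm T)%:E.
Proof.
move=> /bounded_opP[Tl [M M0 /opnorm_leP hM]]; rewrite /onorm fineK//.
rewrite ge0_fin_numE ?opnorm_ge0//; apply: le_lt_trans (hM Tl M0) _.
exact: ltry.
Qed.

Lemma onorm_le T (M : R) : 0 <= M -> linear T ->
  (forall x, rnorm (T x) <= M * rnorm x) -> onorm T <= M.
Proof.
move=> M0 Tl hM; rewrite -lee_fin -opnormE; first exact/opnorm_leP.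
by apply/bounded_opP; split=> //; exists M.
Qed.

Lemma onormP T x : bounded_op T -> rnorm (T x) <= onorm T * rnorm x.
Proof.
move=> Tb; have [Tl _] := Tb; move: x; apply/opnorm_leP => //.
  exact: onorm_ge0.
by rewrite -opnormE.
Qed.

End opnorm.

(** * The Hilbert spaces of square-summable families *)

Lemma fsum_fset (V : nmodType) (I : choiceType) (A : {fset I}) (F : I -> V) :
  (forall j, j \notin A -> F j = 0) ->
  \sum_(j \in [set: I]) F j = \sum_(j <- A) F j.
Proof.
move=> FA; rewrite -(fsbig_widen [set` A])//; last first.
  by move=> j /= [_ /negP/FA].
by rewrite fsbig_finite//= set_fsetK.
Qed.

Lemma fset_sum1 (V : nmodType) (I : choiceType) (A : {fset I}) (a : I) (F : I -> V) :
  a \in A -> (forall i, i != a -> F i = 0) -> \sum_(i <- A) F i = F a.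
Proof.
move=> aA Fa; rewrite (big_fsetD1 a)//= big_seq big1 ?addr0// => i.
by rewrite !inE => /andP[/Fa].
Qed.

Section ell2_theory.
Variables (R : realType) (I : choiceType) (H : hilbertType R).
Implicit Types (x y : ell2 I H) (A : {fset I}).

Lemma ell2P x y : (forall i, x i = y i) -> x = y.
Proof. by move=> xy; apply: val_inj; exact/funext. Qed.

Lemma ell2_add x y i : (x + y) i = x i + y i. Proof. by []. Qed.
Lemma ell2_opp x i : (- x) i = - x i. Proof. by []. Qed.
Lemma ell2_scale (k : R[i]) x i : (k *: x) i = k *: x i. Proof. by []. Qed.
Lemma ell2_sum (J : Type) (s : seq J) (F : J -> ell2 I H) i :
  (\sum_(j <- s) F j) i = \sum_(j <- s) F j i.
Proof. by elim: s => [|j s IHs]; rewrite ?big_nil// !big_cons ell2_add IHs. Qed.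

Lemma rnorm_leP x (M : R) : 0 <= M ->
  (forall A, \sum_(i <- A) rnorm (x i) ^+ 2 <= M ^+ 2) <-> rnorm x <= M.
Proof. by move=> M0; rewrite ell2_rnorm; exact: ell2_norm_leP. Qed.

Lemma rnorm_part x A : \sum_(i <- A) rnorm (x i) ^+ 2 <= rnorm x ^+ 2.
Proof. by rewrite ell2_rnorm; exact: part_norm. Qed.

Lemma rnorm_coord x i : rnorm (x i) <= rnorm x.
Proof. by rewrite ell2_rnorm; exact: rnorm_ell2. Qed.

Lemma tensE (v : H) (i j : I) : tens v (delta R i) j = if j == i then v else 0.
Proof. by rewrite /tens /=; case: eqP => _; rewrite ?scale1r ?scale0r. Qed.

Definition supp_in A (x : I -> H) := forall i, i \notin A -> x i = 0.

Definition ftrunc A (x : I -> H) : ell2 I H := \sum_(i <- A) tens (x i) (delta R i).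

Lemma ftruncE A (x : I -> H) j : ftrunc A x j = if j \in A then x j else 0.
Proof.
rewrite /ftrunc ell2_sum; case: ifPn => jA.
  by rewrite (fset_sum1 jA) => [|i /negPf ij]; rewrite tensE ?eqxx// eq_sym ij.
by rewrite big_seq big1// => i iA; rewrite tensE; case: eqP => // ji; rewrite ji iA in jA.
Qed.

Definition mkell2 (x : I -> H) : ell2 I H := insubd 0 x.

Lemma mkell2E (x : I -> H) : x \in @ell2_pred R I H -> mkell2 x = x :> (I -> H).
Proof. by move=> xP; rewrite -[LHS]/(val (mkell2 x)) insubdK. Qed.

Lemma supp_ell2 A (x : I -> H) : supp_in A x -> x \in @ell2_pred R I H.
Proof.
move=> xA; rewrite (_ : x = ftrunc A x); first exact: ell2_valP.
by apply/funext => i; rewrite ftruncE; case: ifPn => // /xA.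
Qed.

Lemma ftrunc_supp A x : supp_in A x -> ftrunc A x = x.
Proof. by move=> xA; apply: ell2P => i; rewrite ftruncE; case: ifPn => // /xA. Qed.

(** Finitely supported families are dense: cut where the partial sums of squares come
    within e^2 of their supremum. *)
Lemma ftrunc_approx x (e : R) : 0 < e -> exists A, rnorm (x - ftrunc A x) <= e.
Proof.
move=> e0; have [A hA] : exists A : {fset I},
    rnorm x ^+ 2 - e ^+ 2 <= \sum_(i <- A) rnorm (x i) ^+ 2.
  apply: contrapT => /forallNP h.
  have h2 A : \sum_(i <- A) rnorm (x i) ^+ 2 <= rnorm x ^+ 2 - e ^+ 2.
    by apply/ltW; rewrite ltNge; apply/negP/h.
  have p0 : 0 <= rnorm x ^+ 2 - e ^+ 2 by have := h2 fset0; rewrite big_seq_fset0.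
  have : rnorm x <= Num.sqrt (rnorm x ^+ 2 - e ^+ 2).
    by apply/rnorm_leP => [|A]; rewrite ?sqrtr_ge0// sqr_sqrtr.
  rewrite -ler_sqr ?nnegrE ?rnorm_ge0 ?sqrtr_ge0// [leRHS]sqr_sqrtr//.
  by rewrite lerBrDr gerDl leNgt exprn_gt0.
exists A; apply/rnorm_leP => [|D]; first exact: ltW.
have E i : (x - ftrunc A x) i = if i \in A then 0 else x i.
  by rewrite ell2_add ell2_opp ftruncE; case: ifP; rewrite ?subrr ?subr0.
under eq_bigr do rewrite E.
have -> : \sum_(i <- D) rnorm (if i \in A then 0 else x i) ^+ 2 =
    \sum_(i <- [fset i in D | i \notin A]%fset) rnorm (x i) ^+ 2.
  rewrite (big_fsetID _ (mem A) D) /= big_seq big1 ?add0r => [|i]; last first.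
    by rewrite !inE => /andP[_ ->]; rewrite rnorm0 expr0n.
  rewrite big_seq [RHS]big_seq; apply: eq_bigr => i.
  by rewrite !inE => /andP[_ /negPf ->].
have := rnorm_part x (D `|` A)%fset.
rewrite (big_fsetID _ (mem A) (D `|` A)%fset) /=.
have -> : [fset i in (D `|` A)%fset | i \in A]%fset = A.
  by apply/fsetP => i; rewrite !inE; case: (i \in A); rewrite ?andbF ?orbT.
have -> : [fset i in (D `|` A)%fset | i \notin A]%fset = [fset i in D | i \notin A]%fset.
  by apply/fsetP => i; rewrite !inE; case: (i \in A); rewrite ?andbF ?orbF.
by move: hA; lra.
Qed.

#[local] Existing Instance summability.totally_filter.

(** The net of partial sums that defines the inner product is constant once it has
    passed [i]. *)
Lemma ip_tens (v : H) i y : ip (tens v (delta R i)) y = ip v (y i) :> R[i].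
Proof.
apply: (cvg_lim (@norm_hausdorff _ _)); apply/cvgrPdist_le => e e0.
exists [fset i]%fset => // A; rewrite /mkset/= fsub1set => iA.
rewrite (fset_sum1 iA) => [|j /negPf ->]; last by rewrite scale0r ip0l.
by rewrite eqxx scale1r subrr normr0 ltW.
Qed.

Lemma ip_supp A x y : supp_in A x -> ip x y = \sum_(i <- A) ip (x i) (y i) :> R[i].
Proof.
by move=> /ftrunc_supp <-; rewrite /ftrunc ip_suml; apply: eq_big_seq => i iA;
  rewrite ip_tens ftruncE iA.
Qed.

Lemma rnorm_supp A x : supp_in A x -> rnorm x ^+ 2 = \sum_(i <- A) rnorm (x i) ^+ 2.
Proof.
move=> xA; apply: complexI; rewrite -ip_rnorm (ip_supp _ xA) rmorph_sum /=.
by apply: eq_bigr => i _; rewrite ip_rnorm.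
Qed.

Lemma rnorm_ftrunc A x : rnorm (ftrunc A x) <= rnorm x.
Proof.
rewrite -ler_sqr ?nnegrE ?rnorm_ge0// (@rnorm_supp A).
  by apply: le_trans (rnorm_part x A); apply: ler_sum => i _; rewrite ftruncE;
    case: ifP => // _; rewrite rnorm0 expr0n/= sqr_ge0.
by move=> i /negPf iA; rewrite ftruncE iA.
Qed.

Lemma rnorm_tens (v : H) (i : I) : rnorm (tens v (delta R i)) = rnorm v.
Proof.
apply/eqP; rewrite -(@eqrXn2 _ 2) ?rnorm_ge0//; apply/eqP/complexI.
by rewrite -!ip_rnorm ip_tens tensE eqxx.
Qed.

End ell2_theory.

Section ell2_scalar.
Variables (R : realType) (I : choiceType).
Local Notation C := R[i].
Implicit Types (x y : ell2 I C).

Lemma tens1 (i : I) : tens (1 : C) (delta R i) = delta R i.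
Proof. by apply: ell2P => j; rewrite tensE /=; case: eqP. Qed.

Lemma deltaE (i j : I) : delta R i j = (j == i)%:R :> C. Proof. by []. Qed.

Lemma tens_delta (a : C) (i : I) : tens a (delta R i) = a *: delta R i.
Proof.
apply: ell2P => j; rewrite tensE ell2_scale deltaE.
by case: eqP; rewrite ?scaler0//= /GRing.scale/= mulr1.
Qed.

Lemma ip_delta x i : ip x (delta R i) = x i :> C.
Proof. by rewrite ip_conj -tens1 ip_tens -ip_conj /= /ip/= conjC1 mulr1. Qed.

Lemma rnorm_delta (i : I) : rnorm (delta R i : ell2 I C) = 1.
Proof. by rewrite -tens1 rnorm_tens /rnorm normr1. Qed.
End ell2_scalar.

(** * Matrices *)
(** Taking 2^m-th roots removes the constant. If b < a then (a / b)^(2^m) would be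
    bounded by c, contrary to the inequality of Bernoulli. *)
Lemma pow2_le (R : realType) (a b c : R) : 0 <= a -> 0 <= b ->
  (forall m, a ^+ (2 ^ m) <= c * b ^+ (2 ^ m)) -> a <= b.
Proof.
move=> a0; rewrite le_eqVlt => /predU1P[<-|b0] h.
  by have := h 0%N; rewrite expr1 mulr0.
rewrite leNgt; apply/negP => ba.
pose t := a / b; have t1 : 0 < t - 1 by rewrite subr_gt0 ltr_pdivlMr// mul1r.
have bern n : 1 + n%:R * (t - 1) <= t ^+ n.
  elim: n => [|n IHn]; first by rewrite mul0r addr0.
  rewrite exprS; apply: (@le_trans _ _ (t * (1 + n%:R * (t - 1)))); last first.
    by rewrite ler_wpM2l// divr_ge0// ltW.
  rewrite -natr1 -subr_ge0 (_ : _ - _ = n%:R * (t - 1) ^+ 2); last by ring.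
  by rewrite mulr_ge0 ?sqr_ge0.
have tc m : m%:R * (t - 1) <= c.
  apply: (@le_trans _ _ (t ^+ (2 ^ m))).
    apply: le_trans (bern _).
    apply: (@le_trans _ _ ((2 ^ m)%:R * (t - 1))); last by rewrite lerDr.
    by rewrite ler_pM2r// ler_nat ltnW// ltn_expl.
  by rewrite expr_div_n ler_pdivrMr ?exprn_gt0.
have c0 : 0 <= c by have := tc 0%N; rewrite mul0r.
have := archi_boundP (divr_ge0 c0 (ltW t1)).
by rewrite ltr_pdivrMr// ltNge tc.
Qed.

(** The square of |S v| is <v, T S v>, at most |v| M |S v|. Stated relative to a stable
    subset [V], because the adjoint relation is sometimes known on a subspace only. *)
Lemma adjoint_bound (R : realType) (H : hilbertType R) (V : set H)
    (S T : H -> H) (M : R) : 0 <= M ->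
  (forall v, V v -> V (S v)) ->
  (forall v w, V v -> V w -> ip (S v) w = ip v (T w) :> R[i]) ->
  (forall w, V w -> rnorm (T w) <= M * rnorm w) ->
  forall v, V v -> rnorm (S v) <= M * rnorm v.
Proof.
move=> M0 VS ST TM v Vv; have := rnorm_ge0 (S v); rewrite le_eqVlt => /predU1P[<-|Sv].
  by rewrite mulr_ge0 ?rnorm_ge0.
rewrite -(ler_pM2r Sv) -expr2.
rewrite rnorm_sqr ST//; last exact: VS.
apply: le_trans (Cauchy_Schwarz _ _) _.
rewrite [leRHS]mulrAC [leRHS]mulrC ler_wpM2l ?rnorm_ge0//.
by apply: TM; exact: VS.
Qed.

Section matrices.
Variables (R : realType) (I : choiceType).
Local Notation C := R[i].
Local Notation mat := (I -> I -> C).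
Implicit Types (k l : mat) (A : {fset I}).

Definition rowfin k := forall i, finite_set [set j | k i j != 0].
Definition mapp k (v : I -> C) : I -> C := fun i => \sum_(j \in [set: I]) k i j * v j.
Definition matmul k l : mat := fun i j => \sum_(m \in [set: I]) k i m * l m j.
Definition matstar k : mat := fun i j => (k j i)^*.
Definition munit i j : mat := fun a b => ((a == i) && (b == j))%:R.
Definition supp2 A k := forall i j, (i \in A) && (j \in A) = false -> k i j = 0.
Definition finmat k := exists A, supp2 A k.

Lemma mappE A k v i : (forall j, j \notin A -> k i j = 0) ->
  mapp k v i = \sum_(j <- A) k i j * v j.
Proof. by move=> kA; apply: fsum_fset => j /kA ->; rewrite mul0r. Qed.

Lemma matD k l i j : (k + l) i j = k i j + l i j. Proof. by []. Qed.
Lemma matZ c k i j : (c *: k) i j = c * k i j. Proof. by []. Qed.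

Lemma rowfin_fset k i : rowfin k -> exists A : {fset I}, forall j, j \notin A -> k i j = 0.
Proof.
move=> kf; exists (fset_set [set j | k i j != 0]) => j.
by rewrite in_fset_set// notin_setE /= => /negP/negPn/eqP.
Qed.

Lemma mapp_matmul k l v : rowfin k -> rowfin l -> mapp (matmul k l) v = mapp k (mapp l v).
Proof.
move=> kf lf; apply/funext => i; have [A kA] := rowfin_fset i kf.
pose B := (\bigcup_(m <- A) fset_set [set j | l m j != 0])%fset.
have lB m j : m \in A -> j \notin B -> l m j = 0.
  move=> mA; apply: contraNeq => lmj; apply/bigfcupP; exists m; rewrite ?mA//.
  by rewrite in_fset_set// inE.
have kmE j : matmul k l i j = \sum_(m <- A) k i m * l m j.
  by apply: fsum_fset => m /kA ->; rewrite mul0r.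
rewrite (mappE (A := B)) => [|j jB]; last first.
  by rewrite kmE big_seq big1// => m mA; rewrite lB ?mulr0.
rewrite (mappE (A := A))//; under eq_bigr do rewrite kmE mulr_suml.
rewrite exchange_big/=; apply: eq_big_seq => m mA.
rewrite (mappE (A := B)); last by move=> j; exact: lB.
by rewrite mulr_sumr; apply: eq_bigr => j _; rewrite mulrA.
Qed.

Lemma matmul_mapp k l i j : matmul k l i j = mapp k (l^~ j) i. Proof. by []. Qed.

Lemma rowfin_matmul k l : rowfin k -> rowfin l -> rowfin (matmul k l).
Proof.
move=> kf lf i; have [A kA] := rowfin_fset i kf.
apply: (@sub_finite_set _ _ (\bigcup_(m in [set` A]) [set j | l m j != 0])); last first.
  by apply: bigcup_finite => //; exact: finite_fset.
move=> j /=; apply: contraNP => h; rewrite matmul_mapp (mappE (A := A))//.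
rewrite big_seq big1// => m mA; have [->|lmj] := eqVneq (l m j) 0; first by rewrite mulr0.
by exfalso; apply: h; exists m.
Qed.

Lemma mappD k l v : rowfin k -> rowfin l -> mapp (k + l) v = mapp k v + mapp l v.
Proof.
move=> kf lf; apply/funext => i.
have [A kA] := rowfin_fset i kf; have [B lB] := rowfin_fset i lf.
have kAB j : j \notin (A `|` B)%fset -> k i j = 0 by rewrite !inE negb_or => /andP[/kA].
have lAB j : j \notin (A `|` B)%fset -> l i j = 0 by rewrite !inE negb_or => /andP[_ /lB].
rewrite -[RHS]/(mapp k v i + mapp l v i) (mappE (k := k) v kAB) (mappE (k := l) v lAB) -big_split.
rewrite (mappE (A := (A `|` B)%fset)) => [|j jAB]; last first.
  by rewrite matD kAB// lAB// addr0.
by apply: eq_bigr => j _; rewrite matD mulrDl.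
Qed.

Lemma mappZ c k v : rowfin k -> mapp (c *: k) v = c *: mapp k v.
Proof.
move=> kf; apply/funext => i; have [A kA] := rowfin_fset i kf.
rewrite -[RHS]/(c * mapp k v i) (mappE (k := k) v kA) (mappE (A := A)) => [|j jA].
  by rewrite mulr_sumr; apply: eq_bigr => j _; rewrite matZ mulrA.
by rewrite matZ kA// mulr0.
Qed.

Lemma supp2_rowfin A k : supp2 A k -> rowfin k.
Proof.
move=> kA i; apply: (@sub_finite_set _ _ [set` A]); last exact: finite_fset.
by move=> j /=; apply: contraNT => /negPf jA; apply/eqP; rewrite kA// jA andbF.
Qed.

Lemma supp2_col A k i j : supp2 A k -> j \notin A -> k i j = 0.
Proof. by move=> kA /negPf jA; rewrite kA// jA andbF. Qed.

Lemma supp2S A B k : (A `<=` B)%fset -> supp2 A k -> supp2 B k.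
Proof.
move=> /fsubsetP AB kA i j ij; apply: kA; apply: contraFF ij => /andP[iA jA].
by rewrite !AB.
Qed.

Lemma supp2_lin A c k l : supp2 A k -> supp2 A l -> supp2 A (c *: k + l).
Proof. by move=> kA lA i j ij; rewrite !fctE kA// lA// addr0 scaler0. Qed.

Lemma supp2_matmul A k l : supp2 A k -> supp2 A l -> supp2 A (matmul k l).
Proof.
move=> kA lA i j ij; rewrite matmul_mapp (mappE (A := A)); last first.
  by move=> m; exact: supp2_col.
rewrite big_seq big1// => m mA; move: ij.
have [iA /= jA|iA _] := boolP (i \in A); first by rewrite lA ?mulr0// jA andbF.
by rewrite kA ?mul0r// (negPf iA).
Qed.

Lemma supp2_matstar A k : supp2 A k -> supp2 A (matstar k).
Proof. by move=> kA i j ij; rewrite /matstar kA ?conjC0// andbC. Qed.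

Lemma finmat_supp2 k l : finmat k -> finmat l -> exists A, supp2 A k /\ supp2 A l.
Proof.
move=> [A kA] [B lB]; exists (A `|` B)%fset.
by split; [apply: supp2S kA; exact: fsubsetUl|apply: supp2S lB; exact: fsubsetUr].
Qed.

Lemma finmat_lin c k l : finmat k -> finmat l -> finmat (c *: k + l).
Proof.
by move=> kf lf; have [A [kA lA]] := finmat_supp2 kf lf; exists A; exact: supp2_lin.
Qed.

Lemma finmat0 : finmat 0.
Proof. by exists fset0. Qed.

Lemma finmat_matmul k l : finmat k -> finmat l -> finmat (matmul k l).
Proof.
by move=> kf lf; have [A [kA lA]] := finmat_supp2 kf lf; exists A; exact: supp2_matmul.
Qed.

Lemma finmat_matstar k : finmat k -> finmat (matstar k).
Proof. by move=> [A kA]; exists A; exact: supp2_matstar. Qed.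

Lemma finmat_rowfin k : finmat k -> rowfin k.
Proof. by move=> [A kA]; exact: supp2_rowfin kA. Qed.

Lemma matstarK k : matstar (matstar k) = k.
Proof. by apply/funext => i; apply/funext => j; rewrite /matstar conjCK. Qed.

Lemma finmat_munit i j : finmat (munit i j).
Proof.
exists [fset i; j]%fset => a b; rewrite /munit !inE => ab.
case: eqP => [ai|//]; case: eqP => [bj|//].
by move: ab; rewrite ai bj !eqxx orbT.
Qed.

Lemma matstar_munit i j : matstar (munit i j) = munit j i.
Proof.
by apply/funext => a; apply/funext => b; rewrite /matstar /munit andbC conjC_nat.
Qed.

Lemma matmul_munit i j m n : matmul (munit i j) (munit m n) = (j == m)%:R *: munit i n.
Proof.
apply/funext => a; apply/funext => b; rewrite matmul_mapp (mappE (A := [fset j]%fset)).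
  rewrite big_seq_fset1 /munit !fctE /GRing.scale/= eqxx andbT -!natrM !mulnb.
  by congr (_ %:R); case: (a == i); case: (j == m); case: (b == n).
by move=> c; rewrite inE /munit => /negPf ->; rewrite andbF.
Qed.

Lemma supp2_sum A k : supp2 A k ->
  k = \sum_(i <- A) \sum_(j <- A) k i j *: munit i j.
Proof.
move=> kA; apply/funext => a; apply/funext => b; rewrite !fct_sumE.
under eq_bigr do rewrite !fct_sumE.
have E i j : (k i j *: munit i j) a b = if (i == a) && (j == b) then k a b else 0.
  rewrite matZ /munit ![_ == i]eq_sym ![_ == j]eq_sym.
  by case: eqP => [->|]; case: eqP => [->|]; rewrite ?mulr1 ?mulr0.
under eq_bigr do under eq_bigr do rewrite E.
have [/andP[aA bA]|ab] := boolP ((a \in A) && (b \in A)).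
  rewrite (fset_sum1 aA) => [|i /negPf ->]; last by rewrite big1.
  by rewrite (fset_sum1 bA) => [|j /negPf ->]; rewrite ?eqxx// andbF.
rewrite kA; last exact/negbTE.
by rewrite big1// => i _; rewrite big1// => j _; case: ifP.
Qed.

(** The action of a matrix on l^2, with the default value 0 where the resulting family
    is not square-summable; for finite matrices this does not occur ([matopE]). *)
Definition matop k (v : ell2 I C) : ell2 I C := mkell2 (mapp k v).

Lemma matopE k v : finmat k -> matop k v = mapp k v :> (I -> C).
Proof.
move=> [A kA]; apply: mkell2E; apply: (@supp_ell2 _ _ _ A) => i /negPf iA.
rewrite (mappE (A := fset0)) ?big_seq_fset0// => j _.
by rewrite kA// iA.
Qed.

Lemma matop_lin c k l v : finmat k -> finmat l ->
  matop (c *: k + l) v = c *: matop k v + matop l v.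
Proof.
move=> kf lf; apply: ell2P => i; rewrite ell2_add ell2_scale !matopE//; last exact: finmat_lin.
have cf : finmat (c *: k) by rewrite -[c *: k]addr0; apply: finmat_lin => //; exact: finmat0.
by rewrite mappD; [rewrite mappZ//; exact: finmat_rowfin|exact: finmat_rowfin..].
Qed.

Lemma matop_matmul k l v : finmat k -> finmat l -> matop (matmul k l) v = matop k (matop l v).
Proof.
move=> kf lf; apply: ell2P => i; rewrite !matopE//; last exact: finmat_matmul.
by rewrite mapp_matmul//; exact: finmat_rowfin.
Qed.

Lemma matop_supp A k v : supp2 A k -> supp_in A (matop k v).
Proof.
move=> kA i /negPf iA; rewrite matopE; last by exists A.
rewrite (mappE (A := fset0)) ?big_seq_fset0// => j _.
by rewrite kA// iA.
Qed.

Lemma matop_adj k v w : finmat k -> ip (matop k v) w = ip v (matop (matstar k) w) :> C.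
Proof.
move=> kf; have [A kA] := kf; rewrite (ip_supp _ (matop_supp v kA)).
rewrite (ip_conj (matop _ w)) (ip_supp _ (matop_supp w (supp2_matstar kA))).
rewrite rmorph_sum /=.
have E k' u i : supp2 A k' -> matop k' u i = \sum_(j <- A) k' i j * u j.
  by move=> k'A; rewrite matopE; [apply: mappE => j; exact: supp2_col k'A|exists A].
under eq_bigr do rewrite E// /ip/= mulr_suml.
rewrite exchange_big /=; apply: eq_bigr => j _.
rewrite E; last exact: supp2_matstar.
rewrite /ip/= mulr_suml rmorph_sum /=; apply: eq_bigr => i _.
by rewrite /matstar !rmorphM /= !conjCK; ring.
Qed.

Lemma matop_linear k : finmat k -> linear (matop k).
Proof.
move=> kf c v w; apply: ip_inj => z; rewrite ipDl ipZl.
by rewrite !matop_adj// ipDl ipZl.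
Qed.

Lemma matop_bounded k : finmat k -> bounded_op (matop k).
Proof.
move=> kf; have [A kA] := kf; apply/bounded_opP; split; first exact: matop_linear.
exists (\sum_(i <- A) \sum_(j <- A) rnorm (k i j : C)) => [|v].
  by do 2 (apply: sumr_ge0 => ? _); exact: rnorm_ge0.
rewrite -(ftrunc_supp (matop_supp v kA)) mulr_suml.
apply: le_trans (rnorm_sum _ _) _; apply: ler_sum => i _.
rewrite rnorm_tens matopE// (mappE (A := A)) => [|j]; last exact: supp2_col.
apply: le_trans (rnorm_sum _ _) _; rewrite mulr_suml; apply: ler_sum => j _.
by rewrite -[k i j * v j]/(k i j *: v j) rnormZ ler_wpM2l ?rnorm_ge0// rnorm_coord.
Qed.

Lemma matop_delta k i j : finmat k -> matop k (delta R j) i = k i j.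
Proof.
move=> kf; have [A kA] := kf; rewrite matopE// (mappE (A := (j |` A)%fset)) => [|m].
  rewrite (big_fsetD1 j) ?inE ?eqxx// deltaE eqxx mulr1 big_seq big1 ?Monoid.mulm1// => m.
  by rewrite !inE deltaE => /andP[/negPf -> _]; rewrite mulr0.
by rewrite !inE negb_or => /andP[_]; exact: supp2_col.
Qed.

Lemma entry_le k i j : finmat k -> rnorm (k i j : C) <= onorm (matop k).
Proof.
move=> kf; rewrite -(matop_delta i j kf); apply: le_trans (rnorm_coord _ _) _.
by apply: le_trans (onormP _ (matop_bounded kf)) _; rewrite rnorm_delta mulr1.
Qed.

Lemma onorm_matstar k : finmat k -> onorm (matop (matstar k)) <= onorm (matop k).
Proof.
move=> kf; have kf' := finmat_matstar kf.
apply: onorm_le => [||x]; [exact: onorm_ge0|exact: matop_linear|].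
apply: (adjoint_bound (V := setT) (T := matop k)) => //; first exact: onorm_ge0.
  by move=> v w _ _; rewrite matop_adj// matstarK.
by move=> w _; exact: onormP (matop_bounded kf).
Qed.

Lemma onorm_sqr k : finmat k ->
  onorm (matop (matmul (matstar k) k)) <= onorm (matop k) ^+ 2.
Proof.
move=> kf; have kf' := finmat_matstar kf.
apply: onorm_le => [||x]; first by rewrite sqr_ge0.
  by apply: matop_linear; exact: finmat_matmul.
rewrite matop_matmul//; apply: le_trans (onormP _ (matop_bounded kf')) _.
rewrite expr2 -mulrA ler_pM ?onorm_ge0 ?rnorm_ge0 ?onorm_matstar//.
exact: onormP (matop_bounded kf).
Qed.

End matrices.

Section matrix_representation.
Variables (R : realType) (I : choiceType) (H : hilbertType R) (W : set H).
Local Notation C := R[i].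
Local Notation mat := (I -> I -> C).
Variable Phi : mat -> H -> H.
Hypothesis PhiW : forall k w, finmat k -> W w -> W (Phi k w).
Hypothesis PhiL : forall c k l w, finmat k -> finmat l -> W w ->
  Phi (c *: k + l) w = c *: Phi k w + Phi l w.
Hypothesis PhiM : forall k l w, finmat k -> finmat l -> W w ->
  Phi (matmul k l) w = Phi k (Phi l w).
Hypothesis PhiS : forall k v w, finmat k -> W v -> W w ->
  ip (Phi k v) w = ip v (Phi (matstar k) w) :> C.

Let Phi0 w : W w -> Phi 0 w = 0.
Proof.
move=> Ww; have := PhiL 1 (finmat0 R I) (finmat0 R I) Ww.
by rewrite addr0 !scale1r => /eqP; rewrite -subr_eq subrr => /eqP.
Qed.

Let Phi_sum (s : seq I) (F : I -> mat) w : (forall i, finmat (F i)) -> W w ->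
  finmat (\sum_(i <- s) F i) /\ Phi (\sum_(i <- s) F i) w = \sum_(i <- s) Phi (F i) w.
Proof.
move=> Ff Ww; elim: s => [|i s [IHf IH]].
  by rewrite !big_nil; split; [exact: finmat0|exact: Phi0].
rewrite !big_cons -[F i]scale1r; split; first exact: finmat_lin.
by rewrite PhiL// IH !scale1r.
Qed.

(** The diagonal unit e_jj is a self-adjoint idempotent, hence a contraction, and the
    square of |e_ij w| is <e_jj w, w>. *)
Lemma munit_contraction i j w : W w -> rnorm (Phi (munit R i j) w) <= rnorm w.
Proof.
move=> Ww; have fm := @finmat_munit R I.
have sq p q v : W v -> rnorm (Phi (munit R p q) v) ^+ 2 <= rnorm (Phi (munit R q q) v) * rnorm v.
  move=> Wv; rewrite rnorm_sqr.
  rewrite PhiS//; last exact: PhiW.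
  rewrite -PhiM//; last exact: finmat_matstar.
  rewrite matstar_munit matmul_munit eqxx scale1r mulrC.
  exact: Cauchy_Schwarz.
have proj v : W v -> rnorm (Phi (munit R j j) v) <= rnorm v.
  move=> Wv; have := rnorm_ge0 (Phi (munit R j j) v); rewrite le_eqVlt => /predU1P[<-|pv].
    exact: rnorm_ge0.
  by rewrite -(ler_pM2l pv) -expr2 sq.
rewrite -ler_sqr ?nnegrE ?rnorm_ge0//; apply: le_trans (sq _ _ _ Ww) _.
by rewrite expr2 ler_wpM2r ?rnorm_ge0// proj.
Qed.

(** Expand [k] in matrix units: there are |A|^2 of them, they act as contractions, and
    each entry is at most the norm of the operator. *)
Lemma crude_bound (A : {fset I}) k w : supp2 A k -> W w ->
  rnorm (Phi k w) <= (#|` A| * #|` A|)%:R * onorm (matop k) * rnorm w.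
Proof.
move=> kA Ww; have kf : finmat k by exists A.
have fm (c : C) (i j : I) : finmat (c *: munit R i j).
  rewrite -[_ *: _]addr0; apply: finmat_lin; [exact: finmat_munit|exact: finmat0].
have PZ c i j : Phi (c *: munit R i j) w = c *: Phi (munit R i j) w.
  by rewrite -[_ *: munit _ _ _]addr0 PhiL ?Phi0 ?addr0//; [exact: finmat_munit|exact: finmat0].
have f2 i : finmat (\sum_(j <- A) k i j *: munit R i j).
  by have [] := @Phi_sum A (fun j => k i j *: munit R i j) w (fun j => fm _ _ _) Ww.
rewrite [in Phi k w](supp2_sum kA).
have [_ ->] := Phi_sum A f2 Ww.
apply: le_trans (rnorm_sum _ _) _.
have sA (r : R) : \sum_(i <- A) r = #|` A|%:R * r.
  by rewrite big_const_seq count_predT iter_addr_0 mulr_natl.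
rewrite natrM -!mulrA -!sA; apply: ler_sum => i _.
have [_ ->] := Phi_sum A (fun j => fm (k i j) i j) Ww.
apply: le_trans (rnorm_sum _ _) _; apply: ler_sum => j _.
rewrite PZ rnormZ ler_pM ?rnorm_ge0//; first exact: entry_le.
exact: munit_contraction.
Qed.

(** Every *-representation of the finite matrices is contractive for the operator norm
    on l^2. The crude bound for k^* k costs its constant only once, whereas the
    C*-identity allows to square both sides as often as one likes; the support of [k],
    and with it the constant, stays the same along the way. *)
Theorem matrix_rep_bound k w : finmat k -> W w ->
  rnorm (Phi k w) <= onorm (matop k) * rnorm w.
Proof.
move=> [A kA] Ww; pose c : R := (#|` A| * #|` A|)%:R.
suff h m : forall k, supp2 A k ->
    rnorm (Phi k w) ^+ (2 ^ m) <= c * (onorm (matop k) * rnorm w) ^+ (2 ^ m).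
  apply: (@pow2_le _ _ _ c); rewrite ?rnorm_ge0 ?mulr_ge0 ?onorm_ge0 ?rnorm_ge0//.
  by move=> m; exact: h.
elim: m => [|m IHm] {kA}k kA; have kf : finmat k by exists A.
  by rewrite !expr1 mulrA; exact: crude_bound.
have sf := finmat_matstar kf.
rewrite expnS !exprM.
have sq : rnorm (Phi k w) ^+ 2 <= rnorm (Phi (matmul (matstar k) k) w) * rnorm w.
  rewrite rnorm_sqr.
  by rewrite PhiS//; [rewrite -PhiM// mulrC; exact: Cauchy_Schwarz|exact: PhiW].
apply: (@le_trans _ _ ((rnorm (Phi (matmul (matstar k) k) w) * rnorm w) ^+ (2 ^ m))).
  by rewrite lerXn2r ?nnegrE ?sqr_ge0 ?mulr_ge0 ?rnorm_ge0.
rewrite exprMn.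
have := IHm _ (supp2_matmul (supp2_matstar kA) kA).
move/(ler_wpM2r (exprn_ge0 (2 ^ m) (rnorm_ge0 w))) => /le_trans; apply.
rewrite -mulrA -exprMn -mulrA -expr2 ler_wpM2l ?ler0n// lerXn2r ?nnegrE//.
- by rewrite mulr_ge0 ?onorm_ge0 ?sqr_ge0.
- by rewrite sqr_ge0.
- by rewrite exprMn ler_wpM2r ?sqr_ge0// onorm_sqr.
Qed.

End matrix_representation.

(** * The C*-algebra of norm limits of finite matrices *)

Section adjoint.
Variables (R : realType) (I : choiceType).
Local Notation C := R[i].
Local Notation l2 := (ell2 I C).
Implicit Types (T : l2 -> l2) (x y : l2).

(** The adjoint of a bounded operator, read off from its matrix; this avoids the
    representation theorem for bounded functionals. *)
Definition adj T y : l2 := mkell2 (fun i => ip y (T (delta R i))).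

(** With u the part supported on [A] of the family (<y, T e_i>)_i, one has |u|^2 = <y, T
    u>, at most |y| |T| |u|. *)
Lemma adj_ell2 T y : bounded_op T ->
  (fun i => ip y (T (delta R i)) : C) \in @ell2_pred R I C.
Proof.
move=> /bounded_opP[Tl [M M0 TM]]; set c := fun i : I => _.
apply/ell2_boundP; exists ((M * rnorm y) ^+ 2) => A.
pose u : l2 := ftrunc A c.
have uA : supp_in A u by move=> i /negPf iA; rewrite ftruncE iA.
have uu : rnorm u ^+ 2 = \sum_(i <- A) rnorm (c i) ^+ 2.
  by rewrite (rnorm_supp uA); apply: eq_big_seq => i iA; rewrite ftruncE iA.
rewrite -uu ler_sqr ?nnegrE ?mulr_ge0 ?rnorm_ge0//.
have := rnorm_ge0 u; rewrite le_eqVlt => /predU1P[<-|u0].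
  by rewrite mulr_ge0 ?rnorm_ge0.
rewrite -(ler_pM2r u0) -expr2.
have -> : rnorm u ^+ 2 = rnorm (ip y (T u) : C).
  rewrite rnorm_sqr (ip_supp _ uA) /u /ftrunc.
  rewrite linop_sum// (ip_conj (\sum_(i <- A) _)) ip_suml rmorph_sum /=.
  congr rnorm; apply: eq_big_seq => i iA.
  by rewrite -/(ftrunc A c) ftruncE iA tens_delta linopZ// ipZl rmorphM /= -ip_conj /ip/= mulrC.
apply: le_trans (Cauchy_Schwarz _ _) _.
by rewrite [leRHS]mulrAC [leRHS]mulrC; apply: ler_wpM2l; [exact: rnorm_ge0|exact: TM].
Qed.

(** Both sides are continuous in [x], and they agree for finitely supported [x] by
    linearity. *)
Lemma ip_adj T x y : bounded_op T -> ip (T x) y = ip x (adj T y) :> C.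
Proof.
move=> Tb; have [Tl _] := Tb.
have fin A (z : l2) : supp_in A z -> ip (T z) y = ip z (adj T y) :> C.
  move=> zA; rewrite (ip_supp _ zA) -{1}(ftrunc_supp zA) /ftrunc linop_sum// ip_suml.
  apply: eq_bigr => i _; rewrite tens_delta linopZ// ipZl mkell2E; last exact: adj_ell2.
  by rewrite [in RHS]/ip/= -ip_conj.
apply: (@rnorm_le_eps _ _ _ _ (onorm T * rnorm y + rnorm (adj T y))) => e e0.
have [A xA] := ftrunc_approx x e0.
have fx := fin A (ftrunc A x) (fun i => ltac:(by move=> /negPf iA; rewrite ftruncE iA)).
rewrite (_ : _ - _ = ip (T (x - ftrunc A x)) y - ip (x - ftrunc A x) (adj T y)); last first.
  by rewrite linopB// !ipBl fx; ring.
apply: le_trans (rnormD _ _) _; rewrite rnormN mulrDr lerD//.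
  apply: le_trans (Cauchy_Schwarz _ _) _; rewrite mulrA ler_wpM2r ?rnorm_ge0//.
  by apply: le_trans (onormP _ Tb) _; rewrite mulrC ler_wpM2r ?onorm_ge0.
by apply: le_trans (Cauchy_Schwarz _ _) _; rewrite ler_wpM2r ?rnorm_ge0.
Qed.

Lemma adj_uniq T S : bounded_op T ->
  (forall x y, ip (T x) y = ip x (S y) :> C) -> S = adj T.
Proof.
by move=> Tb h; apply/funext => y; apply: ip_injr => z; rewrite -h ip_adj.
Qed.

Lemma adj_linear T : bounded_op T -> linear (adj T).
Proof.
move=> Tb k x y; apply: ip_injr => z.
by rewrite ipDr ipZr -!ip_adj// ipDr ipZr.
Qed.

Lemma adj_bound T y : bounded_op T -> rnorm (adj T y) <= onorm T * rnorm y.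
Proof.
move=> Tb; apply: (adjoint_bound (V := setT) (T := T)) => //; first exact: onorm_ge0.
  by move=> v w _ _; rewrite ip_conj -ip_adj// -ip_conj.
by move=> w _; exact: onormP.
Qed.

Lemma adj_bounded T : bounded_op T -> bounded_op (adj T).
Proof.
move=> Tb; apply/bounded_opP; split; first exact: adj_linear.
by exists (onorm T) => [|x]; [exact: onorm_ge0|exact: adj_bound].
Qed.

Lemma adjK T : bounded_op T -> adj (adj T) = T.
Proof.
move=> Tb; apply/esym/adj_uniq; first exact: adj_bounded.
by move=> x y; rewrite ip_conj -ip_adj// -ip_conj.
Qed.

Lemma adj_matop k : finmat k -> adj (matop k) = matop (matstar k).
Proof.
move=> kf; apply/esym/adj_uniq; first exact: matop_bounded.
by move=> x y; rewrite matop_adj.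
Qed.

End adjoint.

Section compact_algebra.
Variables (R : realType) (I : choiceType).
Local Notation C := R[i].
Local Notation l2 := (ell2 I C).
Implicit Types (T S : l2 -> l2) (x y v : l2).

Definition fin_approx T := forall e : R, 0 < e -> exists2 k, finmat k &
  forall v, rnorm (T v - matop k v) <= e * rnorm v.

Lemma fin_approx_bounded T : fin_approx T -> bounded_op T.
Proof.
move=> Ta; apply/bounded_opP; split.
  move=> c x y.
  apply: (@rnorm_le_eps _ _ _ _ (rnorm (c *: x + y) + rnorm (c *: x) + rnorm y)) => e e0.
  have [k kf kT] := Ta e e0.
  rewrite (_ : _ - _ = (T (c *: x + y) - matop k (c *: x + y))
      - (c *: (T x - matop k x) + (T y - matop k y))); last first.
    rewrite (matop_linear kf) scalerBr [X in _ = _ - X]addrACA -opprD.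
    by rewrite opprB addrC addrA subrK addrC.
  apply: le_trans (rnormD _ _) _; rewrite rnormN -addrA mulrDr; apply: lerD; first exact: kT.
  apply: le_trans (rnormD _ _) _; rewrite mulrDr; apply: lerD; last exact: kT.
  by rewrite !rnormZ mulrCA; apply: ler_wpM2l; [exact: rnorm_ge0|exact: kT].
have [k kf kT] := Ta 1 ltr01.
exists (1 + onorm (matop k)) => [|x]; first by rewrite addr_ge0 ?onorm_ge0.
rewrite -[T x](subrK (matop k x)) mulrDl; apply: le_trans (rnormD _ _) _.
by apply: lerD; [exact: kT|exact: onormP (matop_bounded kf)].
Qed.

Lemma fin_approx_matop k : finmat k -> fin_approx (matop k).
Proof.
by move=> kf e e0; exists k => // v; rewrite subrr rnorm0 mulr_ge0 ?rnorm_ge0// ltW.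
Qed.

Definition cpt_pred : {pred l2 -> l2} := mem [set T | fin_approx T].

Lemma cpt_predP T : T \in cpt_pred <-> fin_approx T.
Proof. by rewrite inE. Qed.

Fact cpt_submod_closed : submod_closed cpt_pred.
Proof.
split; first by apply/cpt_predP => e e0; exists 0; [exact: finmat0|] => v;
  rewrite (_ : matop 0 v = 0) ?subrr ?rnorm0 ?mulr_ge0 ?rnorm_ge0 ?ltW//;
  apply: ell2P => i; rewrite matopE ?(mappE (A := fset0)) ?big_seq_fset0//; exact: finmat0.
move=> c T S /cpt_predP Ta /cpt_predP Sa; apply/cpt_predP => e e0.
have c0 : 0 < rnorm (c : C) + 1 by rewrite ltr_wpDl ?rnorm_ge0.
have [k kf kT] := Ta (e / 2 / (rnorm (c : C) + 1)) (divr_gt0 (divr_gt0 e0 (ltr0Sn _ 1)) c0).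
have [l lf lS] := Sa (e / 2) (divr_gt0 e0 (ltr0Sn _ 1)).
exists (c *: k + l) => [|v]; first exact: finmat_lin.
rewrite matop_lin// !fctE opprD addrACA -scalerBr [X in X * _]splitr mulrDl.
apply: le_trans (rnormD _ _) _; rewrite lerD// rnormZ.
apply: le_trans (ler_wpM2l (rnorm_ge0 _) (kT v)) _.
rewrite mulrA ler_wpM2r ?rnorm_ge0// mulrCA -[leRHS]mulr1 ler_wpM2l//.
  by rewrite divr_ge0// ltW.
by rewrite ler_pdivrMr// mul1r lerDl.
Qed.

HB.instance Definition _ :=
  GRing.isSubmodClosed.Build _ _ cpt_pred cpt_submod_closed.

(** The norm closure of the finite matrices. It is the natural carrier for the
    completions, and only later turns out to consist of the compact operators
    ([range_cpt]). *)
Record cpt := Cpt { cpt_val :> l2 -> l2; cpt_valP : cpt_val \in cpt_pred }.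
HB.instance Definition _ := [isSub of cpt for cpt_val].
HB.instance Definition _ := [Choice of cpt by <:].
HB.instance Definition _ := [SubChoice_isSubLmodule of cpt by <:].

Implicit Types (s t : cpt).

Lemma cptP t s : (forall x, t x = s x) -> t = s.
Proof. by move=> ts; apply: val_inj; exact/funext. Qed.

Lemma cpt_approx t : fin_approx t.
Proof. by have := cpt_valP t; rewrite inE. Qed.

Lemma cpt_bounded t : bounded_op t.
Proof. exact: fin_approx_bounded (cpt_approx t). Qed.

Lemma cpt_linear t : linear t.
Proof. by have [] := cpt_bounded t. Qed.

Lemma cpt_addE t s x : (t + s) x = t x + s x. Proof. by []. Qed.
Lemma cpt_oppE t x : (- t) x = - t x. Proof. by []. Qed.
Lemma cpt_scaleE (c : C) t x : (c *: t) x = c *: t x. Proof. by []. Qed.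

Let nrm t : C := (onorm t)%:C%C.

Let nrmD t s : nrm (t + s) <= nrm t + nrm s.
Proof.
rewrite /nrm -rmorphD lecR; apply: onorm_le => [||x]; first by rewrite addr_ge0 ?onorm_ge0.
  exact: cpt_linear.
by rewrite cpt_addE mulrDl; apply: le_trans (rnormD _ _) _; rewrite lerD ?onormP//;
  exact: cpt_bounded.
Qed.

Let onormZle (c : C) t : onorm (c *: t) <= rnorm c * onorm t.
Proof.
apply: onorm_le => [||x]; first by rewrite mulr_ge0 ?rnorm_ge0 ?onorm_ge0.
  exact: cpt_linear.
by rewrite cpt_scaleE rnormZ -mulrA ler_wpM2l ?rnorm_ge0// onormP//; exact: cpt_bounded.
Qed.

Let nrm0 t : nrm t = 0 -> t = 0.
Proof.
move=> /complexI t0; apply: cptP => x; apply: rnorm_eq0; apply/eqP.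
rewrite eq_le rnorm_ge0 andbT; apply: le_trans (onormP _ (cpt_bounded t)) _.
by rewrite t0 mul0r.
Qed.

Let nrmZ (c : C) t : nrm (c *: t) = `|c| * nrm t.
Proof.
rewrite /nrm rnormE -rmorphM /=; congr (_%:C%C).
apply/eqP; rewrite eq_le onormZle/=.
have [->|c0] := eqVneq c 0; first by rewrite rnorm0 mul0r onorm_ge0.
have nc : 0 < rnorm c.
  by rewrite lt_neqAle rnorm_ge0 andbT eq_sym; apply: contra_neq c0; exact: rnorm_eq0.
have := onormZle c^-1 (c *: t); rewrite scalerA mulVf// scale1r.
have -> : rnorm (c^-1 : C) = (rnorm c)^-1.
  by apply: complexI; rewrite -rnormE normfV rnormE fmorphV.
by rewrite ler_pdivlMl.
Qed.

HB.instance Definition _ := Lmodule_isNormed.Build C cpt nrmD nrmZ nrm0.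

Lemma rnorm_cpt t : rnorm t = onorm t. Proof. by []. Qed.

(** A Cauchy filter of operators converges pointwise, uniformly on the unit ball, so the
    limit is again approximated by finite matrices. *)
Lemma cpt_complete (F : set_system cpt) : ProperFilter F -> cauchy F -> cvg F.
Proof.
move=> FF /cauchy_ballP Fc.
have Fi v : cvg ((fun t : cpt => t v) @ F).
  apply: cauchy_cvg; apply/cauchy_ballP => e e0.
  have eE : e = (rnorm e)%:C%C by rewrite -rnormE gtr0_norm.
  move: e0; rewrite eE ltcR => e0.
  have d0 : 0 < rnorm e / (1 + rnorm v) by rewrite divr_gt0// ltr_pwDl ?rnorm_ge0.
  have [|[A B] /= [FA FB] AB] := Fc (rnorm e / (1 + rnorm v))%:C%C; first by rewrite ltcR.
  exists ((fun t : cpt => t v) @` A, (fun t : cpt => t v) @` B) => /=.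
    split; first by apply: filterS FA => x Ax; exists x.
    by apply: filterS FB => x Ax; exists x.
  move=> [_ _] [[x Ax <-] [y By <-]] /=.
  have := AB (x, y) (conj Ax By); rewrite -!ball_normE /= !rnormE !ltcR => xy.
  apply: le_lt_trans (onormP v (cpt_bounded (x - y))) _.
  rewrite -rnorm_cpt; move: xy; rewrite ltr_pdivlMr; last by rewrite ltr_pwDl ?rnorm_ge0.
  by apply: le_lt_trans; rewrite ler_wpM2l ?rnorm_ge0// lerDr.
pose g v := lim ((fun t : cpt => t v) @ F).
have close (e : R) : 0 < e -> \forall t \near F, forall v, rnorm ((t : cpt) v - g v) <= e * rnorm v.
  move=> e0; have [|[A B] /= [FA FB] AB] := Fc e%:C%C; first by rewrite ltcR.
  near=> t => v; apply/ler_addgt0Pr => d d0.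
  have : (\forall s \near F, B s /\ rnorm (g v - (s : cpt) v) < d).
    near=> s; split; first by near: s.
    near: s; have /cvgrPdist_lt/(_ d%:C%C) := Fi v; rewrite ltcR => /(_ d0).
    by apply: filterS => s; rewrite rnormE ltcR.
  move=> /filter_ex[s [Bs sv]].
  apply: le_trans (rnorm_triangle (s v) _ _) _.
  rewrite lerD//; last by rewrite rnorm_distC ltW.
  apply: le_trans (onormP v (cpt_bounded (t - s))) _.
  rewrite ler_wpM2r ?rnorm_ge0// -rnorm_cpt; apply/ltW.
  have := AB (t, s); rewrite -ball_normE /= rnormE ltcR; apply; split=> //=.
  by near: t.
have gP : g \in cpt_pred.
  apply/cpt_predP => e e0; have e2 : 0 < e / 2 by rewrite divr_gt0.
  have /filter_ex[t ht] := close _ e2.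
  have [k kf kt] := cpt_approx t e2.
  exists k => // v; apply: le_trans (rnorm_triangle (t v) _ _) _.
  by rewrite [X in X * _]splitr mulrDl lerD// rnorm_distC.
apply/cvg_ex; exists (Cpt gP); apply/cvgrPdist_le => /= e e0.
have eE : e = (rnorm e)%:C%C by rewrite -rnormE gtr0_norm.
move: e0; rewrite eE ltcR => e0; near=> t.
rewrite distrC rnormE lecR rnorm_cpt; apply: onorm_le; first exact: ltW.
  exact: cpt_linear.
by near: t; exact: close.
Unshelve. all: by end_near. Qed.
HB.instance Definition _ := Uniform_isComplete.Build cpt cpt_complete.

Lemma comp_approx t s : (t \o s) \in cpt_pred.
Proof.
apply/cpt_predP => e e0; have e2 : 0 < e / 2 by rewrite divr_gt0.
have s1 : 0 < onorm s + 1 by rewrite ltr_wpDl ?onorm_ge0.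
have [k kf kt] := cpt_approx t (divr_gt0 e2 s1).
have k1 : 0 < onorm (matop k) + 1 by rewrite ltr_wpDl ?onorm_ge0.
have [l lf ls] := cpt_approx s (divr_gt0 e2 k1).
exists (matmul k l) => [|v]; first exact: finmat_matmul.
rewrite matop_matmul//=; apply: le_trans (rnorm_triangle (matop k (s v)) _ _) _.
rewrite [X in X * _]splitr mulrDl lerD//.
  apply: le_trans (kt _) _; rewrite -mulrA ler_wpM2l ?(ltW e2)// ler_pdivrMl//.
  apply: le_trans (onormP _ (cpt_bounded s)) _; rewrite ler_wpM2r ?rnorm_ge0//.
  by rewrite lerDl.
rewrite -linopB; last exact: matop_linear.
apply: le_trans (onormP _ (matop_bounded kf)) _.
apply: le_trans (ler_wpM2l (onorm_ge0 _) (ls v)) _.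
rewrite mulrA ler_wpM2r ?rnorm_ge0// mulrCA -[leRHS]mulr1 ler_wpM2l ?(ltW e2)//.
by rewrite ler_pdivrMr// mul1r lerDl.
Qed.

Lemma adj_approx t : adj t \in cpt_pred.
Proof.
have tb := cpt_bounded t.
apply/cpt_predP => e e0; have [k kf kt] := cpt_approx t e0.
exists (matstar k) => [|v]; first exact: finmat_matstar.
apply: (adjoint_bound (V := setT) (S := fun v => adj t v - matop (matstar k) v)
  (T := fun v => t v - matop k v)) => //; first exact: ltW.
  move=> x y _ _; rewrite ipBl ipBr (ip_conj y) -ip_adj// -ip_conj.
  by rewrite matop_adj ?matstarK//; exact: finmat_matstar.
by move=> w _; exact: kt.
Qed.

Definition cpt_mul t s : cpt := Cpt (comp_approx t s).
Definition cpt_star t : cpt := Cpt (adj_approx t).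

Let mulA : associative cpt_mul. Proof. by move=> a b c; exact: cptP. Qed.
Let mull (y : cpt) : linear (cpt_mul^~ y). Proof. by move=> c a b; exact: cptP. Qed.
Let mulr (x : cpt) : linear (cpt_mul x).
Proof. by move=> c a b; apply: cptP => v; exact: cpt_linear. Qed.
Let star_antilinear (c : C) t s :
  cpt_star (c *: t + s) = c^* *: cpt_star t + cpt_star s.
Proof.
apply: cptP => v; apply: ip_injr => z; have tb := cpt_bounded.
rewrite -[cpt_val (cpt_star _) v]/(adj _ v) -ip_adj//.
rewrite cpt_addE cpt_scaleE [in RHS]ipDr [in RHS]ipZr conjCK ipDl ipZl.
by rewrite -[RHS]/(c * ip z (adj t v) + ip z (adj s v)) -!ip_adj.
Qed.
Let starK : involutive cpt_star.
Proof. by move=> t; apply: cptP => v /=; rewrite adjK//; exact: cpt_bounded. Qed.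
Let starM t s : cpt_star (cpt_mul t s) = cpt_mul (cpt_star s) (cpt_star t).
Proof.
apply: cptP => v; apply: ip_injr => z /=.
by rewrite -(ip_adj _ _ (cpt_bounded (cpt_mul t s))) -!ip_adj//; exact: cpt_bounded.
Qed.
Let normM t s : `|cpt_mul t s| <= `|t| * `|s|.
Proof.
rewrite !rnormE -rmorphM lecR; apply: onorm_le; first by rewrite mulr_ge0 ?rnorm_ge0.
  exact: cpt_linear.
move=> x /=; apply: le_trans (onormP _ (cpt_bounded t)) _.
by rewrite -mulrA -[onorm t]/(rnorm t) ler_wpM2l ?rnorm_ge0//; exact: (onormP x (cpt_bounded s)).
Qed.
Let norm_star t : `|cpt_mul (cpt_star t) t| = `|t| ^+ 2.
Proof.
have tb := cpt_bounded t.
apply/eqP; rewrite eq_le; apply/andP; split.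
  apply: le_trans (normM _ _) _; rewrite expr2 !rnormE -!rmorphM lecR.
  rewrite ler_wpM2r ?rnorm_ge0//; apply: onorm_le; first exact: rnorm_ge0.
    exact: cpt_linear.
  by move=> x; exact: adj_bound.
rewrite !rnormE -rmorphXn lecR /=.
set N := rnorm (cpt_mul _ _).
have N0 : 0 <= N by exact: rnorm_ge0.
rewrite -(sqr_sqrtr N0) ler_sqr ?nnegrE ?rnorm_ge0 ?sqrtr_ge0//.
apply: onorm_le; rewrite ?sqrtr_ge0//; first exact: cpt_linear.
move=> x; rewrite -ler_sqr ?nnegrE ?mulr_ge0 ?sqrtr_ge0 ?rnorm_ge0//.
rewrite exprMn (sqr_sqrtr N0) rnorm_sqr ip_adj//.
apply: le_trans (Cauchy_Schwarz _ _) _.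
rewrite expr2 mulrCA ler_wpM2l ?rnorm_ge0//.
exact: (onormP x (cpt_bounded (cpt_mul (cpt_star t) t))).
Qed.

HB.instance Definition _ := isCStarAlgebra.Build R cpt
  mulA mull mulr star_antilinear starK starM normM norm_star.

End compact_algebra.

(** * Compact operators *)

Section nets.
Variables (R : realType) (V : completeNormedModType R[i]).
Implicit Types (S : set V) (x y z : V).

(** Total boundedness. *)
Definition has_net S := forall e : R, 0 < e ->
  exists s : seq V, forall z, S z -> exists2 y, y \in s & rnorm (z - y) <= e.

(** An ultrafilter on a totally bounded set contains a ball of every radius, so it is
    Cauchy and converges. *)
Lemma closed_net_compact S : closed S -> has_net S -> compact S.
Proof.
move=> Sc Sn; rewrite compact_ultra => F FU FS.
have pick (s : seq V) (P : V -> set V) :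
    F [set z | exists2 y, y \in s & P y z] -> exists y, F (P y).
  elim: s => [|y s IHs] h.
    have /filter_ex[z [y]] := h; by rewrite in_nil.
  have [Fy|Fy] := in_ultra_setVsetC (P y) FU; first by exists y.
  apply: IHs; apply: filterS (filterI h Fy) => z [[w]].
  by rewrite inE => /predU1P[->//|ws Pw] _; exists w.
have FF : ProperFilter F by exact: ultra_proper.
have /cauchy_cvgP/cvg_ex[p Fp] : cauchy F.
  apply/cauchy_ballP => e e0.
  have eE : e = (rnorm e)%:C%C by rewrite -rnormE gtr0_norm.
  move: e0; rewrite eE ltcR => e0.
  have [|s hs] := Sn (rnorm e / 3); first by rewrite divr_gt0.
  have [|y Fy] := pick s (fun y => [set z | rnorm (z - y) <= rnorm e / 3]).
    by apply: filterS FS => z /hs.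
  exists ([set z | rnorm (z - y) <= rnorm e / 3], [set z | rnorm (z - y) <= rnorm e / 3]) => //=.
  move=> [z w] /= [zy wy]; rewrite -ball_normE /= rnormE ltcR.
  apply: le_lt_trans (rnorm_triangle y _ _) _.
  by rewrite [rnorm (y - w)]rnorm_distC; lra.
exists p; split=> //; apply: Sc => B pB.
have SB : F (S `&` B) by exact: filterI FS (Fp _ pB).
by have [z Sz] := filter_ex SB; exists z.
Qed.

Lemma compact_net S : compact S -> has_net S.
Proof.
rewrite compact_cover => Sc e e0.
have [||D _ SD] := Sc V setT (fun y => ball y e%:C%C).
- by move=> y _; apply: ball_open; rewrite ltcR.
- by move=> z Sz; exists z => //; apply: ballxx; rewrite ltcR.
exists D => z /SD[y yD]; rewrite -ball_normE /= rnormE ltcR => zy.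
by exists y => //; rewrite rnorm_distC ltW.
Qed.

Lemma net_approx S : (forall e : R, 0 < e -> exists2 S', has_net S' &
    forall z, S z -> exists2 z', S' z' & rnorm (z - z') <= e) -> has_net S.
Proof.
move=> h e e0; have e2 : 0 < e / 2 by rewrite divr_gt0.
have [S' S'n SS'] := h _ e2; have [s hs] := S'n _ e2.
exists s => z /SS'[z' /hs[y ys yz'] zz']; exists y => //.
by apply: le_trans (rnorm_triangle z' _ _) _; rewrite [leRHS]splitr lerD.
Qed.

Lemma net_sub S S' : S `<=` S' -> has_net S' -> has_net S.
Proof. by move=> SS' n e e0; have [s hs] := n e e0; exists s => z /SS'/hs. Qed.

Lemma net_closure S : has_net S -> has_net (closure S).
Proof.
move=> Sn; apply: net_approx => e e0; exists S => // z /closure_rnormP/(_ e e0).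
by move=> [y]; exists y.
Qed.

Lemma net_add S S' : has_net S -> has_net S' ->
  has_net [set x + y | x in S & y in S'].
Proof.
move=> n n' e e0; have e2 : 0 < e / 2 by rewrite divr_gt0.
have [s hs] := n _ e2; have [s' hs'] := n' _ e2.
exists [seq x + y | x <- s, y <- s'] => _ [x /hs[x' xs xx'] [y /hs'[y' ys yy'] <-]].
exists (x' + y'); first exact: allpairs_f.
rewrite opprD addrACA; apply: le_trans (rnormD _ _) _.
by rewrite [leRHS]splitr lerD.
Qed.

(** The grid of step [e] starting at -M; x lies just above the point whose index is the
    integral part of (x + M) / e. *)
Lemma real_net (M e : R) : 0 < e -> exists s : seq R, forall x : R, `|x| <= M ->
  exists2 y, y \in s & `|x - y| <= e.
Proof.
move=> e0; exists [seq - M + j%:R * e | j <- iota 0 (Num.truncn ((M + M) / e)).+1] => x.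
rewrite ler_norml => /andP[xM Mx].
have p0 : 0 <= (x + M) / e by rewrite divr_ge0 ?(ltW e0)//; lra.
set j := Num.truncn ((x + M) / e); have /andP[j1 j2] := truncn_itv p0.
exists (- M + j%:R * e).
  apply/mapP; exists j => //; rewrite mem_iota add0n leq0n /= ltnS.
  by apply: le_truncn; rewrite ler_pM2r ?invr_gt0//; lra.
move: j1 j2; rewrite -/j ler_pdivlMr// ltr_pdivrMr// -natr1 mulrDl mul1r => j1 j2.
by rewrite ler_norml; apply/andP; split; lra.
Qed.

Lemma net_line (u : V) (M : R) : has_net [set c *: u | c in [set c : R[i] | rnorm c <= M]].
Proof.
move=> e e0; have u1 : 0 < rnorm u + 1 by rewrite ltr_wpDl ?rnorm_ge0.
have d0 : 0 < e / 2 / (rnorm u + 1) by rewrite !divr_gt0.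
have [s hs] := real_net M d0.
exists [seq (a +i* b)%C *: u | a <- s, b <- s] => _ [c /= cM <-].
have [a aS ac] := hs _ (le_trans (normr_Re c) cM).
have [b bS bc] := hs _ (le_trans (normr_Im c) cM).
exists ((a +i* b)%C *: u); first exact: (allpairs_f (fun a b => (a +i* b)%C *: u)).
rewrite -scalerBl rnormZ.
have h : rnorm (c - (a +i* b)%C : R[i]) <= e / (rnorm u + 1).
  apply: le_trans (rnorm_ReIm _) _.
  rewrite (_ : e / _ = e / 2 / (rnorm u + 1) + e / 2 / (rnorm u + 1)); last first.
    by field; rewrite gt_eqF.
  by case: c {cM} ac bc => c1 c2 /= ac bc; rewrite lerD.
apply: le_trans (ler_wpM2r (rnorm_ge0 _) h) _.
by rewrite mulrAC ler_pdivrMr// ler_pM2l// lerDl.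
Qed.

End nets.

Section compact_operators.
Variables (R : realType) (I : choiceType).
Local Notation C := R[i].
Local Notation l2 := (ell2 I C).
Implicit Types (T : l2 -> l2) (x y v : l2) (A : {fset I}).

(** A box in a finite-dimensional coordinate subspace is a sum of segments. *)
Lemma net_box (s : seq I) (M : R) : has_net
  [set x : l2 | exists2 c : I -> C, forall i, rnorm (c i) <= M &
                x = \sum_(i <- s) c i *: delta R i].
Proof.
elim: s => [|i s IHs].
  move=> e e0; exists [:: 0] => _ [c _ ->]; exists 0; first by rewrite inE.
  by rewrite big_nil subrr rnorm0 ltW.
apply: net_sub (net_add (@net_line R l2 (delta R i) M) IHs) => _ [c cM ->].
rewrite big_cons; exists (c i *: delta R i); first by exists (c i) => //=.
by exists (\sum_(i <- s) c i *: delta R i) => //; exists c.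
Qed.

(** The image of the unit ball under a finite matrix lies in a box of a coordinate
    subspace, which is totally bounded; this passes to norm limits. *)
Lemma fin_approx_compact T : fin_approx T -> compact_op T.
Proof.
move=> Ta; have [Tl _] := fin_approx_bounded Ta; split=> //.
apply: closed_net_compact; first exact: closed_closure.
apply/net_closure/net_approx => e e0.
have [k kf kT] := Ta e e0; have [A kA] := kf.
pose M := onorm (matop k).
exists [set x : l2 | exists2 c : I -> C, forall i, rnorm (c i) <= M &
                x = \sum_(i <- A) c i *: delta R i]; first exact: net_box.
move=> _ [v /= v1 <-]; exists (matop k v).
  exists (matop k v) => [i|].
    apply: le_trans (rnorm_coord _ _) _; apply: le_trans (onormP _ (matop_bounded kf)) _.
    by rewrite ler_piMr ?onorm_ge0//; move: v1; rewrite rnormE -[1]/(1%:C)%C lecR.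
  rewrite -{1}(ftrunc_supp (matop_supp v kA)) /ftrunc.
  by apply: eq_bigr => i _; rewrite tens_delta.
apply: le_trans (kT v) _; rewrite ler_piMr ?(ltW e0)//.
by move: v1; rewrite rnormE -[1]/(1%:C)%C lecR.
Qed.

Lemma ftrunc_mono A B x : (A `<=` B)%fset ->
  rnorm (x - ftrunc B x) <= rnorm (x - ftrunc A x).
Proof.
move=> /fsubsetP AB; apply/rnorm_leP; first exact: rnorm_ge0.
move=> D; apply: le_trans (rnorm_part _ D); apply: ler_sum => i _.
rewrite !ell2_add !ell2_opp !ftruncE; case: ifPn => [_|iB].
  by rewrite subrr rnorm0 expr0n sqr_ge0.
by rewrite (contraNF (AB i) iB).
Qed.

Lemma ftrunc_approx_seq (s : seq l2) (e : R) : 0 < e ->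
  exists A, forall x, x \in s -> rnorm (x - ftrunc A x) <= e.
Proof.
move=> e0; elim: s => [|y s [A hA]]; first by exists fset0.
have [B yB] := ftrunc_approx y e0; exists (A `|` B)%fset => x.
rewrite inE => /predU1P[->|/hA xA].
  by apply: le_trans yB; apply: ftrunc_mono; exact: fsubsetUr.
by apply: le_trans xA; apply: ftrunc_mono; exact: fsubsetUl.
Qed.

Lemma ftrunc_linear A : linear (ftrunc A : l2 -> l2).
Proof.
move=> c x y; apply: ell2P => i; rewrite ell2_add ell2_scale !ftruncE ell2_add ell2_scale.
by case: ifP => //; rewrite scaler0 addr0.
Qed.

Lemma compact_op_bounded T : compact_op T -> bounded_op T.
Proof.
move=> [Tl /compact_net Tn]; have [s hs] := Tn 1 ltr01.
pose M := 1 + \sum_(y <- s) rnorm y.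
have M0 : 0 <= M by rewrite addr_ge0// sumr_ge0// => y _; exact: rnorm_ge0.
apply/bounded_opP; split=> //; exists M => //; apply/opnorm_leP => //.
apply: ge_ereal_sup => _ [x /= x1 <-]; rewrite lee_fin.
have [|y ys yT] := hs (T x); first by apply: subset_closure; exists x.
rewrite -(subrK y (T x)); apply: le_trans (rnormD _ _) _; rewrite lerD//.
rewrite (big_rem y)//= lerDl sumr_ge0// => z _; exact: rnorm_ge0.
Qed.

(** By compactness one coordinate projection P moves the image of the unit ball only
    little, so P T is close to T in norm. The finitely many rows of P T are
    square-summable, being values of the adjoint, and can be truncated as well. *)
Lemma compact_fin_approx T : compact_op T -> fin_approx T.
Proof.
move=> Tc; have Tb := compact_op_bounded Tc; have [Tl /compact_net Tn] := Tc.
move=> e e0; have e6 : 0 < e / 6 by rewrite divr_gt0.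
(* e / 6 three times: to a point of the net, to its truncation, and back *)
have [A hA] : exists A, forall v, rnorm (T v - ftrunc A (T v)) <= e / 2 * rnorm v.
  have [s hs] := Tn _ e6; have [A hA] := ftrunc_approx_seq s e6.
  exists A; pose D v := T v - ftrunc A (T v).
  have Dl : linear D.
    move=> c x y; rewrite /D Tl (ftrunc_linear A).
    by rewrite scalerBr addrACA opprD.
  have e20 : 0 <= e / 2 by rewrite divr_ge0// ltW.
  apply/(opnorm_leP (T := D)) => //; apply: ge_ereal_sup => _ [x /= x1 <-].
  have [|y ys yT] := hs (T x); first by apply: subset_closure; exists x.
  rewrite lee_fin /D (_ : e / 2 = e / 6 + (e / 6 + e / 6)); last by field.
  apply: le_trans (rnorm_triangle y _ _) _; apply: lerD; first exact: yT.
  apply: le_trans (rnorm_triangle (ftrunc A y) _ _) _; apply: lerD; first exact: hA.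
  rewrite -(linopB _ _ (ftrunc_linear A)).
  by apply: le_trans (rnorm_ftrunc _ _) _; rewrite rnorm_distC.
(* each of the |A| rows may be off by e / 2 / n *)
pose n : R := (#|` A|)%:R + 1; have n0 : 0 < n by rewrite ltr_wpDl.
have d0 : 0 < e / 2 / n by rewrite !divr_gt0.
pose t i := adj T (delta R i).
have [B hB] := ftrunc_approx_seq [seq t i | i <- A] d0.
pose k : I -> I -> C := fun i j => if (i \in A) && (j \in B) then T (delta R j) i else 0.
have kf : finmat k.
  exists (A `|` B)%fset => i j; apply: contraFeq; rewrite /k; case: ifP => [/andP[iA jB] _|].
    by rewrite !inE iA jB orbT.
  by rewrite eqxx.
exists k => // v; rewrite [X in X * _]splitr mulrDl.
apply: le_trans (rnorm_triangle (ftrunc A (T v)) _ _) _; apply: lerD; first exact: hA.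
have -> : matop k v = ftrunc A (fun i => ip v (ftrunc B (t i)) : C).
  apply: ell2P => i; rewrite ftruncE matopE// (mappE (A := B)) => [|j /negPf jB]; last first.
    by rewrite /k jB andbF.
  case: ifPn => iA; last by rewrite big1// => j _; rewrite /k (negPf iA) mul0r.
  rewrite (ip_conj (ftrunc B _)) (@ip_supp _ _ _ B) => [|j /negPf jB]; last by rewrite ftruncE jB.
  rewrite rmorph_sum /=; apply: eq_big_seq => j jB; rewrite ftruncE jB /k iA jB /=.
  rewrite /t /adj mkell2E; last exact: adj_ell2.
  by rewrite [in RHS]/ip/= rmorphM /= conjCK -ip_conj ip_delta.
rewrite (_ : _ - _ = \sum_(i <- A) tens (ip v (t i - ftrunc B (t i)) : C) (delta R i)); last first.
  apply: ell2P => i; rewrite -[RHS]/(ftrunc A (fun i => ip v (t i - ftrunc B (t i)) : C) i).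
  rewrite ell2_add ell2_opp !ftruncE; case: ifP => _; last by rewrite subrr.
  by rewrite ipBr /t -ip_adj// ip_delta.
apply: le_trans (rnorm_sum _ _) _.
apply: (@le_trans _ _ (\sum_(i <- A) e / 2 / n * rnorm v)).
  rewrite big_seq [leRHS]big_seq; apply: ler_sum => i iA; rewrite rnorm_tens.
  apply: le_trans (Cauchy_Schwarz _ _) _; rewrite mulrC ler_wpM2r ?rnorm_ge0//.
  by apply: hB; exact: map_f.
rewrite big_const_seq count_predT iter_addr_0 -mulrnAl ler_wpM2r ?rnorm_ge0//.
rewrite -mulr_natr mulrAC -[leRHS]mulr1 -mulrA ler_wpM2l ?divr_ge0 ?(ltW e0)//.
by rewrite ler_pdivrMr// mul1r lerDl.
Qed.

Lemma range_cpt : range (@cpt_val R I) = @compact_op R l2.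
Proof.
apply/seteqP; split=> [_ [t _ <-]|T /compact_fin_approx Ta].
  exact/fin_approx_compact/cpt_approx.
by exists (Cpt (proj2 (cpt_predP T) Ta)).
Qed.

Lemma cpt_val_rep : cstar_rep (@cpt_val R I).
Proof.
split=> //; first by move=> t _; exact: cpt_bounded.
by move=> t x y _; rewrite ip_adj//; exact: cpt_bounded.
Qed.

End compact_operators.

(** * Uniqueness of completions *)

Section cstar_basics.
Variables (R : realType) (A : cstarAlgType R).
Implicit Types x y : A.

Lemma rnorm_cmul x y : rnorm (cmul x y) <= rnorm x * rnorm y.
Proof. by rewrite -lecR rmorphM /= -!rnormE cnormM. Qed.

(** From |x|^2 = |x^* x| <= |x^*| |x|. *)
Lemma rnorm_cstar x : rnorm (cstar x) = rnorm x.
Proof.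
have le y : rnorm y <= rnorm (cstar y).
  have := rnorm_ge0 y; rewrite le_eqVlt => /predU1P[<-|y0]; first exact: rnorm_ge0.
  rewrite -(ler_pM2r y0) -expr2; apply: le_trans (rnorm_cmul _ _).
  by rewrite -lecR rmorphXn /= -!rnormE cnorm_cstar.
by apply/eqP; rewrite eq_le le andbT; have := le (cstar x); rewrite cstarK.
Qed.

Lemma cmulBl x y z : cmul (x - y) z = cmul x z - cmul y z :> A.
Proof. by have := cmul_linearl z (-1) y x; rewrite !scaleN1r ![- _ + _]addrC. Qed.

Lemma cmulBr x y z : cmul z (x - y) = cmul z x - cmul z y :> A.
Proof. by have := cmul_linearr z (-1) y x; rewrite !scaleN1r ![- _ + _]addrC. Qed.

Lemma cstarB x y : cstar (x - y) = cstar x - cstar y :> A.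
Proof.
by have := cstar_antilinear (-1) y x; rewrite rmorphN rmorph1 !scaleN1r ![- _ + _]addrC.
Qed.
End cstar_basics.

Section completions.
Variables (R : realType) (V : lmodType R[i]) (S : set V).
Variables (mul : V -> V -> V) (star : V -> V) (N : V -> \bar R).
Hypothesis Slin : forall (k : R[i]) a b, S a -> S b -> S (k *: a + b).
Hypothesis Smul : forall a b, S a -> S b -> S (mul a b).
Hypothesis Sstar : forall a, S a -> S (star a).
Local Notation is_compl := (is_completion S mul star N).

(** The graph of the isomorphism between two completions. *)
Definition same_limit (A B : cstarAlgType R) (jA : V -> A) (jB : V -> B) x y :=
  forall e : R, 0 < e ->
    exists2 a, S a & rnorm (x - jA a) <= e /\ rnorm (y - jB a) <= e.

Section two_completions.
Variables (A B : cstarAlgType R) (jA : V -> A) (jB : V -> B).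
Hypothesis cA : is_compl jA.
Hypothesis cB : is_compl jB.
Local Notation sl := (same_limit jA jB).

Lemma same_limit_sym x y : sl x y -> same_limit jB jA y x.
Proof. by move=> h e /h[a Sa [? ?]]; exists a. Qed.

Lemma completion_isometry a b : S a -> S b ->
  rnorm (jA a - jA b) = rnorm (jB a - jB b).
Proof.
move=> Sa Sb; have [lA _ _ nA _] := cA; have [lB _ _ nB _] := cB.
apply: EFin_inj; have := lA (-1) b a Sb Sa; have := lB (-1) b a Sb Sa.
rewrite !scaleN1r ![- _ + jA _]addrC ![- _ + jB _]addrC => <- <-.
by rewrite nA ?nB//; rewrite -scaleN1r; exact: Slin.
Qed.

Lemma same_limit_j a : S a -> sl (jA a) (jB a).
Proof. by move=> Sa e e0; exists a; rewrite // !subrr !rnorm0 ltW. Qed.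

Lemma same_limit_lin (k : R[i]) x y x' y' : sl x y -> sl x' y' ->
  sl (k *: x + x') (k *: y + y').
Proof.
have [lA _ _ _ _] := cA; have [lB _ _ _ _] := cB.
move=> h h' e e0; have k1 : 0 < rnorm (k : R[i]) + 1 by rewrite ltr_wpDl ?rnorm_ge0.
have [|a Sa [xa ya]] := h (e / 2 / (rnorm (k : R[i]) + 1)); first by rewrite !divr_gt0.
have [|b Sb [xb yb]] := h' (e / 2); first by rewrite divr_gt0.
have K (W : normedModType R[i]) (u v p q : W) :
    rnorm (u - p) <= e / 2 / (rnorm (k : R[i]) + 1) -> rnorm (v - q) <= e / 2 ->
    rnorm (k *: u + v - (k *: p + q)) <= e.
  move=> up vq; rewrite opprD addrACA -scalerBr; apply: le_trans (rnormD _ _) _.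
  rewrite [leRHS]splitr; apply: lerD => //; rewrite rnormZ.
  apply: le_trans (ler_wpM2l (rnorm_ge0 _) up) _.
  rewrite mulrCA -[leRHS]mulr1 ler_wpM2l ?divr_ge0 ?(ltW e0)//.
  by rewrite ler_pdivrMr// mul1r lerDl.
exists (k *: a + b); first exact: Slin.
by rewrite lA// lB//; split; exact: K.
Qed.

Lemma same_limit_mul x y x' y' : sl x y -> sl x' y' -> sl (cmul x x') (cmul y y').
Proof.
have [_ mA _ _ _] := cA; have [_ mB _ _ _] := cB.
move=> h h' e e0.
pose M := rnorm x' + rnorm y' + 1.
have M0 : 0 < M by rewrite ltr_wpDl ?addr_ge0 ?rnorm_ge0.
have [|a Sa [xa ya]] := h (e / 2 / M); first by rewrite !divr_gt0.
pose M' := rnorm (jA a) + rnorm (jB a) + 1.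
have M'0 : 0 < M' by rewrite ltr_wpDl ?addr_ge0 ?rnorm_ge0.
have [|b Sb [xb yb]] := h' (e / 2 / M'); first by rewrite !divr_gt0.
have K (W : cstarAlgType R) (u v p q : W) :
    rnorm (u - p) <= e / 2 / M -> rnorm (v - q) <= e / 2 / M' ->
    rnorm v <= M -> rnorm p <= M' -> rnorm (cmul u v - cmul p q) <= e.
  move=> up vq vM pM; apply: le_trans (rnorm_triangle (cmul p v) _ _) _.
  rewrite [leRHS]splitr; apply: lerD.
    rewrite -cmulBl; apply: le_trans (rnorm_cmul _ _) _.
    apply: le_trans (ler_pM (rnorm_ge0 _) (rnorm_ge0 _) up vM) _.
    by rewrite mulfVK ?gt_eqF.
  rewrite -cmulBr; apply: le_trans (rnorm_cmul _ _) _.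
  apply: le_trans (ler_pM (rnorm_ge0 _) (rnorm_ge0 _) pM vq) _.
  by rewrite mulrC mulfVK ?gt_eqF.
have l1 (p q : R) : 0 <= q -> p <= p + q + 1 by move=> q0; rewrite -addrA lerDl addr_ge0.
have l2 (p q : R) : 0 <= p -> q <= p + q + 1.
  by move=> p0; rewrite addrAC lerDr addr_ge0.
exists (mul a b); first exact: Smul.
by rewrite mA// mB//; split; apply: K => //; rewrite ?l1 ?l2 ?rnorm_ge0.
Qed.

Lemma same_limit_star x y : sl x y -> sl (cstar x) (cstar y).
Proof.
have [_ _ sA _ _] := cA; have [_ _ sB _ _] := cB.
move=> h e /h[a Sa [xa ya]]; exists (star a); first exact: Sstar.
by rewrite sA// sB// -!cstarB !rnorm_cstar.
Qed.

Lemma same_limit_le x y : sl x y -> rnorm y <= rnorm x.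
Proof.
have [_ _ _ nA _] := cA; have [_ _ _ nB _] := cB.
move=> h; apply/ler_addgt0Pr => e e0; have [|a Sa [xa ya]] := h (e / 2).
  by rewrite divr_gt0.
have ja : rnorm (jB a) = rnorm (jA a) by apply: EFin_inj; rewrite nA ?nB.
have := rnorm_triangle (jB a) y 0; have := rnorm_triangle x (jA a) 0.
by rewrite !subr0 (rnorm_distC (jA a)) -ja; lra.
Qed.

Lemma same_limit_uniq x y y' : sl x y -> sl x y' -> y = y'.
Proof.
move=> h h'; have := same_limit_le (same_limit_lin (-1) h' h).
rewrite !scaleN1r ![- _ + _]addrC subrr rnorm0 => yy'.
by apply/eqP; rewrite -subr_eq0; apply/eqP/rnorm_eq0/eqP; rewrite eq_le yy' rnorm_ge0.
Qed.

(** The images under [jB] of the elements [a] with [jA a] close to [x] form a Cauchy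
    filter, because [jA] and [jB] induce the same distance on [S]. *)
Lemma same_limit_total x : exists y, sl x y.
Proof.
have [_ _ _ _ dA] := cA.
have dense (e : R) : 0 < e -> exists2 a, S a & rnorm (x - jA a) <= e.
  move=> e0; have : closure (jA @` S) x by rewrite dA.
  by move=> /closure_rnormP/(_ e e0)[_ [a Sa <-]]; exists a.
pose U (e : R) : set B := jB @` [set a | S a /\ rnorm (x - jA a) <= e].
pose F := filter_from [set e : R | 0 < e] U.
have FF : ProperFilter F.
  apply: filter_from_proper => [|e /= /dense[a Sa xa]]; last by exists (jB a); exists a.
  apply: filter_from_filter; first by exists 1 => /=.
  move=> d e /= d0 e0; exists (Num.min d e); first by rewrite /= lt_min d0.
  by move=> _ [a [Sa +] <-]; rewrite le_min => /andP[xd xe]; split; exists a.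
have /cauchy_cvgP/cvg_ex[y Fy] : cauchy F.
  apply/cauchy_ballP => e e0.
  have eE : e = (rnorm e)%:C%C by rewrite -rnormE gtr0_norm.
  move: e0; rewrite eE ltcR => e0; have e3 : 0 < rnorm e / 3 by rewrite divr_gt0.
  exists (U (rnorm e / 3), U (rnorm e / 3)); first by split; exists (rnorm e / 3).
  move=> [_ _] /= [[a [Sa xa] <-] [b [Sb xb] <-]].
  rewrite -ball_normE /= rnormE ltcR -completion_isometry//.
  apply: le_lt_trans (rnorm_triangle x _ _) _.
  by rewrite [rnorm (jA a - x)]rnorm_distC; lra.
exists y => e e0.
have [|d /= d0 Ud] := Fy (ball y e%:C%C); first by apply: nbhsx_ballx; rewrite ltcR.
have [|a Sa xa] := dense (Num.min d e); first by rewrite lt_min d0.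
move: xa; rewrite le_min => /andP[xd xe]; exists a => //; split=> //.
have : ball y e%:C%C (jB a) by apply: Ud; exists a.
by rewrite -ball_normE /= rnormE ltcR => /ltW.
Qed.

End two_completions.

(** The relation [same_limit] is the graph of a bijection by symmetry, and it is
    compatible with the operations because they are continuous. *)
Theorem completion_unique (A B : cstarAlgType R) (jA : V -> A) (jB : V -> B) :
  is_compl jA -> is_compl jB ->
  exists f : A -> B,
    [/\ linear f, {morph f : x y / cmul x y}, {morph f : x / cstar x}, bijective f &
        forall a, S a -> f (jA a) = jB a].
Proof.
move=> cA cB.
have [f fP] := choice (same_limit_total cA cB).
have [g gP] := choice (same_limit_total cB cA).
have uniq x y : same_limit jA jB x y -> f x = y.
  by move=> xy; exact: (same_limit_uniq cA cB (fP x) xy).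
exists f; split.
- by move=> k x y; apply: uniq; exact: same_limit_lin.
- by move=> x y; apply: uniq; exact: same_limit_mul.
- by move=> x; apply: uniq; exact: same_limit_star.
- exists g => x; last by apply: uniq; exact: same_limit_sym.
  by apply: (same_limit_uniq cB cA (gP (f x))); exact: same_limit_sym.
- by move=> a Sa; apply: uniq; exact: same_limit_j.
Qed.

End completions.

(** * Indices and the modular function *)

Section index.
Variable G : groupType.
Local Open Scope group_scope.
Implicit Types (A B D : set G) (g h x : G).

Definition card_image (X : choiceType) (f : G -> X) A : nat := #|` fset_set (f @` A)|.

Lemma fset_imageP (X : choiceType) (f : G -> X) A c : finite_set (f @` A) ->
  reflect (exists2 a, A a & f a = c) (c \in fset_set (f @` A)).
Proof. by move=> ff; rewrite in_fset_set//; apply: (iffP idP) => /[!inE]. Qed.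

(** If the fibres of [f] on [A] are contained in those of [h], then [h] factors through
    [f]; this transports finiteness. *)
Lemma image_factor (X Y : choiceType) (f : G -> X) (h : G -> Y) A :
  (forall a b, A a -> A b -> f a = f b -> h a = h b) -> finite_set (f @` A) ->
  exists phi : X -> Y,
    [/\ forall a, A a -> phi (f a) = h a, finite_set (h @` A) &
        fset_set (h @` A) = [fset phi c | c in fset_set (f @` A)]%fset].
Proof.
move=> fh ff.
pose phi (c : X) : Y := h (xget 1 [set a | A a /\ f a = c]).
have phiE a : A a -> phi (f a) = h a.
  move=> Aa; rewrite /phi; case: xgetP => [b _ [Ab]|/(_ a)]; last by move/not_andP => -[].
  exact: fh.
have E : h @` A = phi @` (f @` A).
  apply/seteqP; split=> [_ [a Aa <-]|_ [_ [a Aa <-] <-]].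
    by exists (f a); [exists a|exact: phiE].
  by exists a => //; rewrite phiE.
have hf : finite_set (h @` A) by rewrite E; exact: finite_image.
exists phi; split=> //; apply/fsetP => c; apply/fset_imageP/imfsetP => //=.
  by move=> [a Aa <-]; exists (f a); [apply/fset_imageP => //; exists a|rewrite phiE].
by move=> [_ /(fset_imageP _ ff)[a Aa <-] ->]; exists a => //; rewrite phiE.
Qed.

Lemma card_image_eq (X Y : choiceType) (f : G -> X) (h : G -> Y) A :
  (forall a b, A a -> A b -> f a = f b <-> h a = h b) ->
  finite_set (f @` A) -> finite_set (h @` A) /\ card_image f A = card_image h A.
Proof.
move=> fh ff.
have [|phi [phiE hf e]] := @image_factor _ _ f h A _ ff.
  by move=> a b Aa Ab; move/(fh _ _ Aa Ab).
split=> //; rewrite /card_image e card_in_imfset//=.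
move=> _ _ /(fset_imageP _ ff)[a Aa <-] /(fset_imageP _ ff)[b Ab <-].
by rewrite !phiE// => /fh; apply.
Qed.

Lemma card_image_fibre (X Y : choiceType) (f : G -> X) (h : G -> Y) A N :
  (forall a b, A a -> A b -> f a = f b -> h a = h b) ->
  finite_set (h @` A) ->
  (forall a, A a -> finite_set (f @` [set b | A b /\ h b = h a]) /\
                    card_image f [set b | A b /\ h b = h a] = N) ->
  finite_set (f @` A) /\ card_image f A = (card_image h A * N)%N.
Proof.
move=> fh hf fib.
pose fb (c : Y) := f @` [set b | A b /\ h b = c].
have E : f @` A = \bigcup_(c in h @` A) fb c.
  apply/seteqP; split=> [_ [a Aa <-]|_ [_ [a Aa <-] [b [Ab _] <-]]]; last by exists b.
  by exists (h a); [exists a|exists a].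
have ff : finite_set (f @` A).
  by rewrite E; apply: bigcup_finite => // _ [a Aa <-]; have [] := fib _ Aa.
split=> //; have [phi [phiE _ e]] := image_factor fh ff.
rewrite /card_image e card_fset_sum1 (partition_big_imfset _ phi)/= big_seq (eq_bigr (fun=> N)).
  by rewrite -big_seq big_const_seq count_predT iter_addn addn0 mulnC.
move=> c /imfsetP[/= _ /(fset_imageP _ ff)[a Aa <-] ->]; rewrite phiE//.
have [af <-] := fib a Aa; rewrite /card_image big_fset_condE /= -card_fset_sum1.
congr (#|` _|); apply/fsetP => d; rewrite !inE /=; apply/andP/fset_imageP => //.
  by move=> [/(fset_imageP _ ff)[b Ab <-]]; rewrite phiE// => /eqP hb; exists b.
move=> [b [Ab hb] <-]; rewrite phiE// hb; split=> //.
by apply/fset_imageP => //; exists b.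
Qed.

(** The index of A :&: B in A, as the number of left cosets of [B] that meet [A]. In
    this form it makes sense for two subgroups neither of which contains the other. *)
Definition relindex A B : nat := card_image (lcoset B) A.
Definition fin_relindex A B : Prop := finite_set (lcoset B @` A).

Lemma lcosetP B x y : is_subgroup B -> lcoset B x = lcoset B y <-> B (x^-1 * y).
Proof.
move=> hB; have [B1 BM BV] := hB; split=> [/lcoset_eqP[//|a Ba ->]|].
  by rewrite mulKg.
move=> Bxy; apply/seteqP; split=> [_ [a Ba <-]|_ [a Ba <-]].
  exists ((x^-1 * y)^-1 * a); first by apply: BM => //; exact: BV.
  by rewrite invgM invgK -mulgA mulVKg.
exists (x^-1 * y * a); first exact: BM.
by rewrite -mulgA mulVKg.
Qed.

Lemma subgroupI A B : is_subgroup A -> is_subgroup B -> is_subgroup (A `&` B).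
Proof.
move=> [A1 AM AV] [B1 BM BV]; split=> //.
  by move=> x y [? ?] [? ?]; split; [exact: AM|exact: BM].
by move=> x [? ?]; split; [exact: AV|exact: BV].
Qed.

Lemma conjsetP A g x : conjset A g x <-> A (g^-1 * x * g).
Proof.
split=> [[a Aa <-]|Ax]; first by rewrite !mulgA mulVg mul1g mulgVK.
by exists (g^-1 * x * g) => //; rewrite !mulgA mulgV mul1g mulgK.
Qed.

Lemma subgroup_conj A g : is_subgroup A -> is_subgroup (conjset A g).
Proof.
move=> [A1 AM AV]; split; first by apply/conjsetP; rewrite mulg1 mulVg.
  move=> x y /conjsetP Ax /conjsetP Ay; apply/conjsetP.
  have -> : g^-1 * (x * y) * g = (g^-1 * x * g) * (g^-1 * y * g).
    by rewrite !mulgA mulgK.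
  exact: AM.
move=> x /conjsetP Ax; apply/conjsetP.
have -> : g^-1 * x^-1 * g = (g^-1 * x * g)^-1 by rewrite !invgM invgK mulgA.
exact: AV.
Qed.

Lemma relindex_gt0 A B : A 1 -> fin_relindex A B -> (0 < relindex A B)%N.
Proof.
move=> A1 fAB; rewrite /relindex /card_image cardfs_gt0; apply/fset0Pn.
by exists (lcoset B 1); rewrite in_fset_set// inE; exists 1.
Qed.

(** The elements of [A] in a given coset of [B] form a translate of A :&: B, and
    translations preserve the number of cosets. *)
Lemma relindex_tower A B D : is_subgroup A -> is_subgroup B -> is_subgroup D ->
  fin_relindex A B -> fin_relindex (A `&` B) D ->
  relindex A (B `&` D) = (relindex A B * relindex (A `&` B) D)%N.
Proof.
move=> hA hB hD fAB fABD; have [A1 AM AV] := hA.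
have hBD := subgroupI hB hD.
apply: (@card_image_fibre _ _ (lcoset (B `&` D)) (lcoset B) A (relindex (A `&` B) D) _ fAB _).2.
  by move=> a b _ _; rewrite !lcosetP// => -[].
move=> a Aa.
pose t := [set b | A b /\ lcoset B b = lcoset B a].
have tE : t = [set a * b | b in A `&` B].
  apply/seteqP; split=> [b [Ab /esym/lcosetP ba]|_ [b [Ab Bb] <-]].
    exists (a^-1 * b); last by rewrite mulVKg.
    by split; [apply: AM => //; exact: AV|exact: ba].
  split; first exact: AM.
  by apply/esym/lcosetP => //; rewrite mulKg.
have E : lcoset (B `&` D) @` t = (fun b => lcoset (B `&` D) (a * b)) @` (A `&` B).
  rewrite tE; apply/seteqP; split=> [_ [_ [b ab <-] <-]|_ [b ab <-]]; first by exists b.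
  by exists (a * b) => //; exists b.
have [|f e] := @card_image_eq _ _ (lcoset D) (fun b => lcoset (B `&` D) (a * b)) (A `&` B) _ fABD;
    last by rewrite E; split=> //; rewrite /relindex e /card_image -/t E.
move=> b c [Ab Bb] [Ac Bc]; rewrite !lcosetP//.
rewrite invgM -mulgA mulKg; split=> [Dbc|[]//]; split=> //.
by have [_ BM BV] := hB; apply: BM => //; exact: BV.
Qed.

Lemma relindex_capr A B D : is_subgroup A -> is_subgroup B -> is_subgroup D ->
  D `<=` A -> fin_relindex A B -> fin_relindex D B.
Proof. by move=> hA hB hD DA; apply: sub_finite_set; exact: image_subset. Qed.

Lemma relindex_conj A B g : is_subgroup B -> fin_relindex A B ->
  fin_relindex (conjset A g) (conjset B g) /\ relindex (conjset A g) (conjset B g) = relindex A B.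
Proof.
move=> hB fAB; pose f a := lcoset (conjset B g) (g * a * g^-1).
have E : lcoset (conjset B g) @` conjset A g = f @` A.
  by apply/seteqP; split=> [_ [_ [a Aa <-] <-]|_ [a Aa <-]];
    [exists a|exists (g * a * g^-1) => //; exists a].
have [|ff fe] := @card_image_eq _ _ (lcoset B) f A _ fAB;
    last by split; [rewrite /fin_relindex E|rewrite /relindex fe /card_image E].
move=> a b _ _; rewrite /f lcosetP// lcosetP; last exact: subgroup_conj.
rewrite conjsetP; suff -> : g^-1 * ((g * a * g^-1)^-1 * (g * b * g^-1)) * g = a^-1 * b by [].
by rewrite !invgM invgK !mulgA mulVg mul1g !mulgVK.
Qed.

End index.

Section modular.
Variables (R : realType) (G : groupType) (Gam : set G).
Hypothesis hG : hecke_pair Gam.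
Local Open Scope group_scope.
Implicit Types g h x y z : G.
Local Notation conj := (conjset Gam).
Local Notation modular := (modular R Gam).

Let hS : is_subgroup Gam. Proof. by have [] := hG. Qed.

Lemma conjsetM g h : conjset (conj g) h = conj (h * g).
Proof. by apply/seteqP; split=> x /=; rewrite !conjsetP invgM !mulgA. Qed.

Lemma conjset1 : conj 1 = Gam.
Proof. by apply/seteqP; split=> x /=; rewrite conjsetP invg1 mul1g mulg1. Qed.

(** The coset a g Gam only depends on the coset of a modulo the conjugate g Gam g^-1. *)
Lemma LindexE g : fin_relindex Gam (conj g) /\ Lindex Gam g = relindex Gam (conj g).
Proof.
have [G1 GM GV] := hS; have [fin _] := (hG.2 g).
have E : lcoset Gam @` dcoset Gam g = (fun a => lcoset Gam (a * g)) @` Gam.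
  apply/seteqP; split=> [_ [_ [a Ga [b Gb <-]] <-]|_ [a Ga <-]].
    exists a => //; apply/lcosetP => //; by rewrite mulKg.
  by exists (a * g * 1); [exists a => //; exists 1|rewrite mulg1].
have [||f e] := @card_image_eq _ _ _ (fun a => lcoset Gam (a * g)) (lcoset (conj g)) Gam;
  last by rewrite /Lindex E /relindex -e.
  move=> a b Ga Gb; rewrite !lcosetP//; last exact: subgroup_conj.
  by rewrite conjsetP invgM !mulgA.
by rewrite -E.
Qed.

(** Inversion exchanges left and right cosets; conjugating by [g] then moves the index
    of g^-1 Gam g in Gam to that of Gam in g Gam g^-1. *)
Lemma RindexE g : fin_relindex (conj g) Gam /\ Rindex Gam g = relindex (conj g) Gam.
Proof.
have [G1 GM GV] := hS; have [_ fin] := (hG.2 g).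
have rcosetP x y : rcoset Gam x = rcoset Gam y <-> Gam (x * y^-1).
  split=> [xy|Gxy].
    have : rcoset Gam x x by exists 1 => //; rewrite mul1g.
    by rewrite xy => -[a Ga <-]; rewrite mulgK.
  apply/seteqP; split=> [_ [a Ga <-]|_ [a Ga <-]].
    by exists (a * (x * y^-1)); [exact: GM|rewrite !mulgA mulgVK].
  exists (a * (x * y^-1)^-1); first by apply: GM => //; exact: GV.
  by rewrite invgM invgK !mulgA mulgVK.
have E : rcoset Gam @` dcoset Gam g = (fun a => rcoset Gam (g * a^-1)) @` Gam.
  apply/seteqP; split=> [_ [_ [a Ga [b Gb <-]] <-]|_ [a Ga <-]].
    exists b^-1; first exact: GV.
    by apply/rcosetP; rewrite invgK !invgM !mulgA mulgK mulgV mul1g; exact: GV.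
  exists (1 * g * a^-1); last by rewrite mul1g.
  by exists 1 => //; exists a^-1 => //; exact: GV.
have [||f e] := @card_image_eq _ _ _ (fun a => rcoset Gam (g * a^-1)) (lcoset (conj g^-1)) Gam.
- move=> a b Ga Gb; rewrite rcosetP lcosetP; last exact: subgroup_conj.
  by rewrite conjsetP !invgM !invgK !mulgA.
- by rewrite -E.
have [] := @relindex_conj _ Gam (conj g^-1) g (subgroup_conj _ hS) f.
rewrite conjsetM mulgV conjset1 => f' e'; split=> //.
by rewrite e' /Rindex E.
Qed.

Let cidx x y : nat := relindex (conj x) (conj y).

Let cidxE x y : fin_relindex (conj x) (conj y) /\ cidx x y = Lindex Gam (x^-1 * y).
Proof.
have [f e] := LindexE (x^-1 * y).
have [] := @relindex_conj _ Gam (conj (x^-1 * y)) x (subgroup_conj _ hS) f.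
by rewrite conjsetM mulVKg -e.
Qed.

Let cidx_gt0 x y : (0 < cidx x y)%N.
Proof.
have [f _] := cidxE x y; apply: relindex_gt0 => //.
by have [] := subgroup_conj x hS.
Qed.

Lemma Rindex_Lindex g : Rindex Gam g = Lindex Gam g^-1.
Proof.
by have [_ ->] := RindexE g; rewrite -{2}conjset1 -/(cidx g 1) (cidxE g 1).2 mulg1.
Qed.

(** Write [X : Y] for the index of X :&: Y in X. For subgroups A, B, D any two of which
    are commensurable, the tower law computes the index of the triple intersection in A
    in two ways, [A : B] [A :&: B : D] = [A : D] [A :&: D : B]. Hence [A : B] / [B : A]
    is the quotient of the indices of A :&: B :&: D in A and in B, and is multiplicative
    in (A, B). Take for A, B, D the conjugates of Gam by 1, g and g h. *)
Lemma modularM g h : modular (g * h) = (modular g * modular h)%R.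
Proof.
have mE x y : modular (x^-1 * y) = ((cidx x y)%:R / (cidx y x)%:R)%R.
  by rewrite /Defs.modular Rindex_Lindex invgM invgK !(cidxE _ _).2.
have := mE 1 (g * h); have := mE 1 g; have := mE g (g * h).
rewrite invg1 !mul1g mulKg => -> -> ->.
pose x : G := 1; pose y := g; pose z := g * h; rewrite -/x -/y -/z.
pose t p q r := relindex (conj p `&` conj q) (conj r).
have hc p := subgroup_conj p hS.
have fi p q r : fin_relindex (conj p `&` conj q) (conj r).
  apply: (@relindex_capr _ (conj p)) => //; [exact: subgroupI|exact: (cidxE p r).1].
have tw p q r : (cidx p q * t p q r = cidx p r * t p r q)%N.
  have e1 := relindex_tower (hc p) (hc q) (hc r) (cidxE p q).1 (fi p q r).
  have e2 := relindex_tower (hc p) (hc r) (hc q) (cidxE p r).1 (fi p r q).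
  by rewrite -/(cidx p q) -/(cidx p r) -/(t _ _ _) in e1 e2; rewrite -e1 -e2 setIC.
have tC p q r : t p q r = t q p r by rewrite /t setIC.
have t0 p q r : ((t p q r)%:R != 0 :> R)%R.
  rewrite pnatr_eq0 -lt0n; apply: relindex_gt0 => //.
  by have [] := subgroupI (hc p) (hc q).
have c0 p q : ((cidx p q)%:R != 0 :> R)%R by rewrite pnatr_eq0 -lt0n.
have cE p q r : ((cidx p q)%:R = (cidx p r)%:R * (t p r q)%:R / (t p q r)%:R :> R)%R.
  by rewrite -natrM -tw natrM mulfK.
rewrite (cE x y z) (cE y x z) (cE z y x) (tC y x) (tC y z) (tC z y) (tC z x).
by field; rewrite !c0 !t0.
Qed.

Lemma modular_gt0 g : (0 < modular g)%R.
Proof.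
rewrite /Defs.modular Rindex_Lindex -[g]mul1g -invg1 -(cidxE 1 g).2.
by rewrite invgM invgK -(cidxE g 1).2 divr_gt0// ltr0n cidx_gt0.
Qed.

Lemma modular_Gam a : Gam a -> modular a = 1%R.
Proof.
move=> Ga; have [G1 GM GV] := hS.
have conja b : Gam b -> conj b = Gam.
  move=> Gb; apply/seteqP; split=> x /=; rewrite conjsetP => Gx.
    have -> : x = b * (b^-1 * x * b) * b^-1 by rewrite !mulgA mulgV mul1g mulgK.
    by apply/GM; [exact/GM|exact/GV].
  by apply/GM => //; apply/GM => //; exact/GV.
have e b : Gam b -> Lindex Gam b = relindex Gam Gam by move=> Gb; rewrite (LindexE b).2 conja.
rewrite /Defs.modular Rindex_Lindex !e//; last exact: GV.
have := cidx_gt0 1 1; rewrite /cidx conjset1 => h.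
by rewrite divff// pnatr_eq0 -lt0n.
Qed.

End modular.

(** * The crossed product as an algebra of finite matrices *)

Lemma finite_finmat (R : realType) (I : choiceType) (k : I -> I -> R[i]) :
  finite_set [set p : I * I | k p.1 p.2 != 0] -> finmat k.
Proof.
set S := [set p | _] => fS.
have f1 : finite_set (fst @` S) by exact: finite_image.
have f2 : finite_set (snd @` S) by exact: finite_image.
exists (fset_set (fst @` S) `|` fset_set (snd @` S))%fset => i j.
apply: contraFeq => kij; rewrite !inE !in_fset_set//.
have Sij : S (i, j) by [].
by apply/andP; split; apply/orP; [left|right]; rewrite inE; exists (i, j).
Qed.

Lemma finmat_finite (R : realType) (I : choiceType) (k : I -> I -> R[i]) :
  finmat k -> finite_set [set p : I * I | k p.1 p.2 != 0].
Proof.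
move=> [A kA]; apply: (@sub_finite_set _ _ ([set` A] `*` [set` A])).
  move=> [i j] /= kij; case ij : ((i \in A) && (j \in A)); first exact/andP.
  by move: kij; rewrite kA ?eqxx.
by apply: finite_setX; exact: finite_fset.
Qed.

Section crossed_product_matrices.
Variables (R : realType) (G : groupType) (Gam : set G).
Hypothesis hG : hecke_pair Gam.
Local Notation C := R[i].
Local Notation GH := (lquot Gam).
Local Notation cl := (cls (lcoset Gam)).
Local Notation dcl := (cls (dcoset Gam)).
Local Notation mat := (GH -> GH -> C).
Implicit Types (g h x y a b : G) (c d e : GH) (k l : mat) (f : GH -> G -> C).

Let hS : is_subgroup Gam. Proof. by have [] := hG. Qed.
Let Gam1 : Gam 1%g. Proof. by have [] := hS. Qed.
Let GamM a b : Gam a -> Gam b -> Gam (a * b)%g. Proof. by have [_ + _] := hS; apply. Qed.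
Let GamV a : Gam a -> Gam a^-1%g. Proof. by have [_ _] := hS; apply. Qed.

Definition sqrt_modular g : C := (Num.sqrt (modular R Gam g))%:C%C.
Local Notation sm := sqrt_modular.

Lemma sqrt_modularM g h : sm (g * h)%g = sm g * sm h.
Proof. by rewrite /sm modularM// sqrtrM ?rmorphM// ltW// modular_gt0. Qed.

Lemma sqrt_modular_Gam a : Gam a -> sm a = 1.
Proof. by move=> Ga; rewrite /sm modular_Gam// sqrtr1. Qed.

Lemma sqrt_modular_neq0 g : sm g != 0.
Proof.
rewrite /sm -(rmorph0 (real_complex R)) (inj_eq (@complexI _)) gt_eqF// sqrtr_gt0.
exact: modular_gt0.
Qed.

Lemma sqrt_modularV g : sm g^-1%g = (sm g)^-1.
Proof.
by apply: (mulfI (sqrt_modular_neq0 g)); rewrite -sqrt_modularM mulgV sqrt_modular_Gam// mulfV// sqrt_modular_neq0.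
Qed.

Lemma sqrt_modular_conj g : (sm g)^* = sm g.
Proof. exact: conjc_real. Qed.

Lemma sqrt_modular_sqr g : (modular R Gam g)%:C%C = sm g * sm g.
Proof. by rewrite /sm -rmorphM/= -expr2 sqr_sqrtr// ltW// modular_gt0. Qed.

Lemma sqrt_modular_mulr g a : Gam a -> sm (g * a)%g = sm g.
Proof. by move=> Ga; rewrite sqrt_modularM [sm a]sqrt_modular_Gam// mulr1. Qed.

Lemma sqrt_modular_mull g a : Gam a -> sm (a * g)%g = sm g.
Proof. by move=> Ga; rewrite sqrt_modularM sqrt_modular_Gam// mul1r. Qed.

Lemma clP x y : cl x = cl y <-> Gam (x^-1 * y)%g.
Proof.
rewrite -lcosetP//; split=> [/(congr1 val)//|xy]; exact: val_inj.
Qed.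

Lemma cl_mulr x a : Gam a -> cl (x * a)%g = cl x.
Proof. by move=> Ga; apply/esym/clP; rewrite mulKg. Qed.

Lemma rep_cl x : exists2 a, Gam a & rep (cl x) = (x * a)%g.
Proof.
exists (x^-1 * rep (cl x))%g; last by rewrite mulVKg.
by apply/clP; rewrite repK.
Qed.

Lemma cl_mul_rep x g : cl (x * rep (cl g))%g = cl (x * g)%g.
Proof.
have [a Ga ->] := rep_cl g.
by rewrite mulgA (cl_mulr _ Ga).
Qed.

Lemma dcl_mul a g b : Gam a -> Gam b -> dcl (a * g * b)%g = dcl g.
Proof.
move=> Ga Gb; apply: val_inj; apply/seteqP; split=> /= [_ [p Gp [q Gq <-]]|_ [p Gp [q Gq <-]]].
  by exists (p * a)%g; [exact: GamM|exists (b * q)%g; [exact: GamM|rewrite !mulgA]].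
exists (p * a^-1)%g; first by apply/GamM => //; exact/GamV.
exists (b^-1 * q)%g; first by apply/GamM => //; exact/GamV.
by rewrite !mulgA mulgVK mulgK.
Qed.

Lemma dcl_mulr g b : Gam b -> dcl (g * b)%g = dcl g.
Proof. by move=> Gb; rewrite -{1}[g]mul1g dcl_mul. Qed.

Lemma dcl_mull a g : Gam a -> dcl (a * g)%g = dcl g.
Proof. by move=> Ga; rewrite -[(a * g)%g]mulg1 dcl_mul. Qed.

Lemma dcl_rep_cl g : dcl (rep (cl g)) = dcl g.
Proof. by have [a Ga ->] := rep_cl g; rewrite dcl_mulr. Qed.

Lemma rep_dcl g : exists a b, [/\ Gam a, Gam b & rep (dcl g) = (a * g * b)%g].
Proof.
have : dcoset Gam g (rep (dcl g)).
  have /(congr1 val)/= <- := repK (dcl g).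
  by exists 1%g => //; exists 1%g => //; rewrite mul1g mulg1.
by move=> [a Ga [b Gb <-]]; exists a, b.
Qed.

Lemma translate_bij x : set_bij [set: GH] [set: GH] (fun e => cl (x * rep e)%g).
Proof.
split=> //.
  move=> d e _ _ /(congr1 val)/= de; exact: lcoset_trans_inj de.
by move=> e _; exists (cl (x^-1 * rep e)%g) => //=; rewrite cl_mul_rep mulVKg repK.
Qed.

Lemma hecke_orbit g : finite_set [set cl (a * g)%g | a in Gam].
Proof.
have [fin _] := hG.2 g.
have [||phi [_ + _]] // := @image_factor G _ _ (fun a => lcoset Gam (a * g)%g) (fun a => cl (a * g)%g) Gam.
  by move=> a b _ _ ab; exact: val_inj.
apply: sub_finite_set fin => _ [a Ga <-]; exists (a * g)%g => //.
by exists a => //; exists 1%g => //; rewrite mulg1.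
Qed.

(** The matrix of an element. With x = rep c and y = rep d the entry is Delta(x^-1
    y)^(1/2) f(x^-1 y)(x), and covariance makes it independent of the representatives
    ([mat_ofE]). *)
Definition mat_of f : mat := fun c d =>
  sm ((rep c)^-1 * rep d)%g * f (cl ((rep c)^-1 * rep d)%g) (rep c).

Definition of_mat k : GH -> G -> C := fun c x =>
  (sm (rep c))^-1 * k (cl x) (cl (x * rep c)%g).

Lemma mat_ofE f x y : Bset f ->
  mat_of f (cl x) (cl y) = sm (x^-1 * y)%g * f (cl (x^-1 * y)%g) x.
Proof.
move=> [_ fcov]; rewrite /mat_of; have [a Ga ->] := rep_cl x; have [b Gb ->] := rep_cl y.
have -> : ((x * a)^-1 * (y * b) = a^-1 * (x^-1 * y) * b)%g by rewrite invgM !mulgA.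
have Ga' := GamV Ga.
by rewrite sqrt_modular_mulr// sqrt_modular_mull// cl_mulr// fcov// /rtrans mulgK.
Qed.

Lemma of_matE k g x : of_mat k (cl g) x = (sm g)^-1 * k (cl x) (cl (x * g)%g).
Proof.
by rewrite /of_mat cl_mul_rep; have [a Ga ->] := rep_cl g; rewrite sqrt_modular_mulr.
Qed.

Lemma of_matK k : mat_of (of_mat k) = k.
Proof.
apply/funext => c; apply/funext => d; rewrite /mat_of of_matE mulrA mulfV ?sqrt_modular_neq0// mul1r.
by rewrite mulVKg !repK.
Qed.

Lemma mat_ofK f : Bset f -> of_mat (mat_of f) = f.
Proof.
move=> fB; apply/funext => c; apply/funext => x.
by rewrite /of_mat mat_ofE// mulKg mulrA mulVf ?sqrt_modular_neq0// mul1r repK.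
Qed.

Lemma mat_of_lin (r : C) f1 f2 : mat_of (r *: f1 + f2) = r *: mat_of f1 + mat_of f2.
Proof.
apply/funext => c; apply/funext => d; rewrite matD matZ /mat_of !fctE /GRing.scale/=.
by rewrite mulrDr mulrCA.
Qed.

Lemma of_mat_lin (r : C) k l : of_mat (r *: k + l) = r *: of_mat k + of_mat l.
Proof.
apply/funext => c; apply/funext => x; rewrite /of_mat matD matZ !fctE /GRing.scale/=.
by rewrite mulrDr mulrCA.
Qed.

(** Reindex the sum over m in G / Gam as m = x e: the entries at (x, x e) and (x e, x c)
    are the values at e and at e^-1 c of the two functions that are convolved, up to the
    factors Delta^(1/2), which multiply. *)
Lemma of_mat_matmul k l : rowfin k -> of_mat (matmul k l) = bmul (of_mat k) (of_mat l).
Proof.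
move=> kf; apply/funext => c; apply/funext => x; rewrite /of_mat /bmul.
have [A kA] := rowfin_fset (cl x) kf.
rewrite /matmul (reindex_fsbig _ _ _ _ (translate_bij x)).
pose B : {fset GH} := fset_set (cl @` ((fun e => x^-1 * rep e)%g @` [set` A])).
have BP e : e \notin B -> k (cl x) (cl (x * rep e)%g) = 0.
  move=> eB; apply: kA; apply: contra eB => eA; rewrite in_fset_set; last first.
    by apply/finite_image/finite_image; exact: finite_fset.
  rewrite inE; exists (x^-1 * rep (cl (x * rep e)))%g; first by exists (cl (x * rep e)%g).
  by rewrite cl_mul_rep mulKg repK.
rewrite (fsum_fset (A := B)) => [|e /BP ->]; last by rewrite mul0r.
rewrite (fsum_fset (A := B)) => [|e /BP ->]; last by rewrite mulr0 mul0r.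
rewrite mulr_sumr; apply: eq_bigr => e _.
rewrite /rtrans -/(of_mat l _ _) of_matE -mulgA mulVKg.
by rewrite [in RHS]sqrt_modularM sqrt_modularV; field; rewrite !sqrt_modular_neq0.
Qed.

Lemma of_mat_matstar k : of_mat (matstar k) = bstar (of_mat k).
Proof.
apply/funext => c; apply/funext => x.
have conjE (a b : C) : (a^-1 * b)^* = (a^*)^-1 * b^* by rewrite rmorphM fmorphV.
rewrite /bstar /rtrans of_matE -mulgA mulgV mulg1 conjE sqrt_modular_conj.
by rewrite sqrt_modular_sqr -mulrA mulVKf ?sqrt_modular_neq0// sqrt_modularV.
Qed.

Lemma Bset_rowfin f : Bset f -> rowfin (mat_of f).
Proof.
move=> [ff _] c.
apply: (@sub_finite_set _ _ ((fun e => cl (rep c * rep e)%g) @` [set e | f e != 0])); last first.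
  exact: finite_image.
move=> d /= kcd; exists (cl ((rep c)^-1 * rep d)%g).
  apply: contraNneq kcd => f0; rewrite /mat_of f0.
  by rewrite -[X in _ * X]/(0 : C) mulr0.
by rewrite cl_mul_rep mulVKg repK.
Qed.

Lemma mat_of_bmul f1 f2 : Bset f1 -> Bset f2 -> mat_of (bmul f1 f2) = matmul (mat_of f1) (mat_of f2).
Proof.
move=> B1 B2; rewrite -{1}(mat_ofK B1) -{1}(mat_ofK B2) -of_mat_matmul ?of_matK//.
exact: Bset_rowfin.
Qed.

Lemma mat_of_bstar f : Bset f -> mat_of (bstar f) = matstar (mat_of f).
Proof. by move=> fB; rewrite -{1}(mat_ofK fB) -of_mat_matstar of_matK. Qed.

(** Such cosets lie in the orbit of c^-1 d under Gam, which is finite for a Hecke pair.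
    *)
Lemma finite_position c d : finite_set [set e : GH | exists x, cl x = c /\ cl (x * rep e)%g = d].
Proof.
apply: sub_finite_set (hecke_orbit ((rep c)^-1 * rep d)%g) => e [x [xc xd]].
have [a Ga E] := rep_cl x; rewrite xc in E.
have [b Gb E'] := rep_cl (x * rep e)%g; rewrite xd in E'.
exists a => //; rewrite E E' invgM !mulgA mulgV mul1g -!mulgA mulKg.
by rewrite (cl_mulr _ Gb) repK.
Qed.

(** The value of [of_mat k] at the coset of [g] depends on x through (x Gam, x g Gam),
    which is the same as the coset of x modulo Gam :&: g Gam g^-1. *)
Lemma of_mat_crossed k : finmat k -> crossed (of_mat k).
Proof.
move=> kf; have [A kA] := kf; split; first split.
- apply: (@sub_finite_set _ _ (\bigcup_(p in [set p : GH * GH | k p.1 p.2 != 0])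
    [set e | exists x, cl x = p.1 /\ cl (x * rep e)%g = p.2])).
    move=> e /= ke; apply: contrapT => h; move/negP: ke; apply; apply/eqP/funext => x.
    rewrite /of_mat; have [->|kx] := eqVneq (k (cl x) (cl (x * rep e)%g)) 0; first by rewrite mulr0.
    by exfalso; apply: h; exists (cl x, cl (x * rep e)%g) => //; exists x.
  by apply: bigcup_finite => [|p _]; [exact: finmat_finite|exact: finite_position].
- by move=> a g Ga; apply/funext => x; rewrite /rtrans !of_matE sqrt_modular_mull// mulgA cl_mulr.
move=> g; split=> [x t [Gt /conjsetP Gt']|].
  rewrite !of_matE cl_mulr// (_ : x * t * g = x * g * (g^-1 * t * g))%g ?(cl_mulr _ Gt')//.
  by rewrite !mulgA mulgK.
have hK : is_subgroup (Gam `&` conjset Gam g) by apply: subgroupI => //; exact: subgroup_conj.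
have [||_ [_ + _]] // := @image_factor G _ _ (fun x => (cl x, cl (x * g)%g))
    (lcoset (Gam `&` conjset Gam g)) [set x | of_mat k (cl g) x != 0].
  move=> x y _ _ E; have /clP xy := congr1 fst E; have /clP xgyg := congr1 snd E.
  apply/lcosetP => //; split=> //.
  by apply/conjsetP; move: xgyg; rewrite invgM !mulgA.
apply: sub_finite_set (finmat_finite kf) => _ [x /= kx <-] /=.
by apply: contraNneq kx; rewrite of_matE => ->; rewrite mulr0.
Qed.

(** Conversely, x |-> (x Gam, x g Gam) is well defined modulo Gam :&: g Gam g^-1, so
    each of the finitely many values of [f] contributes finitely many entries. *)
Lemma crossed_finmat f : crossed f -> finmat (mat_of f).
Proof.
move=> [[ff fcov] fC]; apply: finite_finmat.
apply: (@sub_finite_set _ _ (\bigcup_(e in [set e | f e != 0])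
   ((fun x => (cl x, cl (x * rep e)%g)) @` [set x | f e x != 0]))).
  move=> [c d] /= kcd.
  have fx : f (cl ((rep c)^-1 * rep d)%g) (rep c) != 0.
    by apply: contraNneq kcd => f0; rewrite /mat_of f0 mulr0.
  exists (cl ((rep c)^-1 * rep d)%g).
    by apply: contraNneq fx => /= ->.
  by exists (rep c) => //; rewrite cl_mul_rep mulVKg !repK.
apply: bigcup_finite => // e _.
have [_] := fC (rep e); rewrite repK => fin.
have hK : is_subgroup (Gam `&` conjset Gam (rep e)).
  by apply: subgroupI => //; exact: subgroup_conj.
have [|_ [_ + _]] // := @image_factor G _ _ (lcoset (Gam `&` conjset Gam (rep e)))
  (fun x => (cl x, cl (x * rep e)%g)) [set x | f e x != 0] _ fin.
move=> x y _ _ /lcosetP -/(_ hK)[xy /conjsetP xy']; congr pair; apply/clP => //.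
by rewrite invgM !mulgA in xy' *.
Qed.

Definition rinv (phi : G -> C) := forall x a, Gam a -> phi (x * a)%g = phi x.

Lemma ofC_Bset phi : rinv phi -> @Bset R G Gam (ofC phi).
Proof.
move=> phiG; split.
  apply: (@sub_finite_set _ _ [set cl 1%g]); last exact: finite_set1.
  by move=> c /=; rewrite /ofC; case: (c =P _) => [->//|_]; rewrite eqxx.
move=> a g Ga; rewrite /ofC; have -> : (cl (a * g)%g == cl 1%g) = (cl g == cl 1%g).
  have E x : (cl x == cl 1%g) = (x \in Gam).
    apply/eqP/idP => [/esym/clP|]; first by rewrite invg1 mul1g inE.
    by rewrite inE => Gx; apply/esym/clP; rewrite invg1 mul1g.
  rewrite !E; apply/idP/idP; rewrite !inE => h; last exact: GamM.
  by rewrite -(mulKg a g); apply: GamM => //; exact: GamV.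
by case: eqP => // _; apply/funext => x; rewrite /rtrans phiG.
Qed.

Lemma mat_of_ofC phi c d : rinv phi -> mat_of (ofC phi) c d = if c == d then phi (rep c) else 0.
Proof.
move=> phiG; rewrite /mat_of /ofC.
have -> : (cl ((rep c)^-1 * rep d)%g == cl 1%g) = (c == d).
  apply/eqP/eqP => [/esym/clP|->]; last by rewrite mulVg.
  by rewrite invg1 mul1g => /clP; rewrite !repK.
case: eqP => [->|_]; last by rewrite mulr0.
by rewrite mulVg sqrt_modular_Gam// mul1r.
Qed.

Lemma ofH_Bset (f : dquot Gam -> C) : hecke f -> @Bset R G Gam (ofH f).
Proof.
move=> hf; split.
  apply: sub_finite_set (hecke_support hG hf) => c /= fc; apply: contraNneq fc => f0.
  by apply/eqP/funext => x; rewrite /ofH f0.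
by move=> a g Ga; apply/funext => x; rewrite /rtrans /ofH !dcl_rep_cl dcl_mull.
Qed.

Lemma mat_of_ofH (f : dquot Gam -> C) c d : mat_of (ofH f) c d = sm ((rep c)^-1 * rep d)%g * f (dcl ((rep c)^-1 * rep d)%g).
Proof. by rewrite /mat_of /ofH dcl_rep_cl. Qed.

Lemma hecke_lin (r : C) (f1 f2 : dquot Gam -> C) : hecke f1 -> hecke f2 -> hecke (r *: f1 + f2).
Proof.
move=> h1 h2; apply: (@sub_finite_set _ _ ([set D | f1 D != 0] `|` [set D | f2 D != 0])).
  move=> D /=; rewrite !fctE /GRing.scale/=; have [->|] := eqVneq (f1 D) 0; last by left.
  by rewrite mulr0 add0r; right.
by rewrite finite_setU.
Qed.

Lemma hecke_hmul (f1 f2 : dquot Gam -> C) : hecke f1 -> hecke f2 -> hecke (hmul f1 f2).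
Proof.
move=> /(hecke_support hG) s1 /(hecke_support hG) s2.
set S1 := [set c | _] in s1; set S2 := [set c | _] in s2.
apply: (@sub_finite_set _ _ ((fun p : GH * GH => dcl (rep p.1 * rep p.2)%g) @` (S1 `*` S2))).
  move=> D /= hD; apply: contrapT => h; move/negP: hD; apply; apply/eqP.
  rewrite /hmul fsbig1// => e _; have [->|f1e] := eqVneq (f1 (dcl (rep e))) 0.
    by rewrite mul0r.
  have [->|f2e] := eqVneq (f2 (dcl ((rep e)^-1 * rep D)%g)) 0; first by rewrite mulr0.
  exfalso; apply: h; exists (e, cl ((rep e)^-1 * rep D)%g).
    by split=> //=; rewrite /S2/= dcl_rep_cl.
  rewrite /=; have [a Ga ->] := rep_cl ((rep e)^-1 * rep D)%g.
  by rewrite !mulgA mulgV mul1g dcl_mulr// repK.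
by apply: finite_image; exact: finite_setX.
Qed.

Lemma hecke_hstar (f : dquot Gam -> C) : hecke f -> hecke (hstar f).
Proof.
move=> hf.
apply: (@sub_finite_set _ _ ((fun D => dcl (rep D)^-1%g) @` [set D | f D != 0])); last first.
  exact: finite_image.
move=> D /= hD; exists (dcl (rep D)^-1%g).
  by apply: contraNneq hD => f0; rewrite /hstar f0 conjC0 mulr0.
have [a [b [Ga Gb ->]]] := rep_dcl (rep D)^-1%g.
by rewrite !invgM invgK mulgA dcl_mul ?repK//; exact: GamV.
Qed.

Lemma hecke_dchar g : hecke (@dchar R G Gam g).
Proof.
apply: (@sub_finite_set _ _ [set dcl g]); last exact: finite_set1.
move=> D /=; rewrite /dchar indicE; have [|] := boolP (D \in _); first by rewrite inE.
by rewrite eqxx.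
Qed.

(** Both sides sum over G / Gam; they differ by the choice of a representative of the
    double coset of c, which the translation by [a] compensates. *)
Lemma ofH_hmul (f1 f2 : dquot Gam -> C) : ofH (hmul f1 f2) = bmul (ofH f1) (ofH f2).
Proof.
apply/funext => c; apply/funext => x; rewrite /ofH /bmul /hmul /rtrans.
have [a [b [Ga Gb ->]]] := rep_dcl (rep c).
rewrite (reindex_fsbig _ _ _ _ (translate_bij a)); apply: eq_fsbigr => e _.
have [t Gt ->] := rep_cl (a * rep e)%g.
rewrite dcl_rep_cl dcl_mul//; congr (_ * f2 _).
rewrite (_ : _ * _ = t^-1 * ((rep e)^-1 * rep c) * b)%g ?dcl_mul//; first exact: GamV.
by rewrite !invgM !mulgA mulgVK.
Qed.

Lemma mat_of_hmul (f1 f2 : dquot Gam -> C) : hecke f1 -> hecke f2 ->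
  mat_of (ofH (hmul f1 f2)) = matmul (mat_of (ofH f1)) (mat_of (ofH f2)).
Proof. by move=> h1 h2; rewrite ofH_hmul mat_of_bmul//; exact: ofH_Bset. Qed.

Lemma mat_of_hstar (f : dquot Gam -> C) : mat_of (ofH (hstar f)) = matstar (mat_of (ofH f)).
Proof.
apply/funext => c; apply/funext => d; rewrite /matstar !mat_of_ofH /hstar.
have [a [b [Ga Gb E]]] := rep_dcl ((rep c)^-1 * rep d)%g.
rewrite sqrt_modular_sqr; have -> : sm (rep (dcl ((rep c)^-1 * rep d)))^-1%g = sm ((rep d)^-1 * rep c)%g.
  by rewrite E !invgM !invgK !mulgA sqrt_modular_mulr; [rewrite -mulgA sqrt_modular_mull//|]; exact: GamV.
have -> : dcl (rep (dcl ((rep c)^-1 * rep d)))^-1%g = dcl ((rep d)^-1 * rep c)%g.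
  by rewrite E !invgM !invgK !mulgA -[(_ * _ * rep c)%g]mulgA dcl_mul//; exact: GamV.
rewrite rmorphM /= [X in _ = X * _]sqrt_modular_conj.
rewrite (_ : sm ((rep c)^-1 * rep d)%g = (sm ((rep d)^-1 * rep c)%g)^-1).
  by rewrite -mulrA mulKf ?sqrt_modular_neq0.
by rewrite -sqrt_modularV invgM invgK.
Qed.

Lemma reindex_coset (c : GH) (F : GH -> C) :
  \sum_(d \in [set: GH]) F d = \sum_(e \in [set: GH]) F (cl (rep c * rep e)%g).
Proof. exact: reindex_fsbig (translate_bij (rep c)). Qed.

(** The sum over h in G / Gam that defines rho(f) is a row of the matrix after the
    substitution d = c h. *)
Lemma rho_mapp (f : dquot Gam -> C) v : hecke f -> rho f v = mapp (mat_of (ofH f)) v :> (GH -> C).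
Proof.
move=> hf; apply/funext => c; rewrite rhoE// /mapp [RHS](reindex_coset c).
apply: eq_fsbigr => e _; rewrite mat_of_ofH; have [a Ga ->] := rep_cl (rep c * rep e)%g.
by rewrite -mulgA mulKg sqrt_modular_mulr// dcl_mulr.
Qed.

Lemma mapp_ofC phi v c : rinv phi -> mapp (mat_of (ofC phi)) v c = phi (rep c) * v c.
Proof.
move=> phiG; rewrite (mappE (A := [fset c]%fset)) => [|d]; last first.
  by rewrite inE => /negPf dc; rewrite mat_of_ofC// eq_sym dc.
by rewrite big_seq_fset1 mat_of_ofC// eqxx.
Qed.

Lemma Mrep_mapp phi v : C0 Gam phi -> Mrep phi v = mapp (mat_of (ofC phi)) v :> (GH -> C).
Proof.
by move=> phi0; apply/funext => c; rewrite MrepE// mapp_ofC//; have [] := phi0.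
Qed.

Lemma Cc_C0 phi : @Cc R G Gam phi -> @C0 R G Gam phi.
Proof.
move=> [phiG fin]; split=> // e e0; apply: sub_finite_set fin.
move=> _ [x /= ex <-]; exists x => //=; apply: contraTneq ex => ->.
by rewrite rnorm0 -ltNge.
Qed.

Lemma ind_Cc x : Cc Gam (@ind R G Gam x).
Proof.
split=> [y a Ga|].
  rewrite /ind !indicE; congr (_%:R); congr nat_of_bool.
  apply/idP/idP; rewrite !inE => -[b Gb]; last by move=> <-; exists (b * a)%g; rewrite ?mulgA//; exact: GamM.
  move=> E; exists (b * a^-1)%g; first by apply: GamM => //; exact: GamV.
  by rewrite mulgA E mulgK.
apply: (@sub_finite_set _ _ [set lcoset Gam x]); last exact: finite_set1.
move=> _ [y /= hy <-] /=; apply/esym/lcosetP => //.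
move: hy; rewrite /ind indicE; case: (boolP (y \in _)); last by rewrite eqxx.
by rewrite inE => -[a Ga <-] _; rewrite mulKg.
Qed.

Lemma ind_rep x c : @ind R G Gam x (rep c) = (c == cl x)%:R.
Proof.
rewrite /ind indicE; congr (_%:R); congr nat_of_bool; apply/idP/eqP; rewrite inE.
  by move=> [a Ga E]; rewrite -[c]repK -E cl_mulr.
by move=> ->; have [a Ga ->] := rep_cl x; exists a.
Qed.

Lemma matmul_ofCl phi k c d : rinv phi -> matmul (mat_of (ofC phi)) k c d = phi (rep c) * k c d.
Proof. by move=> phiG; rewrite matmul_mapp mapp_ofC. Qed.

Lemma matmul_ofCr phi k c d : rinv phi -> matmul k (mat_of (ofC phi)) c d = k c d * phi (rep d).
Proof.
move=> phiG; rewrite /matmul (fsum_fset (A := [fset d]%fset)) => [|m]; last first.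
  by rewrite inE => /negPf md; rewrite mat_of_ofC// md mulr0.
by rewrite big_seq_fset1 mat_of_ofC// eqxx.
Qed.

Lemma ind_rinv x : rinv (@ind R G Gam x).
Proof. by have [] := ind_Cc x. Qed.

(** The spanning element is Delta(g)^(1/2) times the matrix unit at (x Gam, x g Gam). *)
Lemma elem_crossed x g : crossed (@elem R G Gam x g) /\
  mat_of (@elem R G Gam x g) =
  matmul (matmul (mat_of (ofC (@ind R G Gam x))) (mat_of (ofH (@dchar R G Gam g))))
    (mat_of (ofC (@ind R G Gam (x * g)%g))).
Proof.
have bC y : @Bset R G Gam (ofC (@ind R G Gam y)) by apply: ofC_Bset; exact: ind_rinv.
have bH : @Bset R G Gam (ofH (@dchar R G Gam g)) by apply: ofH_Bset; exact: hecke_dchar.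
set k := matmul (matmul _ _) _.
have rf := rowfin_matmul (Bset_rowfin (bC x)) (Bset_rowfin bH).
have eE : @elem R G Gam x g = of_mat k.
  rewrite /elem /k !of_mat_matmul//; last exact: Bset_rowfin.
  by rewrite !mat_ofK.
rewrite eE of_matK; split=> //; apply: of_mat_crossed; apply: finite_finmat.
apply: (@sub_finite_set _ _ [set (cl x, cl (x * g)%g)]); last exact: finite_set1.
move=> [c d] /=; rewrite /k matmul_ofCr; last exact: ind_rinv.
rewrite matmul_ofCl; last exact: ind_rinv.
rewrite !ind_rep; case: (c =P _) => [->|_]; last by rewrite !mul0r eqxx.
by case: (d =P _) => [->|_]; rewrite ?mulr0 ?eqxx.
Qed.

End crossed_product_matrices.

(** * The full norm, and a lower bound for the reduced norm *)

Section norms.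
Variables (R : realType) (G : groupType) (Gam : set G).
Hypothesis hG : hecke_pair Gam.
Local Notation C := R[i].
Local Notation GH := (lquot Gam).
Local Notation cl := (cls (lcoset Gam)).
Local Notation l2 := (ell2 GH C).
Local Notation mat := (GH -> GH -> C).
Local Notation crossed := (@crossed R G Gam).
Implicit Types (g h x y a b : G) (c d e : GH) (k l : mat) (f : GH -> G -> C).

Let hS : is_subgroup Gam. Proof. by have [] := hG. Qed.

Definition mat_norm f : R := onorm (matop (mat_of f)).

Lemma matop_star_rep :
  star_rep crossed (@bmul R G Gam) (@bstar R G Gam) (fun f => matop (mat_of f)).
Proof.
split.
- by move=> f fC; apply: matop_bounded; exact: crossed_finmat.
- by move=> r f1 f2 v h1 h2; rewrite mat_of_lin matop_lin//; exact: crossed_finmat.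
- move=> f1 f2 v h1 h2; rewrite (mat_of_bmul hG h1.1 h2.1).
  by rewrite matop_matmul//; exact: crossed_finmat.
- move=> f v w hf; rewrite (mat_of_bstar hG hf.1).
  by rewrite matop_adj//; exact: crossed_finmat.
Qed.

Lemma Cc_finmat (phi : G -> C) : Cc Gam phi -> finmat (@mat_of R G Gam (ofC phi)).
Proof.
move=> [phiG fin]; apply: finite_finmat.
have [|_ [_ + _]] // := @image_factor G _ _ (lcoset Gam) (fun x => (cl x, cl x))
    [set x | phi x != 0] _ fin.
  by move=> x y _ _ /(lcosetP _ _ hS) /(clP hG) ->.
apply: sub_finite_set => -[c d] /=; rewrite mat_of_ofC//; case: (c =P d) => [-> ph|_].
  by exists (rep d) => //; rewrite repK.
by rewrite eqxx.
Qed.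

(** On C_c(G / Gam) this representation is pointwise multiplication, which is continuous
    for the supremum norm. *)
Lemma matop_full_rep : @full_rep R G Gam l2 (fun f => matop (mat_of f)).
Proof.
split; first exact: matop_star_rep.
move=> phi hphi e e0; exists e => // psi hpsi close.
have fphi := Cc_finmat hphi; have fpsi := Cc_finmat hpsi.
apply/opnorm_leP; last 1 first.
- move=> v; have E c : (matop (mat_of (ofC psi)) v - matop (mat_of (ofC phi)) v) c =
      (psi (rep c) - phi (rep c)) *: v c.
    rewrite ell2_add ell2_opp !matopE// !mapp_ofC//; [|exact: hphi.1|exact: hpsi.1].
    by rewrite scalerBl.
  apply/rnorm_leP; first by rewrite mulr_ge0 ?rnorm_ge0// ltW.
  move=> A; rewrite exprMn; apply: le_trans (ler_wpM2l (sqr_ge0 e) (rnorm_part v A)).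
  rewrite mulr_sumr; apply: ler_sum => c _; rewrite E rnormZ exprMn.
  rewrite ler_wpM2r ?sqr_ge0// ler_sqr ?nnegrE ?rnorm_ge0 ?(ltW e0)//.
- move=> r v w; rewrite !(matop_linear fphi) !(matop_linear fpsi).
  by rewrite scalerBr addrACA opprD.
- exact: ltW.
Qed.

Lemma full_rep_le (H : hilbertType R) (Phi : (GH -> G -> C) -> H -> H) f :
  star_rep crossed (@bmul R G Gam) (@bstar R G Gam) Phi -> crossed f ->
  (opnorm (Phi f) <= (mat_norm f)%:E)%E.
Proof.
move=> [Pb Pl Pm Ps] fC; apply/opnorm_leP; [by have [] := Pb _ fC|exact: onorm_ge0|].
move=> w; rewrite -{1}(mat_ofK hG fC.1).
apply: (@matrix_rep_bound R GH H setT (fun k => Phi (of_mat k))) => //.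
- by move=> r k l v kf lf _; rewrite of_mat_lin Pl//; exact: of_mat_crossed.
- move=> k l v kf lf _; rewrite of_mat_matmul//; last exact: finmat_rowfin.
  by rewrite Pm//; exact: of_mat_crossed.
- by move=> k v v' kf _ _; rewrite of_mat_matstar// -Ps//; exact: of_mat_crossed.
- exact: crossed_finmat.
Qed.

Theorem full_normE f : crossed f -> @full_norm R G Gam f = (mat_norm f)%:E.
Proof.
move=> fC; apply/eqP; rewrite eq_le; apply/andP; split.
  apply: ge_ereal_sup => _ [H [Phi [[Prep _] ->]]]; exact: full_rep_le.
rewrite -opnormE; last by apply: matop_bounded; exact: crossed_finmat.
apply: ereal_sup_ubound; exists l2, (fun f => matop (mat_of f)); split=> //.
exact: matop_full_rep.
Qed.

Lemma fsum_tens (H : hilbertType R) (A : {fset GH}) (u : GH -> H) : supp_in A u ->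
  \sum_(d \in [set: GH]) tens (u d) (delta R d) = ftrunc A u.
Proof.
move=> uA; rewrite (fsum_fset (A := A))// => d dA.
by apply: ell2P => j; rewrite tensE uA// if_same.
Qed.

(** The character phi |-> phi(1) of D_r, as a representation on a line. It is the one
    that turns the regular representation into the action of matrices on l^2. *)
Definition ev1 (phi : G -> C) (v : C) : C := phi 1%g * v.

Lemma Dr_gen K psi : conj_inter Gam K -> Cc K psi -> @Dr R G Gam psi.
Proof. by move=> hK hpsi D D1 _ _ _ _; exact: D1 hK hpsi. Qed.

Lemma Dr_lin (r : C) (psi1 psi2 : G -> C) :
  Dr Gam psi1 -> Dr Gam psi2 -> Dr Gam (r *: psi1 + psi2).
Proof.
move=> h1 h2 D D1 D2 D3 D4 D5.
by apply/D2; [exact: (h1 D D1 D2 D3 D4 D5)|exact: (h2 D D1 D2 D3 D4 D5)].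
Qed.

Lemma Dr_mul (psi1 psi2 : G -> C) :
  Dr Gam psi1 -> Dr Gam psi2 -> Dr Gam (fmul psi1 psi2).
Proof.
move=> h1 h2 D D1 D2 D3 D4 D5.
by apply/D3; [exact: (h1 D D1 D2 D3 D4 D5)|exact: (h2 D D1 D2 D3 D4 D5)].
Qed.

Lemma ev1_rep : star_rep (@Dr R G Gam) (@fmul R G) (@fstar R G) ev1.
Proof.
split.
- move=> phi _; split; first by move=> r v w; rewrite /ev1 mulrDr scalerAr.
  by exists `|phi 1%g| => v; rewrite normrM.
- by move=> r phi psi v _ _; rewrite /ev1 mulrDl -scalerAl.
- by move=> phi psi v _ _; rewrite /ev1 /fmul mulrA.
- by move=> phi v w _; rewrite /ev1 /fstar /ip/= rmorphM /= conjCK mulrCA mulrA.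
Qed.

Lemma ev1_nondegenerate : Defs.nondegenerate (@Dr R G Gam) ev1.
Proof.
apply/seteqP; split=> // v _; apply: subset_closure.
exists 1%N, (fun=> 1), (fun=> v); split; last by rewrite big_ord1 scale1r.
move=> _; exists (@ind R G Gam 1%g); last first.
  exists v => //; rewrite /ev1 /ind indicE mem_set ?mul1r//.
  by exists 1%g; [have [] := hS|rewrite mulg1].
apply: (@Dr_gen Gam); last exact: ind_Cc.
exists [:: 1%g] => //; apply/seteqP; split=> x /=.
  by move=> Gx g; rewrite /= inE => /eqP ->; rewrite conjset1.
by move=> /(_ 1%g); rewrite conjset1; apply; rewrite /= inE.
Qed.

(** At the identity, the translate by g of f(g^-1 h) takes the value f(g^-1 h)(g), which
    is the entry at (g, h) up to Delta^(1/2). *)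
Lemma ev1_reg_op f : crossed f -> @reg_op R G Gam C ev1 f (matop (mat_of f)).
Proof.
move=> fC; have kf := crossed_finmat hG fC; split; first exact: matop_bounded.
move=> v h; have [A kA] := kf.
have E d : (sqrt_modular R Gam ((rep d)^-1 * h)%g) *:
    ev1 (rtrans (rep d) (f (cl ((rep d)^-1 * h)%g))) v = mat_of f d (cl h) * v.
  by rewrite -[in RHS](repK d) (mat_ofE hG _ _ fC.1) /ev1 /rtrans mul1g -mulrA.
under eq_fsbigr do rewrite -/(sqrt_modular R Gam _) E.
rewrite (@fsum_tens _ A) => [|d /negPf dA]; last by rewrite kA ?dA// mul0r.
apply: ell2P => c; rewrite tens_delta linopZ; last exact: matop_linear.
rewrite ell2_scale matop_delta// ftruncE; case: ifPn => [_|/negPf cA]; first by rewrite [RHS]mulrC.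
by rewrite kA ?cA// scaler0.
Qed.

End norms.

(** * The reduced norm *)

Section reduced.
Variables (R : realType) (G : groupType) (Gam : set G).
Hypothesis hG : hecke_pair Gam.
Local Notation C := R[i].
Local Notation GH := (lquot Gam).
Local Notation cl := (cls (lcoset Gam)).
Local Notation mat := (GH -> GH -> C).
Local Notation Dr := (@Dr R G Gam).
Implicit Types (g h x y a b : G) (c d e : GH) (k l : mat) (f : GH -> G -> C).

Let hS : is_subgroup Gam. Proof. by have [] := hG. Qed.

(** The function on G whose images under [pi] are the operator entries of the regular
    representation: the matrix [k], moved by all x in G at once. *)
Definition translates k c d : G -> C := fun x => k (cl (x * rep c)%g) (cl (x * rep d)%g).

(** It is invariant under the intersection K of two conjugates of Gam, and x is
    determined modulo K by the pair of cosets at which [k] is evaluated. *)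
Lemma translates_Dr k c d : finmat k -> Dr (translates k c d).
Proof.
move=> kf; pose K := conjset Gam (rep c) `&` conjset Gam (rep d).
have hK : is_subgroup K by apply: subgroupI; exact: subgroup_conj.
apply: (@Dr_gen _ _ _ K).
  exists [:: rep c; rep d] => //; apply/seteqP; split=> x.
    by move=> [xc xd] g; rewrite /= !inE => /orP[] /eqP ->.
  by move=> h; split; apply: h; rewrite /= !inE eqxx ?orbT.
have inv g x t : conjset Gam g t -> cl (x * t * g)%g = cl (x * g)%g.
  move=> /conjsetP Gt; rewrite (_ : x * t * g = x * g * (g^-1 * t * g))%g ?(cl_mulr hG _ Gt)//.
  by rewrite !mulgA mulgK.
split=> [x t [tc td]|]; first by rewrite /translates !inv.
have [||_ [_ + _]] // := @image_factor G _ _ (fun x => (cl (x * rep c)%g, cl (x * rep d)%g))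
    (lcoset K) [set x | translates k c d x != 0].
  move=> x y _ _ E; have /(clP hG) xc := congr1 fst E; have /(clP hG) xd := congr1 snd E.
  apply/lcosetP => //; split; apply/conjsetP.
    by move: xc; rewrite invgM !mulgA.
  by move: xd; rewrite invgM !mulgA.
by apply: sub_finite_set (finmat_finite kf) => _ [x /= kx <-].
Qed.

Lemma translates_col k d : finmat k ->
  exists A : {fset GH}, forall c, c \notin A -> translates k c d = 0.
Proof.
move=> kf.
have fin : finite_set [set c | translates k c d != 0].
  apply: (@sub_finite_set _ _ (\bigcup_(p in [set p : GH * GH | k p.1 p.2 != 0])
      ((fun e => cl (rep d * rep e)%g) @`
        [set e : GH | exists x, cl x = p.2 /\ cl (x * rep e)%g = p.1]))).
    move=> c /= kc; apply: contrapT => h; move/negP: kc; apply; apply/eqP/funext => x.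
    apply/eqP/negPn/negP => kx; apply: h.
    exists (cl (x * rep c)%g, cl (x * rep d)%g) => //=.
    exists (cl ((rep d)^-1 * rep c)%g); last by rewrite cl_mul_rep// mulVKg repK.
    exists (x * rep d)%g; split=> //; by rewrite cl_mul_rep// -mulgA mulVKg.
  apply: bigcup_finite => [|p _]; first exact: finmat_finite.
  by apply: finite_image; exact: finite_position.
exists (fset_set [set c | translates k c d != 0]) => c.
by rewrite in_fset_set// notin_setE /= => /negP/negPn/eqP.
Qed.

Lemma translates_cols k (s : seq GH) : finmat k ->
  exists A : {fset GH}, forall c d, d \in s -> c \notin A -> translates k c d = 0.
Proof.
move=> kf; elim: s => [|d s [A hA]]; first by exists fset0.
have [B hB] := translates_col d kf; exists (A `|` B)%fset => c d'.
rewrite !inE negb_or => + /andP[cA cB] => /predU1P[->|ds]; first exact: hB.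
exact: hA.
Qed.

Lemma translates_lin (r : C) k l c d :
  translates (r *: k + l) c d = r *: translates k c d + translates l c d.
Proof. by []. Qed.

Lemma translates_matstar k c d : translates (matstar k) c d = fstar (translates k d c).
Proof. by []. Qed.

Lemma translates_matmul k l c d (B : {fset GH}) :
  (forall m, m \notin B -> translates l m d = 0) ->
  translates (matmul k l) c d = \sum_(m <- B) fmul (translates k c m) (translates l m d).
Proof.
move=> lB; apply/funext => x; rewrite fct_sumE /translates /matmul.
rewrite (reindex_fsbig _ _ _ _ (translate_bij hG x)).
by apply: fsum_fset => m /lB/(congr1 (@^~ x)) /= E; rewrite -/(translates l m d x) E mulr0.
Qed.

Section regular_rep.
Variables (H : hilbertType R) (pi : (G -> C) -> H -> H).
Hypothesis pirep : star_rep Dr (@fmul R G) (@fstar R G) pi.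

Let W : set (ell2 GH H) := [set xi | exists A, supp_in A xi].

Definition reg_mat k (xi : ell2 GH H) : ell2 GH H :=
  mkell2 (fun c => \sum_(d \in [set: GH]) pi (translates k c d) (xi d)).

Lemma pi_linear psi : Dr psi -> linear (pi psi).
Proof. by move=> h; have [pb _ _ _] := pirep; have [] := pb _ h. Qed.

Let Dr0 : Dr 0.
Proof. exact: (@translates_Dr 0 (cl 1%g) (cl 1%g) (finmat0 R GH)). Qed.

Lemma pi0 v : pi 0 v = 0.
Proof.
have [_ pl _ _] := pirep; have := pl 1 0 0 v Dr0 Dr0.
by rewrite addr0 !scale1r => /eqP; rewrite -subr_eq subrr => /eqP.
Qed.

Lemma pi_scale (r : C) psi v : Dr psi -> pi (r *: psi) v = r *: pi psi v.
Proof.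
by move=> h; have [_ pl _ _] := pirep; rewrite -[r *: psi]addr0 pl// pi0 addr0.
Qed.

Lemma pi_sum (J : Type) (s : seq J) (psi : J -> G -> C) v : (forall j, Dr (psi j)) ->
  Dr (\sum_(j <- s) psi j) /\ pi (\sum_(j <- s) psi j) v = \sum_(j <- s) pi (psi j) v.
Proof.
have [_ pl _ _] := pirep; move=> h; elim: s => [|j s [IHd IH]].
  by rewrite !big_nil; split; [exact: Dr0|exact: pi0].
rewrite !big_cons -[psi j]scale1r; split; first exact: Dr_lin.
by rewrite pl// IH !scale1r.
Qed.

Lemma reg_matE k (xi : ell2 GH H) A : finmat k -> supp_in A xi ->
  (forall c, reg_mat k xi c = \sum_(d <- A) pi (translates k c d) (xi d)) /\
  exists B : {fset GH}, supp_in B (reg_mat k xi) /\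
    forall c d, d \in A -> c \notin B -> translates k c d = 0.
Proof.
move=> kf xiA; have [B hB] := translates_cols A kf.
have E c : \sum_(d \in [set: GH]) pi (translates k c d) (xi d) =
    \sum_(d <- A) pi (translates k c d) (xi d).
  apply: fsum_fset => d /xiA ->; rewrite linop0//; apply: pi_linear; exact: translates_Dr.
have s : supp_in B (fun c => \sum_(d \in [set: GH]) pi (translates k c d) (xi d)).
  by move=> c cB; rewrite E big_seq big1// => d dA; rewrite hB// pi0.
have rE : reg_mat k xi = (fun c => \sum_(d \in [set: GH]) pi (translates k c d) (xi d)) :> (GH -> H).
  by apply: mkell2E; exact: supp_ell2 s.
by split=> [c|]; [rewrite rE E|exists B; split=> //; rewrite rE].
Qed.

(** For a finitely supported vector all the sums are finite, so the relations needed for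
    [matrix_rep_bound] reduce to [pi] being a *-representation. *)
Lemma reg_mat_bound k xi : finmat k -> W xi ->
  rnorm (reg_mat k xi) <= onorm (matop k) * rnorm xi.
Proof.
have [_ pl pm ps] := pirep; have tD := translates_Dr.
apply: (@matrix_rep_bound R GH _ W reg_mat).
- by move=> k' v kf [A vA]; have [_ [B [sB _]]] := reg_matE kf vA; exists B.
- move=> r k1 k2 v f1 f2 [A vA]; apply: ell2P => c.
  have f12 := finmat_lin r f1 f2.
  rewrite ell2_add ell2_scale (reg_matE f12 vA).1 (reg_matE f1 vA).1 (reg_matE f2 vA).1.
  rewrite scaler_sumr -big_split /=; apply: eq_bigr => d _.
  by rewrite translates_lin pl//; exact: tD.
- move=> k1 k2 v f1 f2 [A vA]; apply: ell2P => c.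
  have [E2 [B [sB colB]]] := reg_matE f2 vA.
  rewrite (reg_matE (finmat_matmul f1 f2) vA).1 (reg_matE f1 sB).1.
  rewrite [RHS](eq_bigr (fun m => \sum_(d <- A) pi (translates k1 c m) (pi (translates k2 m d) (v d)))).
    rewrite exchange_big /=; apply: eq_big_seq => d dA.
    rewrite (@translates_matmul _ _ _ _ B) => [|m mB]; last exact: colB.
    have [_ ->] := @pi_sum _ B (fun m => fmul (translates k1 c m) (translates k2 m d)) (v d)
      (fun m => Dr_mul (tD _ _ _ f1) (tD _ _ _ f2)).
    by apply: eq_bigr => m _; rewrite pm//; exact: tD.
  by move=> m _; rewrite E2 linop_sum//; apply: pi_linear; exact: tD.
- move=> k' v w kf [A vA] [B wB]; have kf' := finmat_matstar kf.
  pose D := (A `|` B)%fset.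
  have vD : supp_in D v by move=> i; rewrite inE negb_or => /andP[/vA].
  have wD : supp_in D w by move=> i; rewrite inE negb_or => /andP[_ /wB].
  rewrite (ip_conj w) (ip_supp _ wD) rmorph_sum /= (ip_supp _ vD).
  under eq_bigr do rewrite -ip_conj (reg_matE kf vD).1 ip_suml.
  rewrite exchange_big /=; apply: eq_bigr => d _.
  rewrite (reg_matE kf' wD).1 (ip_conj (\sum_(i <- D) _)) ip_suml rmorph_sum /=.
  by apply: eq_bigr => c _; rewrite -ip_conj ps; [rewrite translates_matstar|exact: tD].
Qed.

(** [T] is bounded and agrees with [reg_mat] on the dense subspace of finitely supported
    vectors. *)
Lemma reg_op_bound f T : crossed f -> reg_op pi f T ->
  (opnorm T <= (mat_norm f)%:E)%E.
Proof.
move=> fC [Tb TE]; have [Tl _] := Tb; have kf := crossed_finmat hG fC.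
have fin A (xi : ell2 GH H) : supp_in A xi -> T xi = reg_mat (mat_of f) xi.
  move=> xiA; rewrite -{1}(ftrunc_supp xiA) /ftrunc linop_sum//; apply: ell2P => c.
  rewrite ell2_sum (reg_matE kf xiA).1; apply: eq_bigr => d _.
  rewrite -{2}(repK d) TE.
  have E e : (sqrt_modular R Gam ((rep e)^-1 * rep d)%g) *:
      pi (rtrans (rep e) (f (cl ((rep e)^-1 * rep d)%g))) (xi d) =
      pi (translates (mat_of f) e d) (xi d).
    have tE : translates (mat_of f) e d = (sqrt_modular R Gam ((rep e)^-1 * rep d)%g) *:
        (rtrans (rep e) (f (cl ((rep e)^-1 * rep d)%g))).
      apply/funext => x; rewrite /translates (mat_ofE hG _ _ fC.1).
      by rewrite invgM -mulgA mulKg.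
    rewrite -pi_scale -?tE//.
    rewrite -[X in Dr X](scalerK (sqrt_modular_neq0 R hG ((rep e)^-1 * rep d)%g)) -tE.
    by rewrite -[_ *: _]addr0; apply: Dr_lin; [exact: translates_Dr|exact: Dr0].
  under eq_fsbigr do rewrite -/(sqrt_modular R Gam _) E.
  have [B hB] := translates_col d kf.
  have uB : supp_in B (fun e => pi (translates (mat_of f) e d) (xi d)).
    by move=> e /hB ->; exact: pi0.
  by rewrite (fsum_tens uB) ftruncE; case: ifPn => // /uB ->.
apply/opnorm_leP; [exact: Tl|exact: onorm_ge0|move=> xi].
apply: le_trans (_ : mat_norm f * rnorm xi + 0 <= _); last by rewrite addr0.
apply/ler_addgt0Pr => e e0.
have T1 : 0 < onorm T + 1 by rewrite ltr_wpDl ?onorm_ge0.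
have [A xA] := ftrunc_approx xi (divr_gt0 e0 T1).
rewrite addr0 addrC -[T xi](subrK (T (ftrunc A xi))); apply: le_trans (rnormD _ _) _.
apply: lerD.
  rewrite -linopB//; apply: le_trans (onormP _ Tb) _.
  apply: le_trans (ler_wpM2l (onorm_ge0 _) xA) _.
  by rewrite mulrCA -[leRHS]mulr1 ler_wpM2l ?(ltW e0)// ler_pdivrMr// mul1r lerDl.
have sA : supp_in A (ftrunc A xi) by move=> i /negPf iA; rewrite ftruncE iA.
rewrite (fin A)//; apply: le_trans (reg_mat_bound kf _) _; first by exists A.
by rewrite ler_wpM2l ?onorm_ge0// rnorm_ftrunc.
Qed.

End regular_rep.

Theorem red_normE f : crossed f -> @red_norm R G Gam f = (mat_norm f)%:E.
Proof.
move=> fC; apply/eqP; rewrite eq_le; apply/andP; split.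
  by apply: ge_ereal_sup => _ [H [pi [T [prep _ regT ->]]]]; exact: reg_op_bound regT.
rewrite -opnormE; last by apply: matop_bounded; exact: crossed_finmat.
apply: ereal_sup_ubound; exists R[i], (@ev1 R G), (matop (mat_of f)); split=> //.
- exact: ev1_rep.
- exact: ev1_nondegenerate.
- exact: ev1_reg_op.
Qed.

End reduced.

(** * Covariance *)

Lemma lspan_sum (R : realType) (V : lmodType R[i]) (X : set V) (J : Type) (s : seq J)
    (x : J -> V) : (forall j, X (x j)) -> lspan X (\sum_(j <- s) x j).
Proof.
move=> Xx; exists (size s), (fun=> 1), (fun i => x (tnth (in_tuple s) i)).
split; first by move=> i; exact: Xx.
by rewrite big_tnth; apply: eq_bigr => i _; rewrite scale1r.
Qed.

Lemma ler_sum_supp (R : realType) (I : choiceType) (A B : {fset I}) (F : I -> R) :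
  (forall i, 0 <= F i) -> (forall i, i \notin B -> F i = 0) ->
  \sum_(i <- A) F i <= \sum_(i <- B) F i.
Proof.
move=> F0 FB; rewrite (big_fsetID _ (mem B) A) /= [X in _ + X]big_seq.
rewrite [X in _ + X]big1 => [|i]; last by rewrite !inE => /andP[_ /FB].
rewrite addr0 [leRHS](big_fsetID _ (mem A) B) /=.
have -> : [fset i in A | i \in B]%fset = [fset i in B | i \in A]%fset.
  by apply/fsetP => i; rewrite !inE andbC.
by rewrite lerDl sumr_ge0.
Qed.

(** Twice the difference of the two sides is the sum of a_i a_j (x_i - x_j)^2. *)
Lemma weighted_sqr (R : realType) (J : Type) (s : seq J) (a x : J -> R) :
  (forall j, 0 <= a j) ->
  (\sum_(j <- s) a j * x j) ^+ 2 <= (\sum_(j <- s) a j) * \sum_(j <- s) a j * x j ^+ 2.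
Proof.
move=> a0; rewrite expr2 -subr_ge0 -(pmulr_rge0 _ (ltr0Sn R 1)).
have -> : 2%:R * ((\sum_(j <- s) a j) * (\sum_(j <- s) a j * x j ^+ 2) -
    (\sum_(j <- s) a j * x j) * (\sum_(j <- s) a j * x j)) =
  \sum_(i <- s) \sum_(j <- s) a i * a j * (x i - x j) ^+ 2.
  have -> : \sum_(i <- s) \sum_(j <- s) a i * a j * (x i - x j) ^+ 2 =
      \sum_(i <- s) \sum_(j <- s) (a i * (a j * x j ^+ 2) + a j * (a i * x i ^+ 2)
        - 2%:R * ((a i * x i) * (a j * x j))).
    by apply: eq_bigr => i _; apply: eq_bigr => j _; ring.
  under [RHS]eq_bigr do rewrite sumrB big_split /= -!mulr_sumr -mulr_suml.
  rewrite sumrB big_split /= -!mulr_sumr -!mulr_suml.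
  by ring.
by apply: sumr_ge0 => i _; apply: sumr_ge0 => j _; rewrite mulr_ge0 ?sqr_ge0// mulr_ge0.
Qed.

(** The Cauchy-Schwarz inequality with the weights |k(c, d)| bounds each coordinate by
    the row sums; exchanging the sums then brings in the column sums. *)
Lemma Schur_test (R : realType) (I : choiceType) (k : I -> I -> R[i]) (alpha beta : R)
    (v : ell2 I R[i]) : rowfin k -> 0 <= alpha -> 0 <= beta ->
  (forall c (A : {fset I}), \sum_(d <- A) rnorm (k c d : R[i]) <= alpha) ->
  (forall d (A : {fset I}), \sum_(c <- A) rnorm (k c d : R[i]) <= beta) ->
  forall A : {fset I},
    \sum_(c <- A) rnorm (mapp k v c : R[i]) ^+ 2 <= alpha * beta * rnorm v ^+ 2.
Proof.
move=> kf a0 b0 ka kb A.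
have [B hB] : exists B : {fset I}, forall c d, c \in A -> d \notin B -> k c d = 0.
  suff [B hB] : exists B : {fset I}, forall c d, c \in (A : seq I) -> d \notin B -> k c d = 0.
    by exists B.
  elim: (A : seq I) => [|c s [B hB]]; first by exists fset0.
  have [D hD] := rowfin_fset c kf; exists (B `|` D)%fset => c' d.
  rewrite !inE negb_or => + /andP[dB dD] => /predU1P[->|cs]; first exact: hD.
  exact: hB.
apply: (@le_trans _ _ (\sum_(c <- A) alpha * \sum_(d <- B) rnorm (k c d : R[i]) * rnorm (v d) ^+ 2)).
  rewrite big_seq [leRHS]big_seq; apply: ler_sum => c cA.
  rewrite (mappE (A := B)); last by move=> d; exact: hB.
  apply: (@le_trans _ _ ((\sum_(d <- B) rnorm (k c d : R[i]) * rnorm (v d)) ^+ 2)).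
    rewrite ler_sqr ?nnegrE ?rnorm_ge0//; last first.
      by apply: sumr_ge0 => d _; rewrite mulr_ge0 ?rnorm_ge0.
    apply: le_trans (rnorm_sum _ _) _; apply: ler_sum => d _.
    by rewrite -[k c d * v d]/(k c d *: v d) rnormZ.
  apply: le_trans (weighted_sqr _ _ _) _; first by move=> d; exact: rnorm_ge0.
  by rewrite ler_wpM2r// sumr_ge0// => d _; rewrite mulr_ge0 ?rnorm_ge0 ?sqr_ge0.
rewrite -mulr_sumr -mulrA ler_wpM2l// exchange_big /=.
apply: (@le_trans _ _ (\sum_(d <- B) beta * rnorm (v d) ^+ 2)).
  by apply: ler_sum => d _; rewrite -mulr_suml ler_wpM2r ?sqr_ge0.
by rewrite -mulr_sumr ler_wpM2l ?rnorm_part.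
Qed.

Section covariance.
Variables (R : realType) (G : groupType) (Gam : set G).
Hypothesis hG : hecke_pair Gam.
Local Notation C := R[i].
Local Notation GH := (lquot Gam).
Local Notation cl := (cls (lcoset Gam)).
Local Notation dcl := (cls (dcoset Gam)).
Local Notation l2 := (ell2 GH C).
Local Notation M := (@Mrep R G Gam).
Local Notation rho := (@rho R G Gam).
Local Notation ind := (@ind R G Gam).
Local Notation dchar := (@dchar R G Gam).
Local Notation matC phi := (@mat_of R G Gam (ofC phi)).
Local Notation matH f := (@mat_of R G Gam (ofH f)).
Implicit Types (x g : G) (c d : GH) (v w : l2) (phi psi : G -> C).

Let hS : is_subgroup Gam. Proof. by have [] := hG. Qed.

Definition fbounded phi := exists2 B : R, 0 <= B & forall x, rnorm (phi x) <= B.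

Lemma C0_fbounded phi : C0 Gam phi -> fbounded phi.
Proof.
move=> /(C0_bounded hS)[B hB]; exists B => //.
by apply: le_trans (hB 1%g); exact: rnorm_ge0.
Qed.

Lemma mult_bound phi (B : R) v (A : {fset GH}) : 0 <= B -> (forall x, rnorm (phi x) <= B) ->
  \sum_(c <- A) rnorm (phi (rep c) * v c : C) ^+ 2 <= (B * rnorm v) ^+ 2.
Proof.
move=> B0 hB; rewrite exprMn; apply: le_trans (ler_wpM2l (sqr_ge0 _) (rnorm_part v A)).
rewrite mulr_sumr; apply: ler_sum => c _.
rewrite -[phi _ * _]/(phi (rep c) *: v c) rnormZ exprMn ler_wpM2r ?sqr_ge0//.
by rewrite ler_sqr ?nnegrE ?rnorm_ge0.
Qed.

Lemma Mrep_bE phi v c : fbounded phi -> M phi v c = phi (rep c) * v c.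
Proof.
move=> [B B0 hB]; rewrite -[M phi v]/(mkell2 (fun c => phi (rep c) * v c)) mkell2E//.
by apply/ell2_boundP; exists ((B * rnorm v) ^+ 2) => A; exact: mult_bound.
Qed.

Lemma Mrep_bounded phi : fbounded phi -> bounded_op (M phi).
Proof.
move=> hb; have [B B0 hB] := hb; apply/bounded_opP; split.
  move=> r v w; apply: ell2P => c; rewrite ell2_add ell2_scale !Mrep_bE//.
  by rewrite ell2_add ell2_scale mulrDr scalerAr.
exists B => // v; apply/rnorm_leP; first by rewrite mulr_ge0 ?rnorm_ge0.
by move=> A; under eq_bigr do rewrite Mrep_bE//; exact: mult_bound.
Qed.

Lemma Mrep_star_rep : star_rep (@C0 R G Gam) (@fmul R G) (@fstar R G) M.
Proof.
split.
- by move=> phi /C0_fbounded; exact: Mrep_bounded.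
- move=> r phi psi v /C0_fbounded h1 /C0_fbounded h2; apply: ell2P => c.
  rewrite ell2_add ell2_scale !Mrep_bE//; first by rewrite !fctE mulrDl -scalerAl.
  have [B1 B10 b1] := h1; have [B2 B20 b2] := h2.
  exists (rnorm (r : C) * B1 + B2); first by rewrite addr_ge0// mulr_ge0 ?rnorm_ge0.
  move=> x; apply: le_trans (rnormD _ _) _; apply: lerD => //.
  by rewrite rnormZ ler_wpM2l ?rnorm_ge0.
- move=> phi psi v /C0_fbounded h1 /C0_fbounded h2; apply: ell2P => c.
  rewrite !Mrep_bE//; first by rewrite /fmul mulrA.
  have [B1 B10 b1] := h1; have [B2 B20 b2] := h2.
  exists (B1 * B2); first exact: mulr_ge0.
  move=> x; rewrite /fmul -[phi x * psi x]/(phi x *: psi x) rnormZ.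
  by rewrite ler_pM ?rnorm_ge0.
- move=> phi v w /C0_fbounded hb.
  have hb' : fbounded (fstar phi).
    have [B B0 hB] := hb; exists B => // x.
    by rewrite /fstar /rnorm norm_conjC; exact: hB.
  have Mb : bounded_op (M phi) by exact: Mrep_bounded.
  rewrite (ip_adj _ _ Mb); suff -> : adj (M phi) w = M (fstar phi) w by [].
  apply: ell2P => c.
  rewrite Mrep_bE// mkell2E; last exact: adj_ell2.
  rewrite (_ : M phi (delta R c) = phi (rep c) *: delta R c) ?ipZr ?ip_delta//.
  apply: ell2P => d; rewrite Mrep_bE// ell2_scale deltaE; case: (d =P c) => [->//|_].
  by rewrite mulr0 scaler0.
Qed.

Lemma Cc_fbounded phi : Cc Gam phi -> fbounded phi.
Proof. by move=> /Cc_C0; exact: C0_fbounded. Qed.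

Lemma Mrep_Cc_rep : star_rep (@Cc R G Gam) (@fmul R G) (@fstar R G) M.
Proof.
have [h1 h2 h3 h4] := Mrep_star_rep; have sub := Cc_C0.
by split; [move=> a /sub/h1|move=> r a b v /sub ? /sub ?; exact: h2
  |move=> a b v /sub ? /sub ?; exact: h3|move=> a v w /sub; exact: h4].
Qed.

Lemma Mrep_ind c v : M (ind (rep c)) v = tens (v c) (delta R c).
Proof.
apply: ell2P => d; rewrite Mrep_bE; last by apply: Cc_fbounded; exact: ind_Cc.
by rewrite ind_rep// repK tensE; case: (d =P c) => [->|_]; rewrite ?mul1r ?mul0r.
Qed.

Lemma ftrunc_lspan (A : {fset GH}) v :
  lspan [set M phi u | phi in Cc Gam & u in [set: l2]] (ftrunc A v).
Proof.
rewrite /ftrunc; under eq_bigr do rewrite -Mrep_ind.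
apply: lspan_sum => c; exists (ind (rep c)); first exact: ind_Cc.
by exists v.
Qed.

Lemma Mrep_nondegenerate : Defs.nondegenerate (@Cc R G Gam) M.
Proof.
apply/seteqP; split=> // v _; apply/closure_rnormP => e e0.
have [A vA] := ftrunc_approx v e0; exists (ftrunc A v) => //; exact: ftrunc_lspan.
Qed.

Lemma cov_spaceP v : cov_space Gam M v <-> exists A, supp_in A v.
Proof.
split=> [[n [k [u [hu ->]]]]|[A vA]]; last first.
  by rewrite -(ftrunc_supp vA); exact: ftrunc_lspan.
have hA i : exists A, supp_in A (u i).
  have [phi hphi [w _ <-]] := hu i; have [A kA] := Cc_finmat hG hphi.
  exists A => c cA; rewrite Mrep_bE; last exact: Cc_fbounded.
  rewrite (_ : phi (rep c) = matC phi c c); first by rewrite kA ?(negPf cA)// mul0r.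
  by rewrite mat_of_ofC ?eqxx//; exact: hphi.1.
have [A AP] := choice hA.
exists (\bigcup_(i <- enum 'I_n) A i)%fset => c cA; rewrite ell2_sum big1// => i _.
rewrite ell2_scale AP ?scaler0//; apply: contra cA => ci.
by apply/bigfcupP; exists i; rewrite ?mem_enum.
Qed.

(** The absolute values in the row of [c] are those of Delta^(1/2) f, permuted by the
    translation by c; their sum does not depend on the row. *)
Lemma row_sum_matH f : hecke f -> exists2 B : R, 0 <= B &
  forall c (A : {fset GH}), \sum_(d <- A) rnorm (matH f c d : C) <= B.
Proof.
move=> hf; pose F (e : GH) : R := rnorm (sqrt_modular R Gam (rep e) * f (dcl (rep e)) : C).
pose S := fset_set [set e : GH | f (dcl (rep e)) != 0].
exists (\sum_(e <- S) F e); first by apply: sumr_ge0 => e _; exact: rnorm_ge0.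
move=> c A.
have inj : injective (fun d : GH => cl ((rep c)^-1 * rep d)%g).
  by move=> d e /(congr1 val)/=; exact: lcoset_trans_inj.
rewrite (eq_bigr (fun d => F (cl ((rep c)^-1 * rep d)%g))) => [|d _]; last first.
  rewrite mat_of_ofH// /F dcl_rep_cl//; have [a Ga ->] := rep_cl hG ((rep c)^-1 * rep d)%g.
  by rewrite sqrt_modular_mulr.
have -> : \sum_(d <- A) F (cl ((rep c)^-1 * rep d)%g) =
    \sum_(e <- [fset cl ((rep c)^-1 * rep d)%g | d in A]%fset) F e.
  by rewrite big_imfset//= => d e _ _; exact: inj.
apply: ler_sum_supp => e; first exact: rnorm_ge0.
rewrite in_fset_set; last exact: hecke_support.
by rewrite notin_setE /= => /negP/negPn/eqP f0; rewrite /F f0 mulr0 rnorm0.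
Qed.

Lemma matH_rowfin f : hecke f -> rowfin (matH f).
Proof. by move=> hf; apply: Bset_rowfin => //; exact: ofH_Bset. Qed.

(** The rows have uniformly bounded sums, and so have the columns, which are the rows of
    the matrix of the adjoint [hstar f]. *)
Lemma rho_bounded f : hecke f ->
  exists2 B : R, 0 <= B & forall v, rnorm (rho f v) <= B * rnorm v.
Proof.
move=> hf; have [a a0 ha] := row_sum_matH hf.
have [b b0 hb] := row_sum_matH (hecke_hstar hG hf).
exists (Num.sqrt (a * b)); first exact: sqrtr_ge0.
move=> v; apply/rnorm_leP; first by rewrite mulr_ge0 ?sqrtr_ge0 ?rnorm_ge0.
move=> A; rewrite exprMn sqr_sqrtr ?mulr_ge0//.
under eq_bigr do rewrite rho_mapp//.
apply: Schur_test => //; first exact: matH_rowfin.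
move=> d D; apply: le_trans (hb d D); rewrite mat_of_hstar//.
by apply: ler_sum => c _; rewrite /matstar /rnorm norm_conjC.
Qed.

Lemma mapp_linear k (r : C) (u w : GH -> C) : rowfin k ->
  mapp k (r *: u + w) = r *: mapp k u + mapp k w.
Proof.
move=> kf; apply/funext => c; have [A kA] := rowfin_fset c kf.
rewrite -[RHS]/(r * mapp k u c + mapp k w c) !(mappE (A := A))//.
rewrite mulr_sumr -big_split; apply: eq_bigr => d _ /=.
by rewrite -[(r *: u + w) d]/(r * u d + w d); ring.
Qed.

Lemma rho_suppE f v (A : {fset GH}) c : hecke f -> supp_in A v ->
  rho f v c = \sum_(d <- A) matH f c d * v d.
Proof. by move=> hf vA; rewrite rho_mapp//; apply: fsum_fset => d /vA ->; rewrite mulr0. Qed.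

Lemma rho_supp f v : hecke f -> (exists A, supp_in A v) -> exists A, supp_in A (rho f v).
Proof.
move=> hf [A vA]; have rf := matH_rowfin (hecke_hstar hG hf).
have [B hB] : exists B : {fset GH}, forall c d, d \in (A : seq GH) -> c \notin B -> matH f c d = 0.
  elim: (A : seq GH) => [|d s [B hB]]; first by exists fset0.
  have [D hD] := rowfin_fset d rf; exists (B `|` D)%fset => c d'.
  rewrite !inE negb_or => + /andP[cB cD] => /predU1P[->|ds]; last exact: hB.
  by apply/eqP; rewrite -conjC_eq0 -/(matstar (matH f) d c) -mat_of_hstar// hD.
exists B => c cB; rewrite (rho_suppE _ hf vA) big_seq big1// => d dA.
by rewrite hB// mul0r.
Qed.

Lemma rho_adj f v w : hecke f -> (exists A, supp_in A v) -> (exists A, supp_in A w) ->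
  ip (rho f v) w = ip v (rho (hstar f) w) :> C.
Proof.
move=> hf [A vA] [B wB]; have hf' := hecke_hstar hG hf.
rewrite (ip_conj w) (ip_supp _ wB) rmorph_sum /= (ip_supp _ vA).
under eq_bigr do rewrite -ip_conj (rho_suppE _ hf vA) /ip/= mulr_suml.
rewrite exchange_big /=; apply: eq_bigr => d _.
rewrite (rho_suppE _ hf' wB) /ip/= rmorph_sum mulr_sumr; apply: eq_bigr => c _.
have cE (a b : C) : (a^* * b)^* = a * b^* by rewrite rmorphM /= conjCK.
by rewrite mat_of_hstar// -mulrA mulrCA; congr (_ * _); exact: esym (cE _ _).
Qed.

Lemma rho_unit v : rho (dchar 1%g) v = v.
Proof.
apply: ell2P => c; have h1 := hecke_dchar R Gam 1%g.
rewrite rho_mapp//.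
have E d : matH (dchar 1%g) c d = if d == c then 1 else 0.
  rewrite mat_of_ofH// /dchar indicE.
  have -> : (dcl ((rep c)^-1 * rep d)%g \in [set dcl 1%g]) = (d == c).
    have [G1 GM GV] := hS; apply/idP/eqP => [|->]; rewrite inE /=; last by rewrite mulVg.
    move=> /(congr1 val)/= E; have : dcoset Gam 1%g ((rep c)^-1 * rep d)%g.
      by rewrite -E; exists 1%g => //; exists 1%g => //; rewrite mul1g mulg1.
    move=> [a Ga [b Gb e]]; rewrite -(repK d) -(repK c); apply/esym/(clP hG).
    by rewrite -e mulg1; exact: GM.
  by case: (d =P c) => [->|_]; rewrite ?mulr0// mulVg sqrt_modular_Gam ?mulr1//; have [] := hS.
rewrite (mappE (A := [fset c]%fset)) => [|d]; first by rewrite big_seq_fset1 E eqxx mul1r.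
by rewrite inE E => /negPf ->.
Qed.

Lemma elem_mapp x g v :
  mapp (mat_of (@elem R G Gam x g)) v = M (ind x) (rho (dchar g) (M (ind (x * g)%g) v)).
Proof.
have hd := hecke_dchar R Gam g.
have rC y : rowfin (matC (ind y)).
  by apply: finmat_rowfin; apply: Cc_finmat => //; exact: ind_Cc.
have ME y u : M (ind y) u = mapp (matC (ind y)) u :> (GH -> C).
  by apply: Mrep_mapp => //; apply: Cc_C0 => //; exact: ind_Cc.
rewrite (elem_crossed R hG x g).2 mapp_matmul//; last first.
  by apply: rowfin_matmul => //; exact: matH_rowfin.
by rewrite (mapp_matmul _ (rC x) (matH_rowfin hd)) (ME x) (rho_mapp hG _ hd) (ME (x * g)%g).
Qed.

Lemma mapp_mat_of_sum (J : Type) (s : seq J) (r : J -> C) (f : J -> GH -> G -> C) (u : GH -> C) :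
  (forall j, rowfin (mat_of (f j))) ->
  rowfin (mat_of (\sum_(j <- s) r j *: f j)) /\
  mapp (mat_of (\sum_(j <- s) r j *: f j)) u = \sum_(j <- s) r j *: mapp (mat_of (f j)) u.
Proof.
move=> rf; elim: s => [|j s [IHr IH]].
  have k0 : mat_of (0 : GH -> G -> C) = 0 :> (GH -> GH -> C).
    by apply/funext => c; apply/funext => d; exact: mulr0.
  rewrite !big_nil k0; split; first exact: finmat_rowfin (finmat0 R GH).
  by apply/funext => c; rewrite (mappE (A := fset0)) ?big_seq_fset0.
have rr : rowfin (r j *: mat_of (f j)).
  move=> c; apply: sub_finite_set (rf j c) => d /=; apply: contraNneq => kd.
  by rewrite matZ kd mulr0.
rewrite !big_cons mat_of_lin; split; last by rewrite mappD// mappZ// IH.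
move=> c; apply: (@sub_finite_set _ _ ([set d | (r j *: mat_of (f j)) c d != 0] `|`
    [set d | mat_of (\sum_(i <- s) r i *: f i) c d != 0])); last by rewrite finite_setU.
move=> d /=; rewrite matD; have [->|] := eqVneq ((r j *: mat_of (f j)) c d) 0; last by left.
by rewrite add0r; right.
Qed.

(** Passing to matrices of covariant functions is linear and multiplicative, so an
    identity in the crossed product becomes an identity between operators on arbitrary
    functions on G / Gam. *)
Lemma Mrep_rho_decomposition (g x s : G) n (k : 'I_n -> C) (y h : 'I_n -> G) v :
  bmul (bmul (ofH (dchar g)) (ofC (ind x))) (ofH (dchar s)) =
    \sum_(i < n) k i *: @elem R G Gam (y i) (h i) ->
  rho (dchar g) (M (ind x) (rho (dchar s) v)) =
  \sum_(i < n) k i *: M (ind (y i)) (rho (dchar (h i)) (M (ind (y i * h i)%g) v)).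
Proof.
move=> E; apply: ell2P => c.
have hd t := hecke_dchar R Gam t.
have bH t : @Bset R G Gam (ofH (dchar t)) by exact: ofH_Bset.
have bC : @Bset R G Gam (ofC (ind x)) by apply: ofC_Bset => //; exact: ind_rinv.
have rH t := Bset_rowfin hG (bH t); have rC := Bset_rowfin hG bC.
have [_ Esum] := @mapp_mat_of_sum _ (index_enum 'I_n) k (fun i => @elem R G Gam (y i) (h i)) v
  (fun i => finmat_rowfin (crossed_finmat hG (elem_crossed R hG (y i) (h i)).1)).
rewrite ell2_sum rho_mapp// (Mrep_mapp hG); last by apply: Cc_C0 => //; exact: ind_Cc.
rewrite rho_mapp// -!mapp_matmul//; last exact: rowfin_matmul.
have <- : mat_of (bmul (bmul (ofH (dchar g)) (ofC (ind x))) (ofH (dchar s))) =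
    matmul (matmul (matH (dchar g)) (matC (ind x))) (matH (dchar s)).
  rewrite -{1}(mat_ofK hG (bH g)) -{1}(mat_ofK hG bC) -{1}(mat_ofK hG (bH s)).
  by rewrite -!of_mat_matmul ?of_matK//; exact: rowfin_matmul.
rewrite E Esum fct_sumE; apply: eq_bigr => i _.
by rewrite ell2_scale -elem_mapp.
Qed.

Theorem Mrep_rho_covariant : covariant_rep M rho.
Proof.
split; last first.
  move=> f hf; have [B B0 hB] := rho_bounded hf.
  exists B%:C%C => v _; rewrite !rnormE -rmorphM lecR; exact: hB.
split.
- exact: Mrep_Cc_rep.
- exact: Mrep_nondegenerate.
- by move=> f v hf /cov_spaceP h; apply/cov_spaceP; exact: rho_supp.
- move=> f r v w hf _ _; apply: ell2P => c.
  rewrite ell2_add ell2_scale !rho_mapp//.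
  by rewrite (mapp_linear r v w (matH_rowfin hf)).
- move=> r f1 f2 v h1 h2 _; apply: ell2P => c.
  rewrite ell2_add ell2_scale !rho_mapp//; last exact: hecke_lin.
  rewrite -[ofH (r *: f1 + f2)]/(r *: ofH f1 + ofH f2) mat_of_lin mappD ?mappZ//; try exact: matH_rowfin.
  move=> c'; apply: sub_finite_set (matH_rowfin h1 c') => d /=; apply: contraNneq => kd.
  by rewrite matZ kd mulr0.
- move=> f1 f2 v h1 h2 _; apply: ell2P => c.
  rewrite !rho_mapp//; last exact: hecke_hmul.
  by rewrite mat_of_hmul// mapp_matmul//; exact: matH_rowfin.
- by move=> f v w hf /cov_spaceP h1 /cov_spaceP h2; exact: rho_adj.
- by move=> v _; exact: rho_unit.
- by move=> g x s n k y h E v _; exact: Mrep_rho_decomposition.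
Qed.

End covariance.

(** * The completions *)

Section compact_completion.
Variables (R : realType) (G : groupType) (Gam : set G).
Hypothesis hG : hecke_pair Gam.
Local Notation C := R[i].
Local Notation GH := (lquot Gam).
Local Notation l2 := (ell2 GH C).
Local Notation crossed := (@crossed R G Gam).
Local Notation cpt := (@cpt R GH).
Local Notation is_compl N := (is_completion crossed (@bmul R G Gam) (@bstar R G Gam) N).
Implicit Types (f : GH -> G -> C).

Lemma crossed_lin (r : C) f1 f2 : crossed f1 -> crossed f2 -> crossed (r *: f1 + f2).
Proof.
move=> h1 h2; rewrite -(mat_ofK hG h1.1) -(mat_ofK hG h2.1) -of_mat_lin; apply: of_mat_crossed => //.
by apply: finmat_lin; exact: crossed_finmat.
Qed.

Lemma crossed_bmul f1 f2 : crossed f1 -> crossed f2 -> crossed (bmul f1 f2).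
Proof.
move=> h1 h2; have k1 := crossed_finmat hG h1; have k2 := crossed_finmat hG h2.
rewrite -(mat_ofK hG h1.1) -(mat_ofK hG h2.1) -of_mat_matmul//; last exact: finmat_rowfin.
by apply: of_mat_crossed => //; exact: finmat_matmul.
Qed.

Lemma crossed_bstar f : crossed f -> crossed (bstar f).
Proof.
move=> h; rewrite -(mat_ofK hG h.1) -of_mat_matstar//; apply: of_mat_crossed => //.
by apply: finmat_matstar; exact: crossed_finmat.
Qed.

Lemma to_cpt_exists : exists j : (GH -> G -> C) -> cpt,
  forall f, crossed f -> forall v, j f v = matop (mat_of f) v.
Proof.
exists (fun f => insubd 0 (matop (mat_of f))) => f fC v; congr (_ v).
rewrite -[LHS]/(val _) insubdK//.
by apply/cpt_predP; apply: fin_approx_matop; exact: crossed_finmat.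
Qed.

Lemma to_cpt_completion (N : (GH -> G -> C) -> \bar R) (j : (GH -> G -> C) -> cpt) :
  (forall f, crossed f -> N f = (mat_norm f)%:E) ->
  (forall f, crossed f -> forall v, j f v = matop (mat_of f) v) -> is_compl N j.
Proof.
move=> NE jE; have [_ kl km _] := matop_star_rep R hG; split.
- move=> r f1 f2 h1 h2; apply: cptP => v.
  apply: etrans (jE _ (crossed_lin r h1 h2) v) _.
  apply: etrans (kl r f1 f2 v h1 h2) _.
  by rewrite -(jE _ h1) -(jE _ h2).
- move=> f1 f2 h1 h2; apply: cptP => v.
  apply: etrans (jE _ (crossed_bmul h1 h2) v) _.
  apply: etrans (km f1 f2 v h1 h2) _.
  by rewrite -(jE _ h2) -(jE _ h1).
- move=> f h; apply: cptP => v.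
  apply: etrans (jE _ (crossed_bstar h) v) _.
  rewrite (mat_of_bstar hG h.1) -adj_matop; last exact: crossed_finmat.
  by have -> : matop (mat_of f) = j f by apply/funext => w; rewrite jE.
- move=> f h; rewrite NE// /mat_norm; congr (_%:E).
  by have -> : matop (mat_of f) = j f by apply/funext => w; rewrite jE.
- apply/seteqP; split=> // t _; apply/closure_rnormP => e e0.
  have [k kf kt] := cpt_approx t e0.
  have uk := of_mat_crossed hG kf; exists (j (of_mat k)); first by exists (of_mat k).
  rewrite rnorm_cpt; apply: onorm_le; [exact: ltW|exact: cpt_linear|move=> v].
  by rewrite cpt_addE cpt_oppE jE// of_matK//; exact: kt.
Qed.

Lemma completion_iso (N N' : (GH -> G -> C) -> \bar R) (A B : cstarAlgType R)
    (jA : (GH -> G -> C) -> A) (jB : (GH -> G -> C) -> B) :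
  (forall f, crossed f -> N f = (mat_norm f)%:E) ->
  (forall f, crossed f -> N' f = (mat_norm f)%:E) ->
  is_compl N jA -> is_compl N' jB ->
  exists F : A -> B,
    [/\ linear F, {morph F : x y / cmul x y}, {morph F : x / cstar x}, bijective F &
        forall f, crossed f -> F (jA f) = jB f].
Proof.
move=> NE NE' cA [lB mB sB nB dB].
apply: (completion_unique crossed_lin crossed_bmul crossed_bstar cA); split=> //.
by move=> f h; rewrite nB// NE// NE'.
Qed.

(** Compose the isomorphism onto the concrete completion [cpt] with the inclusion of
    [cpt] in the operators on l^2. *)
Lemma completion_compact (N : (GH -> G -> C) -> \bar R) (A : cstarAlgType R)
    (j : (GH -> G -> C) -> A) :
  (forall f, crossed f -> N f = (mat_norm f)%:E) -> is_compl N j ->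
  exists Psi : A -> l2 -> l2,
    [/\ cstar_rep Psi, injective Psi, range Psi = @compact_op R l2 &
        forall f, crossed f -> Psi (j f) = matop (mat_of f)].
Proof.
move=> NE cj.
have [j' j'E] := to_cpt_exists.
have [F [Fl Fm Fs Fb Fj]] := completion_iso NE NE cj (to_cpt_completion NE j'E).
have [Fi [F' _ F'K]] := (bij_inj Fb, Fb).
have [tb tl tm ts] := @cpt_val_rep R GH.
exists (fun a => cpt_val (F a)); split.
- split.
  + by move=> a _; exact: tb.
  + by move=> r a b x _ _; rewrite Fl; exact: tl.
  + by move=> a b x _ _; rewrite Fm; exact: tm.
  + by move=> a x y _; rewrite Fs; exact: ts.
- by move=> a b /(@val_inj _ _ cpt)/Fi.
- rewrite -range_cpt; apply/seteqP; split=> [_ [a _ <-]|_ [t _ <-]]; first by exists (F a).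
  by exists (F' t) => //; rewrite F'K.
- by move=> f h; apply/funext => v; rewrite Fj// j'E.
Qed.

End compact_completion.

Theorem theorem5p3 (R : realType) (G : groupType) (Gam : set G)
    (hG : hecke_pair Gam) :
  let l2 : hilbertType R := ell2 (lquot Gam) R[i] in
  let M : (G -> R[i]) -> l2 -> l2 := @Mrep R G Gam in
  let rho_r : (dquot Gam -> R[i]) -> l2 -> l2 := @rho R G Gam in
  (* the full crossed product exists *)
  full_crossed_product_exists R Gam /\
  (exists (Af : cstarAlgType R) (jf : (lquot Gam -> G -> R[i]) -> Af),
     is_full_crossed_product jf) /\
  (exists (Ar : cstarAlgType R) (jr : (lquot Gam -> G -> R[i]) -> Ar),
     is_reduced_crossed_product jr) /\
  (* full = reduced = compact operators *)
  (forall (Af : cstarAlgType R) (jf : (lquot Gam -> G -> R[i]) -> Af)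
          (Ar : cstarAlgType R) (jr : (lquot Gam -> G -> R[i]) -> Ar),
     is_full_crossed_product jf -> is_reduced_crossed_product jr ->
     cstar_iso Af Ar /\ iso_compact Ar l2) /\
  (* (M, rho) is covariant *)
  star_rep (@C0 R G Gam) (@fmul R G) (@fstar R G) M /\
  covariant_rep M rho_r /\
  (* its integrated form is faithful, with range the compact operators *)
  (forall (Af : cstarAlgType R) (jf : (lquot Gam -> G -> R[i]) -> Af),
     is_full_crossed_product jf ->
     exists Psi : Af -> l2 -> l2,
       [/\ integrated_form M rho_r jf Psi, injective Psi &
           range Psi = @compact_op R l2]).
Proof.
have fullE := @full_normE R G Gam hG; have redE := @red_normE R G Gam hG.
have [j jE] := to_cpt_exists R hG.
split; first by move=> f fC; rewrite fullE// ltry.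
split; first by exists (cpt R (lquot Gam)), j; exact: to_cpt_completion.
split; first by exists (cpt R (lquot Gam)), j; exact: to_cpt_completion.
split.
  move=> Af jf Ar jr cf cr; split.
    by have [F [Fl Fm Fs Fb _]] := completion_iso hG fullE redE cf cr; exists F.
  by have [Psi [Pr Pi Prange _]] := completion_compact hG redE cr; exists Psi.
split; first exact: Mrep_star_rep.
split; first exact: Mrep_rho_covariant.
move=> Af jf cf; have [Psi [Pr Pi Prange Pj]] := completion_compact hG fullE cf.
exists Psi; split=> //; split=> // x g v.
have [eC _] := elem_crossed R hG x g.
rewrite Pj//; apply: ell2P => c; rewrite matopE; last exact: crossed_finmat.
by rewrite elem_mapp.
Qed.
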